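(* Let the assumptions (A1)–(A7) of the context hold. We can choose $\alpha_t=1/\sqrt t$ and $\beta_t=c/\sqrt t$, where $c>0$ is an appropriate constant chosen depending on the problem parameters, such that the sequence of iterates produced by the Single Sample Actor Critic algorithm satisfies $$\frac{1}{t/2}\sum_{k=t/2}^{t-1}\|\nabla_k\|^2=O\left(\delta^2+\frac{\mu^{-1}}{\sqrt t}\right),\qquad \frac{1}{t/2}\sum_{k=t/2}^{t-1}\|\Delta_k\|^2=O\left(\delta^2+\frac{\mu^{-1}}{\sqrt t}\right),$$ where $\nabla_k=\nabla V(\theta_k)$, $\Delta_k=\omega_k-\omega_{\theta_k}$, and all quantities except $\delta,\mu,t$ are treated as constants in the $O(\cdot)$-notation.
   Context: Setting. Consider a Markov decision process with finite state set and finite action set; when action $a$ is taken in state $s$ the next state is $s_{\rm next}$ with probability $P(s_{\rm next}|s,a)$ and a (random) cost with expectation $c(s,a)$ is incurred. $\gamma\in(0,1)$ is the discount factor, $c_t$ is the cost at step $t$, $\eta$ is a fixed initial distribution of the state. $\pi_\theta(a|s)$ is a family of randomized policies parametrized by a vector $\theta$. $Q^*_\theta(s,a)=E[\sum_{t\ge 0}\gamma^t c_t]$ when one starts by taking $a$ in $s$ and follows $\pi_\theta$ thereafter; $J^*_\theta(s)=E[\sum_{t\ge0}\gamma^tc_t]$ when one starts in $s$ and follows $\pi_\theta$; $V(\theta)=\sum_s\eta(s)J^*_\theta(s)$. $p_{t,\theta}(s)$ is the probability that the state at time $t$ is $s$ when the initial state is drawn from $\eta$ and $\pi_\theta$ is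 followed. $\nu_\theta$ is the distribution on state-action pairs $\nu_\theta(s,a)=(1-\gamma)\sum_{t\ge0}\gamma^tp_{t,\theta}(s)\pi_\theta(a|s)$. Fixed feature vectors $\phi(s,a)$ are given; $\Phi$ is the matrix with rows $\phi(s,a)^T$. $\rho_\theta$ is the stationary distribution over state-action pairs of $\pi_\theta$, and $\mu_\theta$ is the distribution of $(s',a',s'',a'')$ where $(s',a')\sim\rho_\theta$, $s''\sim P(\cdot|s',a')$, $a''\sim\pi_\theta(\cdot|s'')$; $c'$ is the cost incurred in the transition from $(s',a')$. Put $A_\theta=E[\phi(s',a')(\gamma\phi(s'',a'')-\phi(s',a'))^T]$, with $(s',a',s'',a'')\sim\mu_\theta$. $\omega_\theta$ is the limit of the unprojected TD(0) iteration $\omega_{t+1}=\omega_t+\alpha_t(c'+\gamma\phi(s'',a'')^T\omega_t-\phi(s',a')^T\omega_t)\phi(s',a')$ with the policy fixed to $\pi_\theta$ (a fresh tuple being drawn from $\mu_\theta$ at each step). $\|\cdot\|$ is the Euclidean (or induced operator) norm. Assumptions. (A1) There is a finite $C_{\max}$ such that the costs $c_t$ lie in $[-C_{\max},C_{\max}]$ with probability one. (A2) With $\rho_{t,\theta}$ the distribution over state-action pairs after $t$ transitions of following $\pi_\theta$, there are a distribution $\rho_\theta$ and constants $C$ and $\lambda\in[0,1)$, with $C,\lambda$ not depending on $\theta$, such that $\|\rho_{t,\theta}-\rho_\theta\|_1\le C\lambda^t$. (A3) $\pi_\theta(a|s)$ is a thrice continuously differentiable function of $\theta$ for all $s,a$,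 and there are constants $K,K',K''$ with $\|\nabla_\theta\log\pi_\theta(a|s)\|\le K$, $\|\nabla_\theta\pi_\theta(a|s)\|\le K'$, $\|\nabla_\theta^2\pi_\theta(a|s)\|\le K''$ for all $\theta,s,a$. (A4) The columns of $\Phi$ are linearly independent and each row of $\Phi$ has at most unit norm. (A5) For some $\delta>0$, $\sup_\theta E_{(s,a)\sim\nu_\theta}|Q^*_\theta(s,a)-\phi(s,a)^T\omega_\theta|\le\delta$. (A6) There is $\mu\in(0,1)$ with $\sup_\theta\sup_{\|x\|=1}x^TA_\theta x\le-\mu/2<0$. (A7) $\Omega$ is a compact convex set which contains all of the vectors $\omega_\theta$ in its interior; $P_\Omega$ is the Euclidean projection onto $\Omega$. Algorithm (Single Sample Actor Critic). Start at arbitrary $\theta_1,\omega_1$. For $t=1,2,\ldots$: generate a pair $(s_t,a_t)$ from $\nu_{\theta_t}$ and a four-tuple $(s_t',a_t',s_t'',a_t'')$ from $\mu_{\theta_t}$, with associated cost $c_t'$, independently of each other and of all past samples, and update $$\theta_{t+1}=\theta_t-\beta_t\left(\phi(s_t,a_t)^T\omega_t\right)\nabla_\theta\log\pi_{\theta_t}(a_t|s_t),$$ $$\omega_{t+1}=P_\Omega\left[\omega_t+\alpha_t\left(c_t'+\gamma\phi(s_t'',a_t'')^T\omega_t-\phi(s_t',a_t')^T\omega_t\right)\phi(s_t',a_t')\right].$$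
   Formalization: Since the iterates are random, the two averages are proved for the expected squared norms; the O-constant, besides the fixed problem constants, may depend on bounds for the first and second derivatives of the limit vector in the policy parameter. *)

(* Defs.v *)
From HB Require Import structures.
From mathcomp Require Import all_boot all_order all_algebra.
From mathcomp Require Import all_classical all_reals all_analysis.

Set Implicit Arguments.
Unset Strict Implicit.
Unset Printing Implicit Defensive.

Import Order.TTheory GRing.Theory Num.Theory.
Import numFieldNormedType.Exports.

Local Open Scope classical_set_scope.
Local Open Scope ring_scope.

(* Vectors are row vectors.  The library norm on 'rV[R]_n is the sup norm,
   hence the separate Euclidean norm; both give the same topology. *)
Definition dotv (R : realType) n (u v : 'rV[R]_n) : R :=
  \sum_(i < n) u 0 i * v 0 i.

Definition enorm (R : realType) n (u : 'rV[R]_n) : R := Num.sqrt (dotv u u).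

Definition opnorm (R : realType) n (B : 'M[R]_n) : R :=
  sup [set enorm (x *m B) | x in [set x : 'rV[R]_n | enorm x <= 1]].

Definition partial (R : realType) n (f : 'rV[R]_n -> R) (i : 'I_n)
    (x : 'rV[R]_n) : R := 'D_(delta_mx 0 i) f x.

Definition grad (R : realType) n (f : 'rV[R]_n -> R) (x : 'rV[R]_n) : 'rV[R]_n :=
  \row_i partial f i x.

Definition hess (R : realType) n (f : 'rV[R]_n -> R) (x : 'rV[R]_n) : 'M[R]_n :=
  \matrix_(i, j) partial (partial f i) j x.

Fixpoint ktimes_cdiff (R : realType) n (k : nat) (f : 'rV[R]_n -> R) : Prop :=
  if k is k'.+1 then
    continuous f /\ forall i : 'I_n,
      (forall x : 'rV[R]_n, derivable f x (delta_mx 0 i)) /\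
      ktimes_cdiff k' (partial f i)
  else continuous f.

(* These are real suprema, so they are 0 by convention on an unbounded set. *)
Definition sup_grad (R : realType) n d (f : 'rV[R]_n -> 'rV[R]_d) : R :=
  sup [set r | exists x i, r = enorm (grad (fun y => f y 0 i) x)].

Definition sup_hess (R : realType) n d (f : 'rV[R]_n -> 'rV[R]_d) : R :=
  sup [set r | exists x i, r = opnorm (hess (fun y => f y 0 i) x)].

Definition is_proj (R : realType) d (Om : set 'rV[R]_d) (x y : 'rV[R]_d) : Prop :=
  Om y /\ forall z, Om z -> enorm (x - y) <= enorm (x - z).

Definition is_dist (R : realType) (F : finType) (p : F -> R) : Prop :=
  (forall x, 0 <= p x) /\ \sum_x p x = 1.

Definition point_dist (R : realType) (F : finType) (x y : F) : R := (y == x)%:R.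

(* [costlaw s a s'] is the law of the cost incurred in the transition from [s]
   to [s'] under action [a]; the expected cost c(s,a) of the pair (s,a) is the
   average of its mean over s' drawn from [trans s a]. *)
Record mdp (R : realType) (S A : finType) := Mdp {
  trans : S -> A -> S -> R ;
  costlaw : S -> A -> S -> probability (measurableTypeR R) R ;
  transP : forall s a, is_dist (trans s a)
}.

Section processes.
Context (R : realType) (dT : measure_display) (T : measurableType dT).

Definition observable (F : finType) (Z : nat -> T -> F) (C : nat -> T -> R) : Prop :=
  (forall t z, measurable (Z t @^-1` [set z])) /\
  (forall t, measurable_fun [set: T] (C t : T -> measurableTypeR R)).

(* The sigma-algebra generated by the pairs (Z i, C i) for m <= i < t. *)
Definition past (F : finType) (Z : nat -> T -> F) (C : nat -> T -> R)
    (m t : nat) : set (set T) :=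
  <<s [set E | exists i, (m <= i < t)%N /\
        ((exists z, E = Z i @^-1` [set z]) \/
         (exists B : set (measurableTypeR R), measurable B /\ E = C i @^-1` B))] >>.

(* Given the past samples, sample t is [z] with probability [q w z] (which may
   depend on the past through w), and given [z] the associated cost has law
   [kap z]. *)
Definition fresh_sample (F : finType) (P : probability T R)
    (Z : nat -> T -> F) (C : nat -> T -> R) (m t : nat) (q : T -> F -> R)
    (kap : F -> probability (measurableTypeR R) R) : Prop :=
  forall (E : set T) (z : F) (B : set (measurableTypeR R)),
    past Z C m t E -> measurable B ->
    P (E `&` Z t @^-1` [set z] `&` C t @^-1` B) =
      ((\int[P]_(w in E) (q w z)%:E) * kap z B)%E.

(* (X t) and (C t) are the state-action pairs and the costs obtained by drawing
   X 0 from [xi] and following the policy [pi] afterwards. *)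
Definition is_trajectory (S A : finType) (M : mdp R S A) (pi : S -> A -> R)
    (xi : S * A -> R) (P : probability T R) (X : nat -> T -> S * A)
    (C : nat -> T -> R) : Prop :=
  [/\ observable X C,
      forall x, P (X 0%N @^-1` [set x]) = (xi x)%:E
    & forall (t : nat) (E : set T) (x y : S * A) (B : set (measurableTypeR R)),
        past X C 0 t E -> measurable B ->
        P (E `&` X t @^-1` [set x] `&` C t @^-1` B `&` X t.+1 @^-1` [set y]) =
          (P (E `&` X t @^-1` [set x]) *
           (trans M x.1 x.2 y.1 * pi y.1 y.2)%:E *
           costlaw M x.1 x.2 y.1 B)%E].

End processes.

(* The trajectories live on a canonical space [T] with coordinate maps [visit]
   and [cost]; [law theta xi] is the measure on [T] under which the initial
   state-action pair has distribution [xi] and the policy is pi_theta.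
   [rho theta] and [omega theta] stand for rho_theta and omega_theta; they are
   determined by [uniform_mixing] and [is_td_limit] below. *)
Record problem (R : realType) (S A : finType) (n d : nat)
    (dT : measure_display) (T : measurableType dT) := Problem {
  model :> mdp R S A ;
  eta : S -> R ;
  policy : 'rV[R]_n -> S -> A -> R ;
  feature : S -> A -> 'rV[R]_d ;
  rho : 'rV[R]_n -> S * A -> R ;
  omega : 'rV[R]_n -> 'rV[R]_d ;
  visit : nat -> T -> S * A ;
  cost : nat -> T -> R ;
  law : 'rV[R]_n -> (S * A -> R) -> probability T R ;
  etaP : is_dist eta ;
  policyP : forall theta s, is_dist (policy theta s) ;
  lawP : forall theta xi, is_dist xi ->
    is_trajectory model (policy theta) xi (law theta xi) visit cost
}.

Section actor_critic.
Context (R : realType) (S A : finType) (n d : nat).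
Context (dT : measure_display) (T : measurableType dT).
Context (pb : problem R S A n d T) (gamma : R).

Local Notation M := (model pb).
Local Notation phi := (feature pb).

Definition start (theta : 'rV[R]_n) (xi : S -> R) (x : S * A) : R :=
  xi x.1 * policy pb theta x.1 x.2.

Definition discounted_cost (w : T) : R :=
  limn (fun N => \sum_(t < N) gamma ^+ t * cost pb t w).

Definition Qstar (theta : 'rV[R]_n) (s : S) (a : A) : R :=
  fine ('E_(law pb theta (point_dist R (s, a)))[discounted_cost])%E.

Definition Jstar (theta : 'rV[R]_n) (s : S) : R :=
  fine ('E_(law pb theta (start theta (point_dist R s)))[discounted_cost])%E.

Definition V (theta : 'rV[R]_n) : R := \sum_s eta pb s * Jstar theta s.

Definition state_prob (t : nat) (theta : 'rV[R]_n) (s : S) : R :=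
  fine (law pb theta (start theta (eta pb)) [set w | (visit pb t w).1 = s]).

Definition nu (theta : 'rV[R]_n) (x : S * A) : R :=
  (1 - gamma) *
  limn (fun N => \sum_(t < N) gamma ^+ t * state_prob t theta x.1
                              * policy pb theta x.1 x.2).

Definition rho_t (t : nat) (theta : 'rV[R]_n) (xi : S -> R) (x : S * A) : R :=
  fine (law pb theta (start theta xi) (visit pb t @^-1` [set x])).

Definition mu_law (theta : 'rV[R]_n) (y : (S * A) * (S * A)) : R :=
  rho pb theta y.1 * trans M y.1.1 y.1.2 y.2.1 * policy pb theta y.2.1 y.2.2.

Definition mu_cost (y : (S * A) * (S * A)) : probability (measurableTypeR R) R :=
  costlaw M y.1.1 y.1.2 y.2.1.

Definition A_mx (theta : 'rV[R]_n) : 'M[R]_d :=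
  \sum_(y : (S * A) * (S * A)) mu_law theta y *:
    ((phi y.1.1 y.1.2)^T *m (gamma *: phi y.2.1 y.2.2 - phi y.1.1 y.1.2)).

Definition td_step (alpha : R) (y : (S * A) * (S * A)) (c : R) (w : 'rV[R]_d) :
    'rV[R]_d :=
  w + (alpha * (c + gamma * dotv (phi y.2.1 y.2.2) w - dotv (phi y.1.1 y.1.2) w))
      *: phi y.1.1 y.1.2.

(* [w] is the almost sure limit of a TD(0) iteration with step sizes [alpha]
   satisfying the Robbins-Monro conditions.  The limit is the same for all such
   step sizes and initial vectors, so one convergent run determines it. *)
Definition is_td_limit (theta : 'rV[R]_n) (w : 'rV[R]_d) : Prop :=
  exists (dU : measure_display) (U : measurableType dU) (P : probability U R)
    (Y : nat -> U -> (S * A) * (S * A)) (C : nat -> U -> R)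
    (alpha : nat -> R) (w0 : 'rV[R]_d) (om : nat -> U -> 'rV[R]_d),
    [/\ observable Y C,
        forall t, fresh_sample P Y C 0 t (fun=> mu_law theta) mu_cost,
        [/\ forall t, 0 < alpha t, series alpha @ \oo --> +oo
          & cvgn (series (fun t => alpha t ^+ 2))],
        (forall u, om 0%N u = w0) /\
        (forall t u, om t.+1 u = td_step (alpha t) (Y t u) (C t u) (om t u))
      & {ae P, forall u, (fun t => om t u) @ \oo --> w}].

Definition bounded_costs (Cmax : R) : Prop :=
  forall s a s', 0 < trans M s a s' -> costlaw M s a s' [set` `[- Cmax, Cmax]] = 1%E.

Definition uniform_mixing (C lam : R) : Prop :=
  forall theta : 'rV[R]_n, is_dist (rho pb theta) /\
    forall (xi : S -> R) (t : nat), is_dist xi ->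
      \sum_x `|rho_t t theta xi x - rho pb theta x| <= C * lam ^+ t.

Definition smooth_policy (K K' K'' : R) : Prop :=
  forall s a, ktimes_cdiff 3 (fun theta => policy pb theta s a) /\
    forall theta, [/\ 0 < policy pb theta s a,
      enorm (grad (fun th => ln (policy pb th s a)) theta) <= K,
      enorm (grad (fun th => policy pb th s a) theta) <= K'
    & opnorm (hess (fun th => policy pb th s a) theta) <= K''].

Definition Phi : 'M[R]_(#|{: S * A}|, d) :=
  \matrix_(i < #|{: S * A}|) phi (enum_val i).1 (enum_val i).2.

Definition good_features : Prop :=
  row_free Phi^T /\ forall s a, enorm (phi s a) <= 1.

Definition approximation_error (delta : R) : Prop :=
  0 < delta /\ forall theta : 'rV[R]_n,
    \sum_(x : S * A) nu theta x *
      `|Qstar theta x.1 x.2 - dotv (phi x.1 x.2) (omega pb theta)| <= delta.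

Definition critic_conditioning (mu : R) : Prop :=
  0 < mu < 1 /\ forall (theta : 'rV[R]_n) (x : 'rV[R]_d), enorm x = 1 ->
    dotv (x *m A_mx theta) x <= - (mu / 2).

Definition contains_critics (Om : set 'rV[R]_d) : Prop :=
  forall theta, interior Om (omega pb theta).

(* The iterations are indexed from 1: the values at index 0 are irrelevant.
   Sample t is ((s_t, a_t), ((s'_t, a'_t), (s''_t, a''_t))) with cost C t. *)
Definition is_ssac (Om : set 'rV[R]_d) (theta1 : 'rV[R]_n) (omega1 : 'rV[R]_d)
    (alpha beta : nat -> R)
    (dU : measure_display) (U : measurableType dU) (P : probability U R)
    (Z : nat -> U -> (S * A) * ((S * A) * (S * A))) (C : nat -> U -> R)
    (th : nat -> U -> 'rV[R]_n) (om : nat -> U -> 'rV[R]_d) : Prop :=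
  [/\ observable Z C,
      forall t, (0 < t)%N ->
        fresh_sample P Z C 1 t
          (fun u z => nu (th t u) z.1 * mu_law (th t u) z.2)
          (fun z => mu_cost z.2),
      forall u, th 1%N u = theta1 /\ om 1%N u = omega1,
      forall t u, (0 < t)%N ->
        let s := (Z t u).1.1 in let a := (Z t u).1.2 in
        th t.+1 u = th t u - (beta t * dotv (phi s a) (om t u))
          *: grad (fun theta => ln (policy pb theta s a)) (th t u)
    & forall t u, (0 < t)%N ->
        is_proj Om (td_step (alpha t) (Z t u).2 (C t u) (om t u)) (om t.+1 u)].

End actor_critic.

(* Main.v *)
(* Let a_k and b_k be the mean squares of the gradient of V at theta_k and of
   the critic error omega_k - omega_{theta_k}.  By the policy gradient theorem
   the mean actor step is a gradient step whose bias is at most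
   K (delta + |omega_k - omega_{theta_k}|), so mean V decreases at each step by
   a multiple of beta_k a_k, up to multiples of beta_k (delta^2 + b_k) and
   beta_k^2.  The critic error contracts by 1 - mu alpha_k, while its target
   omega_theta moves with theta.  To first order the mean motion is the Jacobian
   of omega_theta applied to the mean actor step, which costs only a multiple of
   beta_k (a_k + b_k + delta^2).  With beta_k = eps mu alpha_k and eps small
   these two inequalities form a stable feedback loop, and summation by parts
   over the window [t/2, t) gives both rates.
   The curvature of omega_theta enters only through beta_k^2.  As omega_theta
   solves a smooth linear system whose inverse is bounded by 2 / mu, its
   curvature is of order mu^-2 and is absorbed by (eps mu)^2.  The linear system
   itself is recovered from the almost sure convergence of TD(0): the
   Robbins-Monro estimate in L2 forces the limit to be the root of the mean
   field. *)
Require Import Defs.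
From HB Require Import structures.
From mathcomp Require Import all_boot all_order all_algebra.
From mathcomp Require Import all_classical all_reals all_analysis.
From mathcomp Require Import measurable_realfun ring lra.

Set Implicit Arguments.
Unset Strict Implicit.
Unset Printing Implicit Defensive.

Import Order.TTheory GRing.Theory Num.Theory.
Import numFieldNormedType.Exports.

Local Open Scope classical_set_scope.
Local Open Scope ring_scope.

(** * Euclidean norms and smooth functions *)

(** The constant in O(.) is fixed before the problem instance, [delta] and [mu], so every estimate
    is uniform in [theta] and the powers of [mu] are tracked explicitly. This is why smoothness is
    one number attached to a function, and why [smooth_system] records the power of the bound on the
    inverse. Fresh samples are specified only through events of the past. As the sample space is
    finite, conditional expectations become finite sums over sample values, and an identity on past
    events extends to bounded past functions by [functional_eq0]. Applying it requires the iterates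
    to be measurable for the past, which in turn calls for continuity in [theta] of the score
    function, [rho] and [omega], and continuity of the projection. The value function is not
    differentiated under its series: an exact performance difference identity yields a quadratic
    Taylor bound whose linear part is the policy gradient. Likewise [rho] is not differentiated as a
    limit: mixing becomes a bounded inverse of a matrix, and one lemma on smooth linear systems
    serves for both [rho] and [omega]. *)

Lemma le_of_eq (R : realType) (x y : R) : x = y -> x <= y.
Proof. by move->. Qed.

Lemma coordB (R : realType) n (u v : 'rV[R]_n) i : (u - v) 0 i = u 0 i - v 0 i.
Proof. by rewrite !mxE. Qed.

Section euclid.
Context (R : realType) (n : nat).
Implicit Types (u v w : 'rV[R]_n) (a b : R).

Lemma dotvC u v : dotv u v = dotv v u.
Proof. by apply: eq_bigr => i _; rewrite mulrC. Qed.

Lemma dotvDl u v w : dotv (u + v) w = dotv u w + dotv v w.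
Proof. by rewrite -big_split; apply: eq_bigr => i _; rewrite mxE mulrDl. Qed.

Lemma dotvZl a u v : dotv (a *: u) v = a * dotv u v.
Proof. by rewrite mulr_sumr; apply: eq_bigr => i _; rewrite mxE mulrA. Qed.

Lemma dotvNl u v : dotv (- u) v = - dotv u v.
Proof. by rewrite -scaleN1r dotvZl mulN1r. Qed.

Lemma dotvBl u v w : dotv (u - v) w = dotv u w - dotv v w.
Proof. by rewrite dotvDl dotvNl. Qed.

Lemma dotv0l u : dotv 0 u = 0.
Proof. by rewrite -(scale0r 0) dotvZl mul0r. Qed.

Lemma dotvDr u v w : dotv u (v + w) = dotv u v + dotv u w.
Proof. by rewrite dotvC dotvDl ![dotv _ u]dotvC. Qed.

Lemma dotvZr a u v : dotv u (a *: v) = a * dotv u v.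
Proof. by rewrite dotvC dotvZl dotvC. Qed.

Lemma dotvNr u v : dotv u (- v) = - dotv u v.
Proof. by rewrite dotvC dotvNl dotvC. Qed.

Lemma dotvBr u v w : dotv u (v - w) = dotv u v - dotv u w.
Proof. by rewrite dotvDr dotvNr. Qed.

Lemma dotv0r u : dotv u 0 = 0.
Proof. by rewrite dotvC dotv0l. Qed.

Lemma dotv_suml (I : Type) (r : seq I) (p : pred I) (f : I -> 'rV[R]_n) u :
  dotv (\sum_(i <- r | p i) f i) u = \sum_(i <- r | p i) dotv (f i) u.
Proof.
by elim/big_rec2: _ => [|i x y _ <-]; rewrite ?dotv0l // dotvDl.
Qed.

Lemma dotv_sumr (I : Type) (r : seq I) (p : pred I) (f : I -> 'rV[R]_n) u :
  dotv u (\sum_(i <- r | p i) f i) = \sum_(i <- r | p i) dotv u (f i).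
Proof. by rewrite dotvC dotv_suml; apply: eq_bigr => i _; rewrite dotvC. Qed.

Lemma dotvv_ge0 u : 0 <= dotv u u.
Proof. by apply: sumr_ge0 => i _; rewrite -expr2 sqr_ge0. Qed.

Lemma enorm_ge0 u : 0 <= enorm u.
Proof. exact: sqrtr_ge0. Qed.

Lemma sqr_enorm u : enorm u ^+ 2 = dotv u u.
Proof. by rewrite sqr_sqrtr ?dotvv_ge0. Qed.

Lemma enorm0 : enorm (0 : 'rV[R]_n) = 0.
Proof. by rewrite /enorm dotv0l sqrtr0. Qed.

Lemma enorm0_eq0 u : enorm u = 0 -> u = 0.
Proof.
move=> /(congr1 (fun x => x ^+ 2)); rewrite sqr_enorm expr0n /= => /eqP.
rewrite psumr_eq0 => [/allP h|i _]; last by rewrite -expr2 sqr_ge0.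
apply/rowP => i; have := h i (mem_index_enum _); rewrite mxE.
by rewrite -expr2 sqrf_eq0 => /eqP.
Qed.

Lemma enormZ a u : enorm (a *: u) = `|a| * enorm u.
Proof.
by rewrite /enorm dotvZl dotvZr mulrA -expr2 sqrtrM ?sqr_ge0 // sqrtr_sqr.
Qed.

Lemma enormN u : enorm (- u) = enorm u.
Proof. by rewrite -scaleN1r enormZ normrN1 mul1r. Qed.

Lemma enormB u v : enorm (u - v) = enorm (v - u).
Proof. by rewrite -enormN opprB. Qed.

Lemma dotv_le u v : `|dotv u v| <= enorm u * enorm v.
Proof.
have [v0|v0] := eqVneq (enorm v) 0.
  by rewrite (enorm0_eq0 v0) dotv0r normr0 enorm0 mulr0.
have vp : 0 < dotv v v by rewrite -sqr_enorm exprn_gt0 // lt0r v0 enorm_ge0.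
(* Cauchy-Schwarz: the squared norm of this multiple of the component of [u] orthogonal to [v] is
   [c * (c * a - b ^+ 2)]. *)
have := dotvv_ge0 (dotv v v *: u - dotv u v *: v).
rewrite dotvBl !dotvBr !dotvZl !dotvZr (dotvC v u).
set a := dotv u u; set b := dotv u v; set c := dotv v v => h.
have {}h : 0 <= c * (c * a - b ^+ 2) by apply: le_trans h _; apply: le_of_eq; ring.
rewrite pmulr_rge0 // subr_ge0 in h.
rewrite -(@ler_pXn2r _ 2) ?nnegrE ?mulr_ge0 ?enorm_ge0 //.
by rewrite real_normK ?num_real // exprMn !sqr_enorm mulrC.
Qed.

Lemma dotv_le_r u v : dotv u v <= enorm u * enorm v.
Proof. exact: le_trans (ler_norm _) (dotv_le u v). Qed.

Lemma sqr_enormD u v :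
  enorm (u + v) ^+ 2 = enorm u ^+ 2 + 2 * dotv u v + enorm v ^+ 2.
Proof. rewrite !sqr_enorm dotvDl !dotvDr (dotvC v u); ring. Qed.

Lemma sqr_enormB u v :
  enorm (u - v) ^+ 2 = enorm u ^+ 2 - 2 * dotv u v + enorm v ^+ 2.
Proof. by rewrite sqr_enormD enormN dotvNr mulrN. Qed.

Lemma enormD u v : enorm (u + v) <= enorm u + enorm v.
Proof.
rewrite -(@ler_pXn2r _ 2) ?nnegrE ?addr_ge0 ?enorm_ge0 //.
rewrite sqr_enormD sqrrD; have := dotv_le_r u v; lra.
Qed.

Lemma enorm_sum (I : Type) (r : seq I) (p : pred I) (f : I -> 'rV[R]_n) :
  enorm (\sum_(i <- r | p i) f i) <= \sum_(i <- r | p i) enorm (f i).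
Proof.
elim/big_rec2: _ => [|i x y _ h]; first by rewrite enorm0.
by rewrite (le_trans (enormD _ _)) // lerD2l.
Qed.

Lemma sqr_enormD_le u v : enorm (u + v) ^+ 2 <= 2 * enorm u ^+ 2 + 2 * enorm v ^+ 2.
Proof.
have := sqr_ge0 (enorm (u - v)); rewrite sqr_enormD sqr_enormB; lra.
Qed.

Lemma sqr_enormB_le u v : enorm (u - v) ^+ 2 <= 2 * enorm u ^+ 2 + 2 * enorm v ^+ 2.
Proof. by rewrite -(enormN v) sqr_enormD_le. Qed.

Lemma coord_enorm u i : `|u 0 i| <= enorm u.
Proof.
rewrite -(@ler_pXn2r _ 2) ?nnegrE ?enorm_ge0 // real_normK ?num_real //.
rewrite sqr_enorm /dotv (bigD1 i) //= -expr2 lerDl.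
by apply: sumr_ge0 => j _; rewrite -expr2 sqr_ge0.
Qed.

Lemma dotv_delta u i : dotv u (delta_mx 0 i) = u 0 i.
Proof.
rewrite /dotv (bigD1 i) //= mxE !eqxx mulr1 big1 ?addr0 // => j ji.
by rewrite mxE (negPf ji) andbF mulr0.
Qed.

Lemma enorm_delta i : enorm (delta_mx 0 i : 'rV[R]_n) = 1.
Proof. by rewrite /enorm dotv_delta mxE !eqxx sqrtr1. Qed.

Lemma enorm_le_sum u : enorm u <= \sum_i `|u 0 i|.
Proof.
rewrite {1}(row_sum_delta u) (le_trans (enorm_sum _ _ _)) // ler_sum // => i _.
by rewrite enormZ enorm_delta mulr1.
Qed.

Lemma enorm_le_bound u B : (forall i, `|u 0 i| <= B) -> enorm u <= n%:R * B.
Proof.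
move=> h; rewrite (le_trans (enorm_le_sum u)) //.
by rewrite (le_trans (ler_sum _ (fun i _ => h i))) // sumr_const card_ord mulr_natl.
Qed.

Lemma enorm_lipschitz u v : `|enorm u - enorm v| <= enorm (u - v).
Proof.
have h1 := enormD (u - v) v; rewrite subrK in h1.
have h2 := enormD (v - u) u; rewrite subrK (enormB v) in h2.
by rewrite ler_norml; apply/andP; split; lra.
Qed.

Lemma enorm_le_norm u : enorm u <= n%:R * `|u|.
Proof. by apply: enorm_le_bound => i; rewrite [`|u|]mx_normrE; apply: le_trans (le_bigmax _ _ (0, i)). Qed.

End euclid.

Section smooth.
Context (R : realType) (n : nat).
Implicit Types (f : 'rV[R]_n -> R) (g : 'rV[R]_n -> 'rV[R]_n) (x h : 'rV[R]_n).

Definition taylor f g (L : R) := forall x h,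
  `|f (x + h) - f x - dotv (g x) h| <= L * enorm h ^+ 2.

(* A bound on f, on its gradient and on its quadratic Taylor remainder: unlike
   second derivatives, this passes directly to products and to solutions of
   linear systems. *)
Definition smooth (B : R) f := exists g,
  [/\ forall x, `|f x| <= B, forall x, enorm (g x) <= B & taylor f g B].

Lemma smooth_ge0 B f : smooth B f -> 0 <= B.
Proof. by move=> [g [h _ _]]; apply: le_trans (h 0). Qed.

Lemma smooth_le B B' f : B <= B' -> smooth B f -> smooth B' f.
Proof.
move=> BB [g [h1 h2 h3]]; exists g; split => [x|x|x h].
- exact: le_trans (h1 x) BB.
- exact: le_trans (h2 x) BB.
- by apply: le_trans (h3 x h) _; rewrite ler_wpM2r // sqr_ge0.
Qed.

(** For increments of norm at most 1 the quadratic remainder is dominated by a linear term; for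
    longer ones the bound on [f] itself suffices. *)
Lemma smooth_lip B f : smooth B f ->
  forall x h, `|f (x + h) - f x| <= 2 * B * enorm h.
Proof.
move=> sf x h; have B0 := smooth_ge0 sf; case: sf => g [h1 h2 h3].
have e0 := enorm_ge0 h; have [e1|e1] := leP (enorm h) 1.
  have -> : f (x + h) - f x = (f (x + h) - f x - dotv (g x) h) + dotv (g x) h by ring.
  rewrite (le_trans (ler_normD _ _)) // (le_trans (lerD (h3 _ _) (dotv_le _ _))) //.
  have k1 : enorm (g x) * enorm h <= B * enorm h by rewrite ler_wpM2r.
  have k2 : B * enorm h ^+ 2 <= B * enorm h.
    by rewrite ler_wpM2l // expr2 ler_piMr.
  lra.
rewrite (le_trans (ler_normB _ _)) // (le_trans (lerD (h1 _) (h1 _))) //.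
have : B <= B * enorm h by rewrite ler_peMr // ltW.
lra.
Qed.

Lemma smooth_cst c B : `|c| <= B -> smooth B (fun=> c).
Proof.
move=> cB; have B0 : 0 <= B by apply: le_trans cB.
exists (fun=> 0); split => // [x|x h]; first by rewrite enorm0.
by rewrite dotv0l subrr subr0 normr0 mulr_ge0 // sqr_ge0.
Qed.

Lemma smooth_add B B' f f' : smooth B f -> smooth B' f' ->
  smooth (B + B') (fun x => f x + f' x).
Proof.
move=> [g [h1 h2 h3]] [g' [h1' h2' h3']].
exists (fun x => g x + g' x); split => [x|x|x h].
- exact: le_trans (ler_normD _ _) (lerD (h1 x) (h1' x)).
- exact: le_trans (enormD _ _) (lerD (h2 x) (h2' x)).
- rewrite dotvDl mulrDl; apply: le_trans (lerD (h3 x h) (h3' x h)).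
  by apply: le_trans (ler_normD _ _); apply: le_of_eq; congr `|_|; ring.
Qed.

Lemma smooth_sum B (I : finType) (f : I -> 'rV[R]_n -> R) :
  (forall i, smooth B (f i)) -> smooth (#|I|%:R * B) (fun x => \sum_i f i x).
Proof.
move=> sf.
have key : forall r : seq I, smooth ((size r)%:R * B) (fun x => \sum_(i <- r) f i x).
  elim=> [|i r IH].
    by under eq_fun do rewrite big_nil; apply: smooth_cst; rewrite normr0 mul0r.
  under eq_fun do rewrite big_cons.
  by rewrite /= -natr1 mulrDl mul1r addrC; apply: smooth_add.
have <- : size (index_enum I) = #|I| by rewrite -(sum1_size (index_enum I)) sum1_card.
exact: key.
Qed.

(** The 6 is 1 + 1 + 4: one remainder from each factor, and the product of the two increments, each
    Lipschitz with twice its constant by [smooth_lip]. *)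
Lemma smooth_mul B B' f f' : smooth B f -> smooth B' f' ->
  smooth (6 * B * B') (fun x => f x * f' x).
Proof.
move=> sf sf'; have B0 := smooth_ge0 sf; have B0' := smooth_ge0 sf'.
have lf := smooth_lip sf; have lf' := smooth_lip sf'.
case: sf => g [h1 h2 h3]; case: sf' => g' [h1' h2' h3'].
have BB : 0 <= B * B' by rewrite mulr_ge0.
exists (fun x => f x *: g' x + f' x *: g x); split => [x|x|x h].
- rewrite normrM; apply: (@le_trans _ _ (B * B')); first exact: ler_pM.
  by rewrite -mulrA; lra.
- apply: le_trans (enormD _ _) _; rewrite !enormZ.
  apply: (@le_trans _ _ (B * B' + B' * B)).
    by apply: lerD; apply: ler_pM => //; exact: enorm_ge0.
  by rewrite -mulrA (mulrC B' B); lra.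
- have -> : f (x + h) * f' (x + h) - f x * f' x - dotv (f x *: g' x + f' x *: g x) h =
    f x * (f' (x + h) - f' x - dotv (g' x) h) + f' x * (f (x + h) - f x - dotv (g x) h)
    + (f (x + h) - f x) * (f' (x + h) - f' x).
    by rewrite dotvDl !dotvZl; ring.
  apply: le_trans (ler_normD _ _) _; apply: le_trans (lerD (ler_normD _ _) (lexx _)) _.
  rewrite !normrM.
  have k1 : `|f x| * `|f' (x + h) - f' x - dotv (g' x) h| <= B * (B' * enorm h ^+ 2) by apply: ler_pM.
  have k2 : `|f' x| * `|f (x + h) - f x - dotv (g x) h| <= B' * (B * enorm h ^+ 2) by apply: ler_pM.
  have k3 : `|f (x + h) - f x| * `|f' (x + h) - f' x| <= (2 * B * enorm h) * (2 * B' * enorm h) by apply: ler_pM.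
  have -> : 6 * B * B' * enorm h ^+ 2 = B * (B' * enorm h ^+ 2) + B' * (B * enorm h ^+ 2) + (2 * B * enorm h) * (2 * B' * enorm h) by ring.
  lra.
Qed.

Lemma smooth_mulc B f c C : `|c| <= C -> smooth B f -> smooth (C * B) (fun x => c * f x).
Proof.
move=> cC sf; have B0 := smooth_ge0 sf; case: sf => g [h1 h2 h3].
exists (fun x => c *: g x); split => [x|x|x h].
- by rewrite normrM ler_pM.
- by rewrite enormZ ler_pM ?enorm_ge0.
- rewrite dotvZl -!mulrBr normrM -mulrA ler_pM //.
Qed.

Lemma taylor_derive f g L x v : taylor f g L ->
  is_derive x v f (dotv (g x) v).
Proof.
move=> T.
have L0 : 0 <= L * enorm v ^+ 2 by apply: le_trans (T x v).
(* The added 1 permits dividing [e] by this quantity even when [L * enorm v ^+ 2] vanishes. *)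
have p1 : 0 < L * enorm v ^+ 2 + 1 by lra.
have K : (fun t : R => t^-1 *: ((f \o shift x) (t *: v) - f x)) @ 0^' --> dotv (g x) v.
  apply/cvgrPdist_le => e e0.
  near=> t.
  have t0 : t != 0 by near: t; exact: nbhs_dnbhs_neq.
  have -> : dotv (g x) v - t^-1 *: ((f \o shift x) (t *: v) - f x) =
     - (t^-1 * (f (x + t *: v) - f x - dotv (g x) (t *: v))).
    by rewrite /= (addrC _ x) /GRing.scale /= dotvZr; field.
  rewrite normrN normrM.
  apply: (@le_trans _ _ (`|t^-1| * (L * enorm (t *: v) ^+ 2))); first exact: ler_wpM2l.
  rewrite enormZ exprMn real_normK ?num_real // normfV.
  have -> : `|t|^-1 * (L * (t ^+ 2 * enorm v ^+ 2)) = `|t| * (L * enorm v ^+ 2).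
    by rewrite -(real_normK (num_real t)); field; rewrite normr_eq0.
  apply: (@le_trans _ _ (`|t| * (L * enorm v ^+ 2 + 1))); first by rewrite ler_wpM2l //; lra.
  rewrite -ler_pdivlMr //; near: t.
  exact: (@dnbhs0_le R R^o _ (divr_gt0 e0 p1)).
by apply: DeriveDef; [apply/cvg_ex; exists (dotv (g x) v) | apply: cvg_lim].
Unshelve. all: by end_near. Qed.

(** This makes the witness hidden in [smooth] unique: it is the coordinatewise [grad]. *)
Lemma taylor_grad f g L : taylor f g L -> grad f = g.
Proof.
move=> T; apply/funext => x; apply/rowP => i; rewrite mxE /partial.
by have := taylor_derive x (delta_mx 0 i) T => h; rewrite derive_val dotv_delta.
Qed.

(** Going from [x] to [x + h + k] directly or through [x + h] gives two expansions of the same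
    value. Their difference isolates [dotv w k]; with [k] parallel to [w] and as long as [h], the
    three remainders cost 1 + 1 + 4 times [L * enorm h ^+ 2]. *)
Lemma taylor_grad_lip f g L : taylor f g L ->
  forall x h, enorm (g (x + h) - g x) <= 6 * L * enorm h.
Proof.
move=> T x h; set w := g (x + h) - g x.
have [h0|h0] := eqVneq (enorm h) 0.
  by rewrite /w (enorm0_eq0 h0) addr0 subrr enorm0 mulr0.
have [w0|w0] := eqVneq (enorm w) 0.
  have L0 : 0 <= L.
    have := le_trans (normr_ge0 _) (T x h); rewrite pmulr_lge0 // exprn_gt0 //.
    by rewrite lt0r h0 enorm_ge0.
  by rewrite w0 mulr_ge0 ?enorm_ge0 // mulr_ge0.
have hp : 0 < enorm h by rewrite lt0r h0 enorm_ge0.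
have wp : 0 < enorm w by rewrite lt0r w0 enorm_ge0.
pose k := (enorm h / enorm w) *: w.
have ek : enorm k = enorm h.
  by rewrite /k enormZ ger0_norm ?divr_ge0 ?enorm_ge0 // divfK.
have dk : dotv w k = enorm h * enorm w.
  by rewrite dotvZr -sqr_enorm; field.
have t1 := T (x + h) k; have t2 := T x h; have t3 := T x (h + k).
rewrite addrA in t3; rewrite ek in t1.
have e3 : enorm (h + k) ^+ 2 <= 4 * enorm h ^+ 2.
  by have := sqr_enormD_le h k; rewrite ek; lra.
have L0 : 0 <= L.
  by have := le_trans (normr_ge0 _) (T x h); rewrite pmulr_lge0 // exprn_gt0.
have e3' : L * enorm (h + k) ^+ 2 <= L * (4 * enorm h ^+ 2) by rewrite ler_wpM2l.
have : dotv w k <= 6 * (L * enorm h ^+ 2).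
  move: t1 t2 t3; rewrite !ler_norml => /andP[a1 a2] /andP[b1 b2] /andP[c1 c2].
  by rewrite dotvDr in c1 c2; rewrite dotvBl; lra.
rewrite dk => hh; rewrite -(ler_pM2l hp) (le_trans hh) //; apply: le_of_eq; ring.
Qed.

(** The topology is that of the sup norm, so the Euclidean bound passes through [enorm_le_norm]. The
    added 1s keep the radius positive for any [C] and for [n = 0]. *)
Lemma lip_continuous f C : (forall x h, `|f (x + h) - f x| <= C * enorm h) ->
  continuous f.
Proof.
move=> fC x.
have C0 : 0 < `|C| + 1 by rewrite ltr_pwDr.
have n0 : 0 < n%:R + 1 :> R by rewrite ltr_pwDr.
apply/(@cvgrPdist_le _ _ _ (nbhs x) (nbhs_filter x)) => e e0.
have e1 : 0 < e / ((`|C| + 1) * (n%:R + 1)) by rewrite divr_gt0 // mulr_gt0.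
have hF := @cvgr_dist_le R 'rV[R]_n 'rV[R]_n (nbhs x) (nbhs_filter (x : 'rV[R]_n)) id x (@cvg_id _ _) _ e1.
suff hG y : `|x - y| <= e / ((`|C| + 1) * (n%:R + 1)) -> `|f x - f y| <= e.
  exact: (@filterS 'rV[R]_n _ (nbhs_filter (x : 'rV[R]_n)) _ _ hG hF).
move=> hy.
have -> : f x - f y = - (f (x + (y - x)) - f x) by rewrite (addrC x) subrK; ring.
rewrite normrN (le_trans (fC _ _)) //.
apply: (@le_trans _ _ ((`|C| + 1) * ((n%:R + 1) * `|y - x|))).
  apply: (@le_trans _ _ ((`|C| + 1) * enorm (y - x))).
    by rewrite ler_wpM2r ?enorm_ge0 // (le_trans (ler_norm _)) // lerDl.
  rewrite ler_pM2l // (le_trans (enorm_le_norm _)) // ler_wpM2r //; lra.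
by rewrite mulrA -ler_pdivlMl ?mulr_gt0 // mulrC distrC.
Qed.

End smooth.

(** * Smooth linear systems *)

Lemma sub_sub3 (V : zmodType) (a b c : V) : (c - b) - (c - a) = a - b.
Proof. by rewrite opprB addrC addrA subrK. Qed.

Section linear_system.
Context (R : realType) (n m : nat).

(** The three summands bound the value of a solution coordinate, its Taylor remainder and its
    gradient, once the factors 1, [kappa ^+ 2] and [kappa] are taken out. Here [kappa * a] is the
    Lipschitz constant of the solution. *)
Definition system_const (B : R) : R :=
  let a := m%:R * (2 * B + m%:R * (2 * B * B)) in
  B + m%:R * (B + m%:R * (a * (2 * B) + B * B)) + n%:R * (m%:R * (B + m%:R * (B * B))).

Variables (B kappa : R) (x b : 'rV[R]_n -> 'rV[R]_m) (M : 'rV[R]_n -> 'M[R]_m).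
Hypothesis sys : forall t, x t *m M t = b t.
Hypothesis sM : forall i j, smooth B (fun t => M t i j).
Hypothesis sb : forall i, smooth B (fun t => b t 0 i).
Hypothesis xB : forall t i, `|x t 0 i| <= B.
Hypothesis kappa1 : 1 <= kappa.
Hypothesis inv : forall t (y : 'rV[R]_m), enorm y <= kappa * enorm (y *m M t).

Let kappa0 : 0 <= kappa. Proof. exact: le_trans kappa1. Qed.

Lemma system_unit t : M t \in unitmx.
Proof.
rewrite -row_free_unit -kermx_eq0; apply/eqP/row_matrixP => i; rewrite row0.
apply/enorm0_eq0/le_anti; rewrite enorm_ge0 andbT (le_trans (inv t _)) //.
by rewrite -row_mul mulmx_ker row0 enorm0 mulr0.
Qed.

(* The residual of the linearized system at t + h is O(kappa |h|^2), and solving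
   for x costs one more factor kappa. *)
Lemma smooth_system i : smooth (system_const B * kappa ^+ 2) (fun t => x t 0 i).
Proof.
have B0 : 0 <= B by apply: le_trans (xB 0 i).
have [gM hM] := choice (fun ij => sM ij.1 ij.2).
have [gb hb] := choice sb.
pose a : R := m%:R * (2 * B + m%:R * (2 * B * B)).
have a0 : 0 <= a by rewrite mulr_ge0 // addr_ge0 ?mulr_ge0.
(* Subtracting the systems at [t] and [t + h] leaves only increments of [b] and [M] on the right. *)
have xlip t h : enorm (x (t + h) - x t) <= kappa * (a * enorm h).
  apply: le_trans (inv t _) _; apply: ler_wpM2l => //.
  rewrite /a -mulrA; apply: enorm_le_bound => j.
  have -> : ((x (t + h) - x t) *m M t) = (b (t + h) - b t) - x (t + h) *m (M (t + h) - M t).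
    by rewrite mulmxBl mulmxBr !sys sub_sub3.
  rewrite !mxE; apply: le_trans (ler_normB _ _) _; rewrite mulrDl lerD //.
    exact: (smooth_lip (sb j)).
  apply: le_trans (ler_norm_sum _ _ _) _.
  apply: (@le_trans _ _ (\sum_(k < m) (B * (2 * B * enorm h)))).
    apply: ler_sum => k _; rewrite !mxE normrM ler_pM //; exact: (smooth_lip (sM k j)).
  by rewrite sumr_const card_ord -[X in X <= _]mulr_natl; apply: le_of_eq; ring.
(* Differentiating [x *m M = b] gives [Dx *m M = G], so the candidate gradient of coordinate [i] is
   column [i] of [G t *m invmx (M t)]. *)
pose G t : 'M[R]_(n, m) := \matrix_(k, j)
  (gb j t 0 k - \sum_l x t 0 l * gM (l, j) t 0 k).
have GE t h j : (h *m G t) 0 j = dotv (gb j t) h - \sum_l x t 0 l * dotv (gM (l, j) t) h.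
  rewrite mxE /dotv; under eq_bigr do rewrite mxE mulrBr; rewrite sumrB; congr (_ - _).
    by apply: eq_bigr => k _; rewrite mulrC.
  under eq_bigr do rewrite mulr_sumr; rewrite exchange_big; apply: eq_bigr => l _.
  by rewrite mulr_sumr; apply: eq_bigr => k _ /=; ring.
pose g t : 'rV[R]_n := \row_k (G t *m invmx (M t)) k i.
have gE t h : dotv (g t) h = (h *m (G t *m invmx (M t))) 0 i.
  by rewrite mxE; apply: eq_bigr => k _; rewrite mxE mulrC.
have mulVB t (z : 'rV[R]_m) : enorm (z *m invmx (M t)) <= kappa * enorm z.
  by apply: le_trans (inv t _) _; rewrite mulmxKV ?system_unit.
have BB : 0 <= B * B by rewrite mulr_ge0.
have gM1 ij t : enorm (gM ij t) <= B by have [_ + _] := hM ij.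
have gb1 j t : enorm (gb j t) <= B by have [_ + _] := hb j.
have k2 : kappa <= kappa ^+ 2 by rewrite expr2 ler_peMr.
have k21 : 1 <= kappa ^+ 2 by rewrite (le_trans kappa1).
have c0 : 0 <= system_const B by rewrite /system_const !(addr_ge0, mulr_ge0).
exists g; split => [t|t|t h].
- apply: (@le_trans _ _ (system_const B)); last by rewrite ler_peMr.
  apply: le_trans (xB _ _) _; rewrite /system_const -addrA lerDl.
  by rewrite !(addr_ge0, mulr_ge0).
- apply: (@le_trans _ _ (n%:R * (kappa * (m%:R * (B + m%:R * (B * B)))))).
    apply: enorm_le_bound => k; rewrite -dotv_delta gE mulmxA.
    apply: le_trans (coord_enorm _ _) _; apply: le_trans (mulVB _ _) _.
    apply: ler_wpM2l => //; apply: enorm_le_bound => j; rewrite GE.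
    apply: le_trans (ler_normB _ _) _; apply: lerD.
      by apply: le_trans (dotv_le _ _) _; rewrite enorm_delta mulr1.
    apply: le_trans (ler_norm_sum _ _ _) _.
    apply: (@le_trans _ _ (\sum_(l < m) (B * B))); last by rewrite sumr_const card_ord mulr_natl.
    apply: ler_sum => l _; rewrite normrM ler_pM //.
    by apply: le_trans (dotv_le _ _) _; rewrite enorm_delta mulr1.
  rewrite mulrCA mulrC; apply: ler_pM => //.
    by rewrite !(addr_ge0, mulr_ge0).
  by rewrite /system_const lerDr !(addr_ge0, mulr_ge0).
pose w := x (t + h) - x t - h *m (G t *m invmx (M t)).
have -> : x (t + h) 0 i - x t 0 i - dotv (g t) h = w 0 i by rewrite gE !mxE.
apply: le_trans (coord_enorm _ _) _; apply: le_trans (inv t _) _.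
have -> : w *m M t = (b (t + h) - b t) - x (t + h) *m (M (t + h) - M t) - h *m G t.
  rewrite /w !mulmxA mulmxBl mulmxKV ?system_unit // mulmxBl mulmxBr !sys.
  by rewrite sub_sub3.
set z := (_ - _ - _).
have zB : enorm z <= m%:R * ((B + m%:R * (kappa * (a * (2 * B)) + B * B)) * enorm h ^+ 2).
  apply: enorm_le_bound => j; rewrite /z.
  have -> : (b (t + h) - b t - x (t + h) *m (M (t + h) - M t) - h *m G t) 0 j =
    (b (t + h) 0 j - b t 0 j - dotv (gb j t) h)
    - \sum_l ((x (t + h) - x t) 0 l * (M (t + h) l j - M t l j) +
       x t 0 l * (M (t + h) l j - M t l j - dotv (gM (l, j) t) h)).
    have subE (y1 y2 y3 y4 : 'rV[R]_m) :
      (y1 - y2 - y3 - y4) 0 j = y1 0 j - y2 0 j - y3 0 j - y4 0 j by rewrite !mxE.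
    rewrite subE GE big_split /=.
    have -> : (x (t + h) *m (M (t + h) - M t)) 0 j =
      \sum_l (x (t + h) - x t) 0 l * (M (t + h) l j - M t l j) +
      \sum_l x t 0 l * (M (t + h) l j - M t l j).
      by rewrite mxE -big_split; apply: eq_bigr => l _; rewrite !mxE /=; ring.
    have -> : \sum_l x t 0 l * (M (t + h) l j - M t l j - dotv (gM (l, j) t) h) =
      \sum_l x t 0 l * (M (t + h) l j - M t l j) - \sum_l x t 0 l * dotv (gM (l, j) t) h.
      by rewrite -sumrB; apply: eq_bigr => l _; ring.
    ring.
  apply: le_trans (ler_normB _ _) _; rewrite mulrDl lerD //.
    by have [_ _ ] := hb j; apply.
  apply: le_trans (ler_norm_sum _ _ _) _.
  apply: (@le_trans _ _ (\sum_(l < m) ((kappa * (a * (2 * B)) + B * B) * enorm h ^+ 2))); last first.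
    by rewrite sumr_const card_ord -[X in X <= _]mulr_natl mulrA.
  apply: ler_sum => l _; apply: le_trans (ler_normD _ _) _; rewrite !normrM mulrDl lerD //.
    apply: (@le_trans _ _ ((kappa * (a * enorm h)) * (2 * B * enorm h))); last by apply: le_of_eq; ring.
    apply: ler_pM => //; first by apply: le_trans (coord_enorm _ _) _; exact: xlip.
    exact: (smooth_lip (sM l j)).
  rewrite -mulrA ler_pM //; have [_ _ ] := hM (l, j); apply.
apply: (@le_trans _ _ (kappa * (m%:R * ((B + m%:R * (kappa * (a * (2 * B)) + B * B)) * enorm h ^+ 2)))).
  exact: ler_wpM2l.
have e0 : 0 <= enorm h ^+ 2 by rewrite sqr_ge0.
set Y := B + m%:R * (kappa * _ + _).
have -> : kappa * (m%:R * (Y * enorm h ^+ 2)) = kappa * (m%:R * Y) * enorm h ^+ 2 by ring.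
apply: ler_wpM2r => //.
apply: (@le_trans _ _ (kappa ^+ 2 * (m%:R * (B + m%:R * (a * (2 * B) + B * B))))).
  rewrite expr2 -[leRHS]mulrA; apply: ler_wpM2l => //; rewrite {}/Y.
  rewrite [leRHS]mulrCA; apply: ler_wpM2l => //.
  rewrite [leRHS]mulrDr; apply: lerD; first by rewrite ler_peMl.
  rewrite [leRHS]mulrCA; apply: ler_wpM2l => //.
  by rewrite [leRHS]mulrDr lerD // ler_peMl.
rewrite mulrC; apply: ler_wpM2r; first exact: le_trans k21.
rewrite /system_const -/a addrAC lerDr !(addr_ge0, mulr_ge0) //.
Qed.

End linear_system.

(** * Quadratic Taylor bounds from bounded second partial derivatives *)

Section partial_derivatives.
Context (R : realType) (n : nat).
Implicit Types (f : 'rV[R]_n -> R) (x h : 'rV[R]_n).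

Lemma is_derive_line f i x (r : R) :
  (forall y, derivable f y (delta_mx 0 i)) ->
  is_derive r 1 (fun s : R => f (x + s *: delta_mx 0 i))
    (partial f i (x + r *: delta_mx 0 i)).
Proof.
move=> df; set y := x + r *: _.
have E : (fun h : R => h^-1 *: (((fun s : R => f (x + s *: delta_mx 0 i)) \o shift r) (h *: (1 : R)) - f y)) =
         (fun h : R => h^-1 *: ((f \o shift y) (h *: delta_mx 0 i) - f y)).
  apply/funext => h /=; congr (_ *: (f _ - _)).
  have -> : h *: (1 : R) = h by rewrite /GRing.scale /= mulr1.
  by rewrite /y scalerDl addrCA.
apply: DeriveDef; first by rewrite /derivable E; exact: df.
by rewrite /derive E.
Qed.

Lemma partial_mvt f i x (s : R) : (forall y, derivable f y (delta_mx 0 i)) ->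
  exists2 s', `|s'| <= `|s| &
    f (x + s *: delta_mx 0 i) - f x = s * partial f i (x + s' *: delta_mx 0 i).
Proof.
move=> df; pose g (r : R) := f (x + r *: delta_mx 0 i).
have dg r := is_derive_line x r df.
have cg : continuous g.
  move=> r; apply: differentiable_continuous; apply/derivable1_diffP.
  by have [] := dg r.
have g0 : g 0 = f x by rewrite /g scale0r addr0.
have cw (A : set R) : {within A, continuous g} by apply: continuous_subspaceT.
have [s0|s0] := leP 0 s.
  have [c] := @MVT_segment R g _ 0 s s0 (fun r _ => dg r) (cw _).
  rewrite in_itv /= => /andP[c0 cs] E; exists c; first by rewrite !ger0_norm.
  by rewrite -g0 -/(g s) E subr0 mulrC.
have [c] := @MVT_segment R g _ s 0 (ltW s0) (fun r _ => dg r) (cw _).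
rewrite in_itv /= => /andP[c0 cs] E; exists c.
  by rewrite !ler0_norm ?lerN2 // ltW.
by rewrite -g0 -/(g s) -opprB E sub0r mulrN opprK mulrC.
Qed.

(** The path from [x] to [x + h] moves one coordinate at a time, with the mean value theorem on each
    leg; stating the claim for a list of coordinates makes this an induction. *)
Lemma partial_lip f B : (forall i y, derivable f y (delta_mx 0 i)) ->
  (forall i y, `|partial f i y| <= B) ->
  forall x h, `|f (x + h) - f x| <= n%:R * B * enorm h.
Proof.
move=> df fB x h.
have key (r : seq 'I_n) : forall x,
    `|f (x + \sum_(i <- r) h 0 i *: delta_mx 0 i) - f x| <= (size r)%:R * (B * enorm h).
  elim: r => [|i r IH] y; first by rewrite big_nil addr0 subrr normr0 mul0r.
  rewrite big_cons addrA.
  have [s' _ E] := partial_mvt y (h 0 i) (df i).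
  set y' := y + _ in E *.
  have -> : f (y' + \sum_(j <- r) h 0 j *: delta_mx 0 j) - f y =
    (f (y' + \sum_(j <- r) h 0 j *: delta_mx 0 j) - f y') + (f y' - f y) by ring.
  apply: le_trans (ler_normD _ _) _; rewrite /= -natr1 mulrDl mul1r lerD // E normrM mulrC.
  by rewrite ler_pM // coord_enorm.
have := key (index_enum 'I_n) x.
rewrite -row_sum_delta.
have -> : size (index_enum 'I_n) = n by rewrite -(sum1_size (index_enum _)) sum1_card card_ord.
by rewrite mulrA.
Qed.

(** Same path as in [partial_lip]; the offset [z] records what has already been travelled. The cube
    collects [n] legs, the Lipschitz constant [n%:R * B] of a partial derivative, and a total
    displacement of at most [n%:R * enorm h]. *)
Lemma partial_taylor f B : (forall i y, derivable f y (delta_mx 0 i)) ->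
  (forall i j y, derivable (partial f i) y (delta_mx 0 j)) ->
  (forall i j y, `|partial (partial f i) j y| <= B) ->
  taylor f (grad f) (n%:R ^+ 3 * B).
Proof.
move=> df ddf fB x h.
have e0 := enorm_ge0 h.
have lip i := partial_lip (fun j y => ddf i j y) (fun j y => fB i j y).
(* With no coordinate the hypotheses do not force [B] to be nonnegative, so dimension 0 is settled
   apart. *)
have [n0|[i0]] : n = 0%N \/ exists i : 'I_n, True.
    by case: (n) => [|k]; [left | right; exists ord0].
  have -> : h = 0 by apply/rowP => i; case: i => k hk; exfalso; rewrite n0 in hk.
  by rewrite addr0 subrr dotv0r subrr normr0 enorm0 expr0n mulr0.
move=> _; have B0 : 0 <= B by apply: le_trans (fB i0 i0 0).
have nB : 0 <= n%:R * B by rewrite mulr_ge0.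
have key (r : seq 'I_n) : forall z a, enorm z <= a ->
    `|f (x + z + \sum_(i <- r) h 0 i *: delta_mx 0 i) - f (x + z)
      - \sum_(i <- r) h 0 i * partial f i x| <=
    (size r)%:R * enorm h * (n%:R * B * (a + (size r)%:R * enorm h)).
  elim: r => [|i r IH] z a za.
    by rewrite !big_nil addr0 subrr subr0 normr0 !mul0r.
  rewrite !big_cons !addrA.
  have [s' s'h E] := partial_mvt (x + z) (h 0 i) (df i).
  have hi : enorm (h 0 i *: delta_mx 0 i : 'rV[R]_n) <= enorm h.
    by rewrite enormZ enorm_delta mulr1 coord_enorm.
  have hs : enorm (s' *: delta_mx 0 i : 'rV[R]_n) <= enorm h.
    by rewrite enormZ enorm_delta mulr1 (le_trans s'h) // coord_enorm.
  have za' : enorm (z + h 0 i *: delta_mx 0 i) <= a + enorm h.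
    by apply: le_trans (enormD _ _) _; apply: lerD.
  have := IH _ _ za'; rewrite !addrA => IH'.
  set y := x + z + h 0 i *: _ in E IH' *.
  set sm := \sum_(j <- r) h 0 j *: _ in IH' *.
  set sp := \sum_(j <- r) _ in IH' *.
  have -> : f (y + sm) - f (x + z) - (h 0 i * partial f i x + sp) =
    (f (y + sm) - f y - sp) + ((f y - f (x + z)) - h 0 i * partial f i x) by ring.
  apply: le_trans (ler_normD _ _) _.
  have Q : `|f y - f (x + z) - h 0 i * partial f i x| <= enorm h * (n%:R * B * (a + enorm h)).
    rewrite E -mulrBr normrM ler_pM // ?coord_enorm //.
    rewrite -addrA (le_trans (lip i _ _)) // ler_wpM2l //.
    by apply: le_trans (enormD _ _) _; apply: lerD.
  apply: le_trans (lerD IH' Q) _; rewrite /= -natr1.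
  set k : R := (size r)%:R; have k0 : 0 <= k by rewrite ler0n.
  have : 0 <= k * enorm h * (n%:R * B * enorm h) by rewrite !mulr_ge0.
  have : 0 <= enorm h * (n%:R * B * (k * enorm h)) by rewrite !mulr_ge0.
  rewrite -subr_ge0 => p1 p2.
  have -> : (k + 1) * enorm h * (n%:R * B * (a + (k + 1) * enorm h)) =
    k * enorm h * (n%:R * B * (a + enorm h + k * enorm h)) +
    enorm h * (n%:R * B * (a + enorm h)) + enorm h * (n%:R * B * (k * enorm h)) by ring.
  lra.
have z0 : enorm (0 : 'rV[R]_n) <= 0 by rewrite enorm0.
have := key (index_enum 'I_n) 0 0 z0.
have -> : size (index_enum 'I_n) = n by rewrite -(sum1_size (index_enum _)) sum1_card card_ord.
rewrite addr0 add0r -row_sum_delta.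
have -> : \sum_i h 0 i * partial f i x = dotv (grad f x) h.
  by apply: eq_bigr => i _; rewrite mxE mulrC.
move=> hh; apply: le_trans hh _; apply: le_of_eq; ring.
Qed.

(** [opnorm] is a real supremum, so its set must first be shown bounded; the sum of the absolute
    values of the entries is an upper bound. *)
Lemma opnorm_entry (H : 'M[R]_n) i j : `|H i j| <= opnorm H.
Proof.
have E : ((delta_mx 0 i : 'rV[R]_n) *m H) 0 j = H i j.
  rewrite mxE (bigD1 i) //= mxE !eqxx mul1r big1 ?addr0 // => k ki.
  by rewrite mxE (negPf ki) andbF mul0r.
rewrite -E; apply: le_trans (coord_enorm _ _) _.
apply: ub_le_sup; last by exists (delta_mx 0 i) => //=; rewrite enorm_delta.
exists (\sum_j \sum_i `|H i j|) => _ [x /= x1 <-].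
apply: le_trans (enorm_le_sum _) _; apply: ler_sum => k _; rewrite mxE.
apply: le_trans (ler_norm_sum _ _ _) _; apply: ler_sum => l _.
by rewrite normrM ler_piMl // (le_trans (coord_enorm _ _)).
Qed.

Lemma c3_smooth f (K' K'' : R) : ktimes_cdiff 3 f ->
  (forall x, `|f x| <= 1) ->
  (forall x, enorm (grad f x) <= K') ->
  (forall x, opnorm (hess f x) <= K'') ->
  smooth (1 + `|K'| + n%:R ^+ 3 * `|K''|) f.
Proof.
move=> /= [_ df] f1 fK' fK''; exists (grad f).
have n0 : 0 <= n%:R ^+ 3 * `|K''| by rewrite mulr_ge0 // exprn_ge0.
have k0 := normr_ge0 K'.
split => [x|x|x h].
- by rewrite (le_trans (f1 x)) // -addrA lerDl addr_ge0.
- apply: le_trans (fK' x) _; have := ler_norm K'; lra.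
- apply: (@le_trans _ _ (n%:R ^+ 3 * `|K''| * enorm h ^+ 2)); last first.
    by rewrite ler_wpM2r ?sqr_ge0 // lerDr addr_ge0.
  apply: partial_taylor => [i y|i j y|i j y].
  + by have [+ _] := df i.
  + by have [_ [_ +]] := df i => /(_ j)[].
  + have := opnorm_entry (hess f y) i j; rewrite mxE => h1.
    by rewrite (le_trans h1) // (le_trans (fK'' y)) // ler_norm.
Qed.

End partial_derivatives.

(** * Means of bounded functions *)

(** Bounded everywhere, not just almost surely: integrability and stability under products are then
    automatic, and [mean] is an honest real-valued linear functional on this class. *)
Definition bounded_measurable (R : realType) d (T : measurableType d)
    (f : T -> R) : Prop :=
  measurable_fun [set: T] f /\ exists B, forall x, `|f x| <= B.

Definition mean (R : realType) d (T : measurableType d) (P : probability T R)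
  (f : T -> R) : R := fine ('E_P[f])%E.

Section mean_theory.
Context (R : realType) (d : measure_display) (T : measurableType d).
Implicit Types (f g : T -> R) (P : probability T R).

Local Notation bm := (@bounded_measurable R d T).

Lemma bm_cst (c : R) : bm (fun=> c).
Proof. by split; [exact: measurable_cst | exists `|c|]. Qed.

Lemma bm_add f g : bm f -> bm g -> bm (fun x => f x + g x).
Proof.
move=> [mf [B fB]] [mg [B' gB]]; split; first exact: measurable_funD.
by exists (B + B') => x; rewrite (le_trans (ler_normD _ _)) ?lerD.
Qed.

Lemma bm_mul f g : bm f -> bm g -> bm (fun x => f x * g x).
Proof.
move=> [mf [B fB]] [mg [B' gB]]; split; first exact: measurable_funM.
by exists (B * B') => x; rewrite normrM ler_pM.
Qed.

Lemma bm_opp f : bm f -> bm (fun x => - f x).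
Proof.
move=> /(bm_mul (bm_cst (-1))).
by under eq_fun do rewrite mulN1r.
Qed.

Lemma bm_sub f g : bm f -> bm g -> bm (fun x => f x - g x).
Proof. by move=> bf bg; apply: bm_add => //; apply: bm_opp. Qed.

Lemma bm_sum (I : Type) (r : seq I) (p : pred I) (F : I -> T -> R) :
  (forall i, bm (F i)) -> bm (fun x => \sum_(i <- r | p i) F i x).
Proof.
move=> bF; elim: r => [|i r IH].
  by under eq_fun do rewrite big_nil; exact: bm_cst.
by under eq_fun do rewrite big_cons; case: (p i) => //; exact: bm_add.
Qed.

Lemma bm_indic (E : set T) : measurable E -> bm (\1_E).
Proof.
move=> mE; split; first exact: measurable_indic.
by exists 1 => x; rewrite indicE; case: (_ \in _); rewrite /= ?normr1 ?normr0.
Qed.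

Lemma bm_integrable P f : bm f -> P.-integrable setT (EFin \o f).
Proof.
move=> [mf [B fB]]; apply: measurable_bounded_integrable => //.
  by rewrite (le_lt_trans (probability_le1 _ _)) // ltry.
exists B; split; first by rewrite num_real.
by move=> x Bx y _ /=; rewrite (le_trans (fB y)) // ltW.
Qed.

Lemma bm_expectation P f : bm f -> ('E_P[f] = (mean P f)%:E)%E.
Proof.
by move=> bf; rewrite /mean fineK // unlock integrable_fin_num //; exact: bm_integrable.
Qed.

Lemma mean_cst P c : mean P (fun=> c) = c.
Proof. by rewrite /mean expectation_cst. Qed.

Lemma mean_lin P (a b : R) f g : bm f -> bm g ->
  mean P (fun x => a * f x + b * g x) = a * mean P f + b * mean P g.
Proof.
move=> bf bg; have i1 := bm_integrable P (bm_mul (bm_cst a) bf).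
have i2 := bm_integrable P (bm_mul (bm_cst b) bg).
rewrite /mean unlock -[LHS]/(Rintegral P setT (fun x => a * f x + b * g x)).
by rewrite RintegralD // !RintegralZl //; exact: bm_integrable.
Qed.

Lemma mean_add P f g : bm f -> bm g ->
  mean P (fun x => f x + g x) = mean P f + mean P g.
Proof.
move=> bf bg; have := mean_lin P 1 1 bf bg.
by under eq_fun do rewrite !mul1r; rewrite !mul1r.
Qed.

Lemma mean_scale P (a : R) f : bm f -> mean P (fun x => a * f x) = a * mean P f.
Proof.
move=> bf; have := mean_lin P a 0 bf bf.
by under eq_fun do rewrite mul0r addr0; rewrite mul0r addr0.
Qed.

Lemma mean_sub P f g : bm f -> bm g ->
  mean P (fun x => f x - g x) = mean P f - mean P g.
Proof.
move=> bf bg; have := mean_lin P 1 (-1) bf bg.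
by under eq_fun do rewrite mul1r mulN1r; rewrite mul1r mulN1r.
Qed.

Lemma mean_sum P (I : Type) (r : seq I) (p : pred I) (F : I -> T -> R) :
  (forall i, bm (F i)) ->
  mean P (fun x => \sum_(i <- r | p i) F i x) = \sum_(i <- r | p i) mean P (F i).
Proof.
move=> bF; elim: r => [|i r IH].
  by under eq_fun do rewrite big_nil; rewrite mean_cst big_nil.
under eq_fun do rewrite big_cons; rewrite big_cons; case: (p i) => //.
by rewrite mean_add ?IH //; exact: bm_sum.
Qed.

Lemma mean_le P f g : bm f -> bm g -> (forall x, f x <= g x) -> mean P f <= mean P g.
Proof.
move=> bf bg fg; rewrite /mean unlock; apply: le_Rintegral => //; exact: bm_integrable.
Qed.

Lemma mean_norm P f B : bm f -> (forall x, `|f x| <= B) -> `|mean P f| <= B.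
Proof.
move=> bf fB; rewrite ler_norml -{2}(mean_cst P B) -(mean_cst P (- B)).
by apply/andP; split; apply: mean_le => //; (try exact: bm_cst) => x;
  have := fB x; rewrite ler_norml => /andP[].
Qed.

Lemma mean_indic P (E : set T) : measurable E -> mean P (\1_E) = fine (P E).
Proof. by move=> mE; rewrite /mean expectation_indic. Qed.

Lemma mean_le_ae P f g : bm f -> bm g -> (forall x, 0 <= f x) -> (forall x, 0 <= g x) ->
  {ae P, forall x, f x <= g x} -> mean P f <= mean P g.
Proof.
move=> bf bg f0 g0 fg; rewrite -lee_fin -!bm_expectation //.
by apply: expectation_le => //; [case: bf | case: bg].
Qed.

(* Peeling off binary digits, [F = (1_{F >= 1/2} + F') / 2] with [0 <= F' <= 1],
   shows that [|L F| <= D / 2 ^ k] for all [k]. *)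
Lemma functional_eq0 (L : (T -> R) -> R) (D : R) :
  (forall a b f g, bm f -> bm g ->
     L (fun x => a * f x + b * g x) = a * L f + b * L g) ->
  (forall E, measurable E -> L (\1_E) = 0) ->
  (forall f, bm f -> (forall x, 0 <= f x <= 1) -> `|L f| <= D) ->
  forall f, bm f -> L f = 0.
Proof.
move=> Llin L1 LD.
have key k : forall f, bm f -> (forall x, 0 <= f x <= 1) -> `|L f| <= D / 2 ^+ k.
  elim: k => [|k IH] f bf f01; first by rewrite expr0 divr1 LD.
  pose E := [set x | 2^-1 <= f x].
  have mE : measurable E.
    have : measurable ([set: T] `&` (fun x => 2^-1 <= f x) @^-1` [set true]).
      by apply: measurable_fun_ler => //; exact: bf.1.
    by rewrite setTI; congr measurable; apply/seteqP; split => x.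
  have bE := bm_indic mE.
  pose f' x := 2 * f x + (-1) * \1_E x.
  have bf' : bm f' by apply: bm_add; apply: bm_mul => //; exact: bm_cst.
  have f'01 x : 0 <= f' x <= 1.
    rewrite /f' indicE; have /andP[h0 h1] := f01 x.
    case: (boolP (x \in E)) => /=.
      by rewrite inE /E /= => h; lra.
    by rewrite notin_setE /E /= => /negP; rewrite -ltNge => h; lra.
  have -> : f = (fun x => 2^-1 * f' x + 2^-1 * \1_E x).
    by apply/funext => x; rewrite /f'; field.
  rewrite Llin // L1 // mulr0 addr0 normrM exprS invfM mulrCA.
  by rewrite ger0_norm ?invr_ge0 // ler_wpM2l ?invr_ge0 // IH.
have key0 f : bm f -> (forall x, 0 <= f x <= 1) -> L f = 0.
  move=> bf f01; apply/eqP; rewrite -normr_le0; apply/ler_addgt0Pr => e e0.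
  have D0 : 0 <= D by apply: le_trans (LD f bf f01).
  have [k hk] : exists k, D / e <= k%:R.
    by exists (Num.bound (D / e)); rewrite ltW // archi_boundP // divr_ge0 // ltW.
  rewrite add0r (le_trans (key k f bf f01)) // ler_pdivrMr ?exprn_gt0 //.
  rewrite mulrC -ler_pdivrMr // (le_trans hk) // -natrX ler_nat.
  by rewrite ltnW // ltn_expl.
move=> f bf; have [B fB] := bf.2.
have B0 : 0 < `|B| + 1 by rewrite ltr_pwDr.
set C := `|B| + 1 in B0.
have fC x : - C <= f x <= C.
  by rewrite -ler_norml (le_trans (fB x)) // /C (le_trans (ler_norm B)) // lerDl.
(* An affine map brings the range into [[0, 1]]; its constant part is killed by [L] because the
   constant 1 is an indicator. *)
pose f' x := (2 * C)^-1 * f x + 2^-1 * 1.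
have bf' : bm f' by apply: bm_add; [apply: bm_mul => //; exact: bm_cst | exact: bm_cst].
have f'01 x : 0 <= f' x <= 1.
  have /andP[h1 h2] := fC x.
  have -> : f' x = (f x + C) / (2 * C) by rewrite /f'; field; rewrite gt_eqF.
  have C2 : 0 < 2 * C by rewrite mulr_gt0.
  by apply/andP; split; [apply: divr_ge0; lra | rewrite ler_pdivrMr // mul1r; lra].
have L1' : L (fun=> 1) = 0.
  have := L1 _ measurableT; congr (L _ = _).
  by apply/funext => x; rewrite indicE in_setT.
have := key0 _ bf' f'01; rewrite /f' Llin //; last exact: bm_cst.
rewrite L1' mulr0 addr0 => /eqP; rewrite mulf_eq0 invr_eq0 mulf_eq0 pnatr_eq0 /=.
by rewrite (gt_eqF B0) /= => /eqP.
Qed.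

End mean_theory.

Local Notation bm := bounded_measurable.

Section law_of_cost.
Context (R : realType) (d : measure_display) (T : measurableType d).
Context (P : probability T R) (C : T -> R).
Hypothesis mC : measurable_fun [set: T] (C : T -> measurableTypeR R).

Lemma bm_comp (f : R -> R) : bm (f : measurableTypeR R -> R) ->
  bm (fun u => f (C u)).
Proof.
by move=> [mf [B hB]]; split; [exact: measurableT_comp mf mC | exists B].
Qed.

(** Both sides are linear in [psi] and agree on indicators, so [functional_eq0] applies to their
    difference. [X] serves as the indicator of a conditioning event, with [K] its weight. *)
Lemma mean_law (X : T -> R) (kap : probability (measurableTypeR R) R) K psi :
  bm X ->
  (forall B : set (measurableTypeR R), measurable B ->
     mean P (fun u => X u * \1_B (C u)) = K * mean kap \1_B) ->
  bm (psi : measurableTypeR R -> R) ->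
  mean P (fun u => X u * psi (C u)) = K * mean kap psi.
Proof.
move=> bX XK bpsi; have [_ [D XD]] := bX.
pose L (f : measurableTypeR R -> R) := mean P (fun u => X u * f (C u)) - K * mean kap f.
apply/eqP; rewrite -subr_eq0; apply/eqP.
apply: (@functional_eq0 _ _ _ L (D + `|K|)) => // {psi bpsi}.
- move=> a b f g bf bg; rewrite /L mean_lin //.
  under eq_fun do rewrite mulrDr mulrCA (mulrCA (X _) b).
  by rewrite mean_lin; [ring | |]; apply: bm_mul => //; exact: bm_comp.
- by move=> B mB; rewrite /L XK // subrr.
- move=> f bf f01; rewrite /L (le_trans (ler_normB _ _)) // lerD //.
    apply: mean_norm => [|u]; first by apply: bm_mul => //; exact: bm_comp.
    have /andP[f0 f1] := f01 (C u).
    by rewrite normrM (le_trans _ (XD u)) // ler_piMr // ger0_norm.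
  rewrite normrM ler_piMr //; apply: mean_norm => // x.
  by have /andP[f0 f1] := f01 x; rewrite ger0_norm.
Qed.

End law_of_cost.

(** * Conditional expectation of a fresh sample *)

Section fresh.
Context (R : realType) (d : measure_display) (U : measurableType d).
Context (F : finType) (P : probability U R).
Context (Z : nat -> U -> F) (C : nat -> U -> R).
Hypothesis obs : observable Z C.

Definition past_gen (m t : nat) : set (set U) :=
  [set E | exists i, (m <= i < t)%N /\
     ((exists z, E = Z i @^-1` [set z]) \/
      (exists B : set (measurableTypeR R), measurable B /\ E = C i @^-1` B))].

(** The past as a measurable type on the carrier [U]: being adapted is then plain
    [bounded_measurable] over this type, and all its closure lemmas apply as they stand. *)
Definition history (m t : nat) := g_sigma_algebraType (past_gen m t).

Definition past_bm (m t : nat) (f : U -> R) : Prop :=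
  @bm R _ (history m t) f.

Lemma past_gen_measurable m t E : past_gen m t E -> measurable E.
Proof.
case: obs => mZ mC [i [_ [[z ->]|[B [mB ->]]]]]; first exact: mZ.
by rewrite -[_ @^-1` _]setTI; apply: mC.
Qed.

Lemma past_measurable m t (E : set U) : past Z C m t E -> measurable E.
Proof. by apply: smallest_sub; [exact: sigma_algebra_measurable | exact: past_gen_measurable]. Qed.

Lemma past_bm_bm m t f : past_bm m t f -> bm f.
Proof.
move=> [mf bf]; split => // _ B mB; rewrite setTI.
apply: (@past_measurable m t); rewrite -[_ @^-1` _]setTI.
exact: (mf measurableT B mB).
Qed.

Lemma measurable_history_le m t t' (f : U -> R) : (t <= t')%N ->
  measurable_fun [set: history m t] (f : history m t -> R) ->
  measurable_fun [set: history m t'] (f : history m t' -> R).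
Proof.
move=> tt' mf _ B mB; have := mf measurableT B mB; rewrite !setTI.
apply: sub_sigma_algebra2 => E [i [/andP[mi it] hE]]; exists i; split => //.
by rewrite mi (leq_trans it).
Qed.

Lemma past_bm_le m t t' f : (t <= t')%N -> past_bm m t f -> past_bm m t' f.
Proof. by move=> tt' [mf bf]; split => //; apply: measurable_history_le mf. Qed.

Lemma past_cost m t i (psi : R -> R) : (m <= i < t)%N ->
  bm (psi : measurableTypeR R -> R) ->
  past_bm m t (fun u => psi (C i u)).
Proof.
move=> mit [mpsi [B hB]]; split; last by exists B => x; exact: hB.
move=> _ Y mY; rewrite setTI; apply: sub_sigma_algebra; exists i; split => //; right.
exists (psi @^-1` Y); split => //; rewrite -[_ @^-1` _]setTI; exact: mpsi.
Qed.

Variables (m t : nat) (q : U -> F -> R)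
  (kap : F -> probability (measurableTypeR R) R).
Hypothesis fresh : fresh_sample P Z C m t q kap.
Hypothesis qP : forall z, past_bm m t (q^~ z).

Lemma fresh_indic (E : set U) z (B : set (measurableTypeR R)) :
  past Z C m t E -> measurable B ->
  mean P (fun u => \1_E u * \1_(Z t @^-1` [set z]) u * \1_B (C t u)) =
  mean P (fun u => \1_E u * q u z) * mean (kap z) \1_B.
Proof.
move=> pE mB; have mE := past_measurable pE.
have [mZ mC] := obs; have mCB : measurable (C t @^-1` B).
  by rewrite -[_ @^-1` _]setTI; apply: mC.
have -> : (fun u => \1_E u * \1_(Z t @^-1` [set z]) u * \1_B (C t u)) =
  \1_(E `&` Z t @^-1` [set z] `&` C t @^-1` B) :> (U -> R).
  by apply/funext => u; rewrite !indicI.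
rewrite mean_indic; last by do 2!apply: measurableI => //.
rewrite fresh // (mean_indic _ mB) fineM; last 2 first.
- apply: integrable_fin_num => //; apply: (integrableS measurableT) => //.
  exact/bm_integrable/past_bm_bm/qP.
- exact: fin_num_measure.
congr (_ * _); rewrite /mean unlock; congr fine.
rewrite integral_mkcond; apply: eq_integral => u _.
by rewrite patchE indicE; case: (u \in E); rewrite ?mul1r ?mul0r.
Qed.

Lemma fresh_past_event (E : set U) z psi :
  past Z C m t E -> bm (psi : measurableTypeR R -> R) ->
  mean P (fun u => \1_E u * \1_(Z t @^-1` [set z]) u * psi (C t u)) =
  mean P (fun u => \1_E u * q u z) * mean (kap z) psi.
Proof.
move=> pE; have mE := past_measurable pE; have [mZ mC] := obs.
apply: mean_law => // [|B mB]; last exact: fresh_indic.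
by apply: bm_mul; exact: bm_indic.
Qed.

(** Second use of [functional_eq0], now with the weight [H] as variable over [history m t], whose
    measurable sets are exactly the past events of [fresh_past_event]. *)
Lemma fresh_value (H : U -> R) z psi :
  past_bm m t H -> bm (psi : measurableTypeR R -> R) ->
  mean P (fun u => H u * \1_(Z t @^-1` [set z]) u * psi (C t u)) =
  mean P (fun u => H u * q u z) * mean (kap z) psi.
Proof.
move=> pH bpsi; have [mZ mC] := obs.
have bC := bm_comp (mC t) bpsi.
set K := mean (kap z) psi; have bq := past_bm_bm (qP z).
have bZ : bm (\1_(Z t @^-1` [set z]) : U -> R) by exact: bm_indic.
pose f u := \1_(Z t @^-1` [set z]) u * psi (C t u) - K * q u z.
have bf : bm f.
  by apply: bm_sub; apply: bm_mul => //; exact: bm_cst.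
pose L (h : history m t -> R) := mean P (fun u => h u * f u).
have [D hD] := bf.2.
apply/eqP; rewrite -subr_eq0; apply/eqP.
have bH := past_bm_bm pH.
have LE h : bm (h : U -> R) ->
    mean P (fun u => h u * \1_(Z t @^-1` [set z]) u * psi (C t u)) -
    mean P (fun u => h u * q u z) * K = L h.
  move=> bh; rewrite mulrC -mean_scale -?mean_sub /L; last 3 first.
  - by apply: bm_mul => //; apply: bm_mul.
  - by apply: bm_mul; [exact: bm_cst | apply: bm_mul].
  - by apply: bm_mul.
  by congr mean; apply/funext => u; rewrite /f; ring.
rewrite LE //; apply: (@functional_eq0 _ _ _ L D) => //.
- move=> a b g h bg bh; rewrite /L -mean_lin; last 2 first.
  - by apply: bm_mul => //; exact: (past_bm_bm bg).
  - by apply: bm_mul => //; exact: (past_bm_bm bh).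
  by congr mean; apply/funext => u; ring.
- move=> E pE; have mE := past_measurable pE; rewrite -LE; last exact: bm_indic.
  by rewrite fresh_past_event // subrr.
- move=> g bg g01; apply: mean_norm; first by apply: bm_mul => //; exact: (past_bm_bm bg).
  move=> u; have /andP[g0 g1] := g01 u.
  by rewrite normrM (le_trans _ (hD u)) // ler_piMl // ger0_norm.
Qed.

(** Splitting by the finitely many values of [Z t] turns the conditional expectation given the past
    into the explicit sum on the right. *)
Lemma mean_fresh_cost (H : F -> U -> R) psi :
  (forall z, past_bm m t (H z)) ->
  bm (psi : measurableTypeR R -> R) ->
  mean P (fun u => H (Z t u) u * psi (C t u)) =
  mean P (fun u => \sum_z q u z * (mean (kap z) psi * H z u)).
Proof.
move=> pH bpsi; have [mZ mC] := obs.
have bC := bm_comp (mC t) bpsi.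
have bH z := past_bm_bm (pH z).
have bq z := past_bm_bm (qP z).
have -> : (fun u => H (Z t u) u * psi (C t u)) =
    fun u => \sum_z H z u * \1_(Z t @^-1` [set z]) u * psi (C t u).
  apply/funext => u; rewrite (bigD1 (Z t u)) //= big1 ?addr0; last first.
    move=> z zZ; rewrite indicE memNset ?mulr0 ?mul0r // => /= /esym/eqP.
    exact/negP.
  by rewrite indicE mem_set // mulr1.
rewrite !mean_sum => [|z|z]; last 2 first.
- by apply: bm_mul => //; apply: bm_mul => //; exact: bm_cst.
- by apply: bm_mul => //; apply: bm_mul => //; exact: bm_indic.
apply: eq_bigr => z _; rewrite fresh_value // mulrC -mean_scale; last exact: bm_mul.
by congr mean; apply/funext => u; ring.
Qed.

Lemma mean_fresh (H : F -> U -> R) : (forall z, past_bm m t (H z)) ->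
  mean P (fun u => H (Z t u) u) = mean P (fun u => \sum_z q u z * H z u).
Proof.
move=> pH; have := mean_fresh_cost pH (bm_cst _ 1).
under eq_fun do rewrite mulr1; move=> ->; congr mean; apply/funext => u.
by apply: eq_bigr => z _; rewrite mean_cst mul1r.
Qed.

(** A bad event for the value [z] has probability [q] averaged times a mass under [kap z]. The
    second alternative serves impossible transitions, about whose cost law nothing is assumed. *)
Lemma fresh_cost_ae (p : F -> set (measurableTypeR R)) :
  (forall z, measurable (p z)) ->
  (forall z, kap z (p z) = 1%E \/ forall u, q u z = 0) ->
  {ae P, forall u, p (Z t u) (C t u)}.
Proof.
move=> mp hp; have [mZ mC] := obs.
pose N z := Z t @^-1` [set z] `&` C t @^-1` (~` p z).
have mN z : measurable (N z).
  apply: measurableI => //; rewrite -[_ @^-1` _]setTI.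
  by apply: mC => //; exact: measurableC.
have PN z : P (N z) = 0%E.
  have -> : N z = setT `&` Z t @^-1` [set z] `&` C t @^-1` (~` p z) by rewrite setTI.
  rewrite fresh //; [|exact: (@measurableT _ (history m t))|exact: measurableC].
  case: (hp z) => [h|h]; last by rewrite integral0_eq ?mul0e // => u _; rewrite h.
  by rewrite [X in (_ * X)%E]probability_setC // h subee // mule0.
have : {ae P, forall u, forall z, ~ N z u}.
  apply: filter_forall => z; exists (N z); split => // u /=.
  by move=> /contrapT.
apply: filterS => u hu; apply: contrapT => hp'; apply: (hu (Z t u)); split => //.
Qed.

End fresh.

(** * Discounted sums *)

Section discounted_sum.
Context (R : realType) (gamma : R).
Hypothesis g01 : 0 < gamma < 1.
Implicit Types (a : nat -> R) (B L : R).

Definition gpartial a (N : nat) : R := \sum_(t < N) gamma ^+ t * a t.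

Definition gsum a : R := limn (gpartial a).

Let g0 : 0 <= gamma. Proof. by case/andP: g01 => /ltW. Qed.

Let g1 : 0 < 1 - gamma. Proof. by rewrite subr_gt0; case/andP: g01. Qed.

Lemma gpow_cvg0 B : (fun N => B * gamma ^+ N) @ \oo --> 0.
Proof.
rewrite -(mulr0 B); apply: cvgMr; apply: cvg_expr.
by rewrite ger0_norm //; case/andP: g01.
Qed.

(** Discounted sums are identified through this criterion: any geometric error bound for the partial
    sums pins down the limit. *)
Lemma gsum_unique a L B :
  (forall N, `|L - gpartial a N| <= B * gamma ^+ N) -> gsum a = L.
Proof.
move=> h; apply: cvg_lim => //; apply/cvgrPdist_le => e e0.
have /cvgrPdist_le/(_ e e0) := gpow_cvg0 B; apply: filterS => N.
rewrite sub0r normrN => h'; apply: le_trans (h N) _.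
by apply: le_trans (ler_norm _) h'.
Qed.

Lemma gpartial_geometric N : gpartial (fun=> 1) N = (1 - gamma ^+ N) / (1 - gamma).
Proof.
rewrite /gpartial; elim: N => [|N IH]; first by rewrite big_ord0 expr0 subrr mul0r.
rewrite big_ord_recr /= IH mulr1 exprS; field.
by rewrite gt_eqF.
Qed.

Lemma gsum_cvg a B : (forall t, `|a t| <= B) -> cvgn (gpartial a).
Proof.
move=> aB; have B0 : 0 <= B by apply: le_trans (aB 0%N).
have -> : gpartial a = series (fun t => gamma ^+ t * a t).
  by apply/funext => N; rewrite /series /= big_mkord.
apply: normed_cvg; apply: (@series_le_cvg _ _ (fun t => B * gamma ^+ t)).
- by move=> t /=; exact: normr_ge0.
- by move=> t /=; rewrite mulr_ge0 ?exprn_ge0.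
- by move=> t /=; rewrite normrM ger0_norm ?exprn_ge0 // mulrC ler_wpM2r ?exprn_ge0.
- apply: (@is_cvg_geometric_series _ B gamma).
  by rewrite ger0_norm //; case/andP: g01.
Qed.

Lemma gpartial_tail a B N M : (forall t, `|a t| <= B) -> (N <= M)%N ->
  `|gpartial a M - gpartial a N| <= B / (1 - gamma) * gamma ^+ N.
Proof.
move=> aB NM; have B0 : 0 <= B by apply: le_trans (aB 0%N).
have key k : `|gpartial a (N + k) - gpartial a N| <= B * (gamma ^+ N - gamma ^+ (N + k)) / (1 - gamma).
  elim: k => [|k IH]; first by rewrite addn0 !subrr normr0 mulr0 mul0r.
  rewrite addnS {1}/gpartial big_ord_recr /= -/(gpartial a (N + k)) addrAC.
  apply: le_trans (ler_normD _ _) _; rewrite normrM ger0_norm ?exprn_ge0 //.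
  apply: (@le_trans _ _ (B * (gamma ^+ N - gamma ^+ (N + k)) / (1 - gamma) + gamma ^+ (N + k) * B)).
    by apply: lerD => //; apply: ler_wpM2l => //; rewrite exprn_ge0.
  by apply: le_of_eq; rewrite exprS; field; rewrite gt_eqF.
rewrite -(subnKC NM); apply: le_trans (key _) _.
rewrite mulrAC; apply: ler_wpM2l; first by apply: divr_ge0 => //; exact: ltW.
by rewrite lerBlDr lerDl exprn_ge0.
Qed.

Lemma gsum_tail a B N : (forall t, `|a t| <= B) ->
  `|gsum a - gpartial a N| <= B / (1 - gamma) * gamma ^+ N.
Proof.
move=> aB; have c := gsum_cvg aB; apply/ler_addgt0Pr => e e0.
have /cvgrPdist_le/(_ e e0) [M _ hM] := c.
have {}hM : `|gsum a - gpartial a (maxn M N)| <= e by apply: hM; rewrite /= leq_maxl.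
have h := gpartial_tail aB (leq_maxr M N).
have -> : gsum a - gpartial a N = (gpartial a (maxn M N) - gpartial a N) +
  (gsum a - gpartial a (maxn M N)) by ring.
by apply: le_trans (ler_normD _ _) _; apply: lerD.
Qed.

Lemma gsum_bound a B : (forall t, `|a t| <= B) -> `|gsum a| <= B / (1 - gamma).
Proof.
by move=> /(gsum_tail 0); rewrite /gpartial big_ord0 subr0 expr0 mulr1.
Qed.

Lemma gsum_shift a B : (forall t, `|a t| <= B) ->
  gsum a = a 0%N + gamma * gsum (fun t => a t.+1).
Proof.
move=> aB; pose a' t := a t.+1; have aB' t : `|a' t| <= B by exact: aB.
have B0 : 0 <= B by apply: le_trans (aB 0%N).
have gB := gsum_bound aB'.
apply: (gsum_unique (B := B / (1 - gamma))) => -[|N].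
  rewrite /gpartial big_ord0 subr0 expr0 mulr1; apply: le_trans (ler_normD _ _) _.
  have -> : B / (1 - gamma) = B + gamma * (B / (1 - gamma)) by field; rewrite gt_eqF.
  by rewrite lerD // normrM ger0_norm // ler_wpM2l.
have -> : gpartial a N.+1 = a 0%N + gamma * gpartial a' N.
  rewrite /gpartial big_ord_recl expr0 mul1r mulr_sumr; congr (_ + _).
  by apply: eq_bigr => i _; rewrite lift0 exprS mulrA.
rewrite opprD addrACA subrr add0r -mulrBr normrM ger0_norm // exprS mulrCA.
by rewrite ler_wpM2l // (gsum_tail N aB').
Qed.

Lemma gsum_sum (I : finType) (c : I -> R) (a : I -> nat -> R) B :
  (forall i t, `|a i t| <= B) ->
  gsum (fun t => \sum_i c i * a i t) = \sum_i c i * gsum (a i).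
Proof.
move=> aB; apply: (gsum_unique (B := (\sum_i `|c i|) * (B / (1 - gamma)))) => N.
have -> : gpartial (fun t => \sum_i c i * a i t) N = \sum_i c i * gpartial (a i) N.
  rewrite /gpartial; under eq_bigr do rewrite mulr_sumr.
  rewrite exchange_big; apply: eq_bigr => i _; rewrite mulr_sumr.
  by apply: eq_bigr => t _; rewrite mulrCA.
rewrite -sumrB mulr_suml mulr_suml; apply: le_trans (ler_norm_sum _ _ _) _.
apply: ler_sum => i _; rewrite -mulrBr normrM -mulrA ler_wpM2l //.
exact: gsum_tail.
Qed.

End discounted_sum.

(** * The state-action chain *)

Section measurable_limit.
Context (R : realType) (d : measure_display) (T : measurableType d).

(** [limn] returns [point] on divergent sequences, so the convergence set must be measurable too: it
    is where the upper and lower limits agree and are finite. *)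
Lemma measurable_limn (h : nat -> T -> R) :
  (forall n, measurable_fun [set: T] (h n)) ->
  measurable_fun [set: T] (fun x => limn (h ^~ x)).
Proof.
move=> mh; pose H n x := (h n x)%:E.
have mH n : measurable_fun [set: T] (H n) by exact/measurable_EFinP.
pose S x := limn_esup (H ^~ x); pose I x := limn_einf (H ^~ x).
have mS : measurable_fun [set: T] S by exact: measurable_fun_limn_esup.
have mI : measurable_fun [set: T] I.
  have -> : I = (fun x => - limn_esup (fun n => (- h n x)%:E))%E.
    by apply/funext => x; rewrite /I -limn_einfN; congr limn_einf; apply/funext => n /=; rewrite opprK.
  apply: measurableT_comp => //; apply: measurable_fun_limn_esup => n.
  by apply/measurable_EFinP; exact: measurable_funN.
pose F x : \bar R := (fine (S x))%:E.
have mF : measurable_fun [set: T] F.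
  by apply/measurable_EFinP; apply: measurableT_comp => //; exact: fine_measurable.
have -> : (fun x => limn (h ^~ x)) =
    fun x => if (S x == I x) && (S x == F x) then fine (S x) else point.
  apply/funext => x; case: ifPn.
    move=> /andP[/eqP SI /eqP SF].
    have c : H ^~ x @ \oo --> S x.
      apply: (@squeeze_cvge _ _ _ _ (einfs (H ^~ x)) _ (esups (H ^~ x))).
      - near=> n; rewrite /einfs /esups /sdrop; apply/andP; split.
          by apply: ereal_inf_lbound; exists n => //=.
        by apply: ereal_sup_ubound; exists n => //=.
      - by rewrite SI /I limn_einf_lim; apply: is_cvg_einfs.
      - by rewrite /S limn_esup_lim; apply: is_cvg_esups.
    have c' : h ^~ x @ \oo --> fine (S x).
      by rewrite SF in c; exact: (fine_cvg c).
    exact: cvg_lim.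
  rewrite negb_and => Hn.
  rewrite dvgP // => /cvg_ex[l hl].
  have c : H ^~ x @ \oo --> l%:E by apply: cvg_EFin; [near=> n | exact: hl].
  have [SE IE] : S x = l%:E /\ I x = l%:E.
    have [e1 e2] := cvg_limn_einf_sup c; split => //.
  by move: Hn; rewrite SE IE /F SE !eqxx.
apply: measurable_fun_ifT => //.
  by apply: measurable_and; exact: measurable_fun_eqe.
by apply: measurableT_comp => //; exact: fine_measurable.
Unshelve. all: by end_near. Qed.

End measurable_limit.

(* Costs are bounded almost surely only; clipping bounds them everywhere and
   changes them on a null set. *)
Definition clip (R : realType) (b x : R) : R := Num.max (- b) (Num.min b x).

Section clip.
Context (R : realType) (b : R).
Hypothesis b0 : 0 <= b.

Lemma clip_le x : `|clip b x| <= b.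
Proof.
rewrite ler_norml /clip le_max lexx /= ge_max ge_min lexx /= andbT.
by rewrite (le_trans _ b0) // oppr_le0.
Qed.

Lemma clip_id x : - b <= x <= b -> clip b x = x.
Proof. by move=> /andP[h1 h2]; rewrite /clip min_r // max_r. Qed.

Lemma clip_bm : bm (clip b : measurableTypeR R -> R).
Proof.
split; last by exists b => x; exact: clip_le.
apply: measurable_maxr; first exact: measurable_cst.
by apply: measurable_minr; [exact: measurable_cst | exact: measurable_id].
Qed.

End clip.

Lemma dist_sum_bound (R : realType) (F : finType) (q f : F -> R) B :
  is_dist q -> (forall x, `|f x| <= B) -> `|\sum_x q x * f x| <= B.
Proof.
move=> [q0 q1] fB; apply: le_trans (ler_norm_sum _ _ _) _.
rewrite -[leRHS]mul1r -q1 mulr_suml; apply: ler_sum => y _.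
by rewrite normrM ger0_norm // ler_wpM2l.
Qed.

Lemma dist_le1 (R : realType) (F : finType) (q : F -> R) x : is_dist q -> `|q x| <= 1.
Proof. by move=> [q0 q1]; rewrite ger0_norm // -q1 (bigD1 x) //= lerDl sumr_ge0. Qed.

Section chain.
Context (R : realType) (S A : finType) (n d : nat).
Context (dT : measure_display) (T : measurableType dT).
Context (pb : problem R S A n d T) (gamma Cmax : R).
Implicit Types (theta : 'rV[R]_n) (x y : S * A) (xi q f : S * A -> R).

Let Cm := `|Cmax|.
Let Cm0 : 0 <= Cm. Proof. exact: normr_ge0. Qed.

Definition ptrans theta x y : R := trans pb x.1 x.2 y.1 * policy pb theta y.1 y.2.

(** The kernel [ptrans] acting on weights; [pullf] is its action on functions, and [push_pull] their
    duality. *)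
Definition pushf theta q y : R := \sum_x q x * ptrans theta x y.

Definition pullf theta f x : R := \sum_y ptrans theta x y * f y.

Lemma policy_ge0 theta s a : 0 <= policy pb theta s a.
Proof. by have [] := policyP pb theta s. Qed.

Lemma policy_sum theta s : \sum_a policy pb theta s a = 1.
Proof. by have [] := policyP pb theta s. Qed.

Lemma trans_ge0 s a s' : 0 <= trans pb s a s'.
Proof. by have [] := transP pb s a. Qed.

Lemma trans_sum s a : \sum_s' trans pb s a s' = 1.
Proof. by have [] := transP pb s a. Qed.

Lemma ptrans_ge0 theta x y : 0 <= ptrans theta x y.
Proof. by rewrite mulr_ge0 ?trans_ge0 ?policy_ge0. Qed.

Lemma sum_policy theta (g : S -> R) (h : S * A -> R) :
  \sum_x g x.1 * policy pb theta x.1 x.2 * h x =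
  \sum_s g s * \sum_a policy pb theta s a * h (s, a).
Proof.
rewrite (eq_bigr (fun x => g x.1 * policy pb theta x.1 x.2 * h (x.1, x.2))); last by case.
rewrite -(pair_bigA _ (fun s a => g s * policy pb theta s a * h (s, a))) /=.
apply: eq_bigr => s _; rewrite mulr_sumr; apply: eq_bigr => a _.
by rewrite mulrA.
Qed.

Lemma sum_policy1 theta (g : S -> R) :
  \sum_(x : S * A) g x.1 * policy pb theta x.1 x.2 = \sum_s g s.
Proof.
have := sum_policy theta g (fun=> 1).
under eq_bigr do rewrite mulr1; move=> ->; apply: eq_bigr => s _.
by under eq_bigr do rewrite mulr1; rewrite policy_sum mulr1.
Qed.

Lemma ptrans_sum theta x : \sum_y ptrans theta x y = 1.
Proof. by rewrite /ptrans (sum_policy1 theta (trans pb x.1 x.2)) trans_sum. Qed.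

Lemma pushf_sum theta q : \sum_y pushf theta q y = \sum_x q x.
Proof.
rewrite /pushf exchange_big; apply: eq_bigr => x _.
by rewrite -mulr_sumr ptrans_sum mulr1.
Qed.

Lemma pushf_ge0 theta q : (forall x, 0 <= q x) -> forall y, 0 <= pushf theta q y.
Proof. by move=> q0 y; apply: sumr_ge0 => x _; rewrite mulr_ge0 ?ptrans_ge0. Qed.

Lemma push_pull theta q f :
  \sum_y pushf theta q y * f y = \sum_x q x * pullf theta f x.
Proof.
rewrite /pushf /pullf; under eq_bigr do rewrite mulr_suml.
rewrite exchange_big; apply: eq_bigr => x _; rewrite mulr_sumr.
by apply: eq_bigr => y _; rewrite mulrA.
Qed.

Lemma iter_push_pull theta q f t :
  \sum_y iter t (pushf theta) q y * f y = \sum_x q x * iter t (pullf theta) f x.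
Proof.
elim: t f => [//|t IH] f; by rewrite iterS push_pull IH iterSr.
Qed.

Lemma iter_push_dist theta q t : is_dist q -> is_dist (iter t (pushf theta) q).
Proof.
move=> qd; elim: t => [//|t [IH0 IH1]]; rewrite iterS; split.
  exact: pushf_ge0.
by rewrite pushf_sum.
Qed.

Lemma pullf_bound theta f B : (forall x, `|f x| <= B) -> forall x, `|pullf theta f x| <= B.
Proof.
move=> fB x; apply: le_trans (ler_norm_sum _ _ _) _.
rewrite -[leRHS]mul1r -(ptrans_sum theta x) mulr_suml; apply: ler_sum => y _.
by rewrite normrM ger0_norm ?ptrans_ge0 // ler_wpM2l ?ptrans_ge0.
Qed.

Lemma iter_pull_bound theta f B t : (forall x, `|f x| <= B) ->
  forall x, `|iter t (pullf theta) f x| <= B.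
Proof. by move=> fB; elim: t => [//|t IH]; rewrite iterS; exact: pullf_bound. Qed.

Lemma start_dist theta (xi : S -> R) : is_dist xi -> is_dist (start pb theta xi).
Proof.
move=> [x0 x1]; split => [x|]; first by rewrite mulr_ge0 ?policy_ge0.
by rewrite sum_policy1.
Qed.

Lemma point_is_dist (F : finType) (x : F) : is_dist (point_dist R x).
Proof.
split => [y|]; first by rewrite ler0n.
rewrite (bigD1 x) //= /point_dist eqxx big1 ?addr0 // => y yx.
by rewrite (negPf yx).
Qed.

Section trajectory.
Variables (theta : 'rV[R]_n) (xi : S * A -> R).
Hypothesis xid : is_dist xi.

Let P := law pb theta xi.
Let X := visit pb.
Let C := cost pb.

Let obs : observable X C. Proof. by have [] := lawP pb theta xid. Qed.

Lemma trajectory_joint t x y (B : set (measurableTypeR R)) : measurable B ->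
  mean P (fun w => \1_(X t @^-1` [set x]) w * \1_(X t.+1 @^-1` [set y]) w * \1_B (C t w)) =
  mean P \1_(X t @^-1` [set x]) * (ptrans theta x y * mean (costlaw pb x.1 x.2 y.1) \1_B).
Proof.
move=> mB; have [mX mC] := obs; have mCB : measurable (C t @^-1` B).
  by rewrite -[_ @^-1` _]setTI; apply: mC.
have -> : (fun w => \1_(X t @^-1` [set x]) w * \1_(X t.+1 @^-1` [set y]) w * \1_B (C t w)) =
  \1_([set: T] `&` X t @^-1` [set x] `&` C t @^-1` B `&` X t.+1 @^-1` [set y]) :> (T -> R).
  by apply/funext => u; rewrite setTI !indicI /=; ring.
rewrite mean_indic; last by rewrite setTI; do 2!apply: measurableI => //.
have [_ _ Pjoint] := lawP pb theta xid.
rewrite Pjoint //; last first.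
  exact: (@measurableT _ (g_sigma_algebraType (fun E : set T => exists i : nat, (0 <= i < t)%N /\ ((exists z, E = X i @^-1` [set z]) \/ (exists B : set (measurableTypeR R), measurable B /\ E = C i @^-1` B))))).
rewrite setTI !mean_indic // /ptrans.
rewrite !fineM ?fin_num_measure //=; first by rewrite mulrA.
by rewrite fin_numM // fin_num_measure.
Qed.

(** Chapman-Kolmogorov: [trajectory_joint] with the trivial cost event, summed over the pair visited
    at time [t]. *)
Lemma mean_visit t x : mean P \1_(X t @^-1` [set x]) = iter t (pushf theta) xi x.
Proof.
have [mX mC] := obs; have [_ P0 _] := lawP pb theta xid.
elim: t x => [|t IH] x; first by rewrite mean_indic // P0.
rewrite iterS /pushf.
have -> : \1_(X t.+1 @^-1` [set x]) = fun w => \sum_y \1_(X t @^-1` [set y]) w *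
     \1_(X t.+1 @^-1` [set x]) w * \1_[set: R] (C t w) :> R.
  apply/funext => w; rewrite (bigD1 (X t w)) //= big1 ?addr0; last first.
    move=> z zZ; rewrite indicE memNset ?mul0r // => /= /esym/eqP; exact/negP.
  by rewrite [X in X * _ * _]indicE mem_set // mul1r [X in _ * X]indicE in_setT mulr1.
rewrite mean_sum; last first.
  move=> y; apply: bm_mul; first by apply: bm_mul; exact: bm_indic.
  by under eq_fun do rewrite indicE in_setT; exact: bm_cst.
apply: eq_bigr => y _; rewrite trajectory_joint // IH mean_indic //.
by rewrite probability_setT /= mulr1.
Qed.

Lemma law_visit t x : fine (P (X t @^-1` [set x])) = iter t (pushf theta) xi x.
Proof. by have [mX mC] := obs; rewrite -mean_visit mean_indic. Qed.

Lemma trajectory_cost t x y psi : bm (psi : measurableTypeR R -> R) ->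
  mean P (fun w => \1_(X t @^-1` [set x]) w * \1_(X t.+1 @^-1` [set y]) w * psi (C t w)) =
  iter t (pushf theta) xi x * (ptrans theta x y * mean (costlaw pb x.1 x.2 y.1) psi).
Proof.
move=> bpsi; have [mX mC] := obs; rewrite mulrA.
apply: mean_law => // [|B mB]; first by apply: bm_mul; exact: bm_indic.
by rewrite trajectory_joint // mean_visit mulrA.
Qed.

End trajectory.

End chain.

(** * Value functions and the policy gradient *)

Lemma grad_ln (R : realType) n (f : 'rV[R]_n -> R) x :
  (forall i y, derivable f y (delta_mx 0 i)) -> 0 < f x ->
  grad (fun y => ln (f y)) x = (f x)^-1 *: grad f x.
Proof.
move=> df fx; apply/rowP => i; rewrite !mxE /partial.
pose g (r : R) := f (x + r *: delta_mx 0 i).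
have g0 : g 0 = f x by rewrite /g scale0r addr0.
have dg : is_derive (0 : R) 1 g (partial f i x).
  by have := @is_derive_line _ _ f i x 0 (df i); rewrite scale0r addr0.
have dln : is_derive (g 0) 1 (@ln R) (g 0)^-1 by apply: is_derive1_ln; rewrite g0.
have := @is_derive1_comp _ (@ln R) g 0 _ _ dln dg; rewrite g0 => -[_ <-].
have E : (fun h : R => h^-1 *: (((fun y => ln (f y)) \o shift x) (h *: delta_mx 0 i) - ln (f x))) =
         (fun h : R => h^-1 *: (((@ln R \o g) \o shift 0) (h *: (1 : R)) - (@ln R \o g) 0)).
  apply/funext => h /=; have -> : h *: (1 : R) = h by rewrite /GRing.scale /= mulr1.
  by rewrite g0 addr0 /g (addrC x).
by rewrite /derive E.
Qed.

Lemma sum_pair (V : nmodType) (S A : finType) (f : S * A -> V) :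
  \sum_x f x = \sum_s \sum_a f (s, a).
Proof.
rewrite (eq_bigr (fun x => f (x.1, x.2))); last by case.
by rewrite -(pair_bigA _ (fun s a => f (s, a))).
Qed.

Section value.
Context (R : realType) (S A : finType) (n d : nat).
Context (dT : measure_display) (T : measurableType dT).
Context (pb : problem R S A n d T) (gamma Cmax : R).
Implicit Types (theta : 'rV[R]_n) (x y : S * A) (xi q f : S * A -> R).

Local Notation Cm := `|Cmax|.
Local Notation push := (pushf pb).
Local Notation pull := (pullf pb).

Hypothesis g01 : 0 < gamma < 1.
Hypothesis bc : bounded_costs pb Cmax.

Let g0 : 0 <= gamma. Proof. by case/andP: g01 => /ltW. Qed.
Let g1 : 0 < 1 - gamma. Proof. by rewrite subr_gt0; case/andP: g01. Qed.

(** Clipping keeps this finite also for transitions of probability zero, whose cost law is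
    arbitrary; on possible transitions the clipping changes nothing almost surely. *)
Definition mcost (s : S) (a : A) (s' : S) : R :=
  mean (costlaw pb s a s') (clip Cm : measurableTypeR R -> R).

Definition cbar x : R := \sum_s' trans pb x.1 x.2 s' * mcost x.1 x.2 s'.

(** The analytic form of the action value, a series over the finite chain; [QstarE] identifies it
    with the expectation over trajectories. *)
Definition Qv theta x : R := gsum gamma (fun t => iter t (pull theta) cbar x).

Lemma mcost_bound s a s' : `|mcost s a s'| <= Cm.
Proof. by apply: mean_norm; [exact: clip_bm | move=> x; exact: clip_le]. Qed.

Lemma cbar_bound x : `|cbar x| <= Cm.
Proof. exact: dist_sum_bound (transP pb x.1 x.2) (mcost_bound x.1 x.2). Qed.

Lemma pullf_fst theta (h : S -> R) x :
  pull theta (fun y => h y.1) x = \sum_s' trans pb x.1 x.2 s' * h s'.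
Proof.
rewrite /pullf /ptrans (sum_policy pb theta (trans pb x.1 x.2) (fun y => h y.1)).
by apply: eq_bigr => s _; rewrite /= -mulr_suml policy_sum mul1r.
Qed.

Let Um theta t x : `|iter t (pull theta) cbar x| <= Cm.
Proof. exact: iter_pull_bound cbar_bound _. Qed.

Lemma Qv_bound theta x : `|Qv theta x| <= Cm / (1 - gamma).
Proof. exact: gsum_bound. Qed.

Lemma QvE theta x : Qv theta x = cbar x + gamma * pull theta (Qv theta) x.
Proof.
rewrite /Qv (gsum_shift g01 (Um theta ^~ x)) /=; congr (_ + _ * _).
exact: (gsum_sum g01 (ptrans pb theta x) (fun y t => Um theta t y)).
Qed.

Lemma costlaw_bounded s a s' : 0 < trans pb s a s' ->
  costlaw pb s a s' [set` `[- Cm, Cm]] = 1%E.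
Proof.
move=> tp.
have mI : measurable ([set` `[- Cm, Cm]] : set (measurableTypeR R)) by exact: measurable_itv.
have mJ : measurable ([set` `[- Cmax, Cmax]] : set (measurableTypeR R)) by exact: measurable_itv.
apply: le_anti; rewrite probability_le1 //= -(bc tp).
apply: le_measure; rewrite ?inE // => z /=; rewrite !in_itv /= => /andP[h1 h2].
have e := ler_norm Cmax; apply/andP; split; lra.
Qed.

Section trajectory_value.
Variables (theta : 'rV[R]_n) (xi : S * A -> R).
Hypothesis xid : is_dist xi.
Let P := law pb theta xi.
Let X := visit pb.
Let C := cost pb.
Let obs : observable X C. Proof. by have [] := lawP pb theta xid. Qed.

Lemma mean_cost t psi : bm (psi : measurableTypeR R -> R) ->
  mean P (fun w => psi (C t w)) = \sum_x iter t (push theta) xi x *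
     \sum_y ptrans pb theta x y * mean (costlaw pb x.1 x.2 y.1) psi.
Proof.
move=> bpsi; have [mX mC] := obs.
have bC := bm_comp (mC t) bpsi.
have sum1 t' w : \sum_x \1_(X t' @^-1` [set x]) w = 1 :> R.
  rewrite (bigD1 (X t' w)) //= big1 ?addr0 ?indicE ?mem_set // => z zZ.
  by rewrite indicE memNset // => /= /esym/eqP; exact/negP.
have -> : (fun w => psi (C t w)) = fun w => \sum_x \sum_y
   \1_(X t @^-1` [set x]) w * \1_(X t.+1 @^-1` [set y]) w * psi (C t w).
  apply/funext => w; under eq_bigr do rewrite -mulr_suml -mulr_sumr sum1 mulr1.
  by rewrite -mulr_suml sum1 mul1r.
have bxy x y : bm (fun w =>
    \1_(X t @^-1` [set x]) w * \1_(X t.+1 @^-1` [set y]) w * psi (C t w)).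
  by apply: bm_mul => //; apply: bm_mul; exact: bm_indic.
rewrite mean_sum; last by move=> x; exact: bm_sum.
apply: eq_bigr => x _; rewrite mean_sum // mulr_sumr.
by apply: eq_bigr => y _; rewrite trajectory_cost.
Qed.

Lemma mean_clip_cost t :
  mean P (fun w => clip Cm (C t w)) = \sum_x xi x * iter t (pull theta) cbar x.
Proof.
rewrite mean_cost; last exact: clip_bm.
rewrite -iter_push_pull; apply: eq_bigr => x _; congr (_ * _).
exact: (pullf_fst theta (mcost x.1 x.2)).
Qed.

Lemma cost_clip_ae : {ae P, forall w, forall t, clip Cm (C t w) = C t w}.
Proof.
have [mX mC] := obs.
have [I mI IE] : {I : set (measurableTypeR R) | measurable I & I = [set` `[- Cm, Cm]]}.
  by exists [set` `[- Cm, Cm]] => //; exact: measurable_itv.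
suff h t : {ae P, forall w, clip Cm (C t w) = C t w} by exact: (ae_foralln h).
pose N := C t @^-1` (~` I).
have mI' : measurable (~` I) by exact: measurableC.
have mN : measurable N by rewrite /N -[_ @^-1` _]setTI; apply: mC.
exists N; split => //; last first.
  move=> w /=; apply: contra_notP => /contrapT; rewrite IE => h.
  by apply: clip_id; move: h; rewrite /= in_itv.
have h : mean P \1_N = 0.
  rewrite -[LHS]/(mean P (fun w => \1_(~` I) (C t w))).
  rewrite mean_cost; last exact: bm_indic.
  rewrite big1 // => x _; rewrite big1 ?mulr0 // => y _.
  (* Impossible transitions have weight zero; for possible ones the cost law puts its whole mass on
     [I]. *)
  have [t0|t0] := eqVneq (trans pb x.1 x.2 y.1) 0; first by rewrite /ptrans t0 !mul0r.
  have tp : 0 < trans pb x.1 x.2 y.1 by rewrite lt0r t0 trans_ge0.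
  rewrite mean_indic // [X in fine X](_ : _ = 0%E) ?mulr0 //.
  have hI : costlaw pb x.1 x.2 y.1 I = 1%E by rewrite IE costlaw_bounded.
  by rewrite [LHS]probability_setC // hI subee.
by move: h; rewrite mean_indic // => /eqP; rewrite fine_eq0 ?fin_num_measure // => /eqP.
Qed.

(** After clipping, the discounted series converges geometrically and uniformly in [w], so limit and
    expectation are exchanged by [gsum_unique]. The original series differs from the clipped one on
    a null set only. *)
Lemma mean_discounted_cost :
  fine ('E_P[discounted_cost pb gamma])%E = \sum_x xi x * Qv theta x.
Proof.
have [mX mC] := obs.
have bC t := bm_comp (mC t) (clip_bm (normr_ge0 Cmax)).
have aB t w : `|clip Cm (C t w)| <= Cm by exact: clip_le.
pose Y w := gsum gamma (fun t => clip Cm (C t w)).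
have bpart N : bm (fun w => gpartial gamma (fun t => clip Cm (C t w)) N).
  by apply: bm_sum => t; apply: bm_mul => //; exact: bm_cst.
have mY : measurable_fun [set: T] Y.
  by apply: measurable_limn => N; have [] := bpart N.
have bY : bm Y.
  by split => //; exists (Cm / (1 - gamma)) => w; exact: gsum_bound.
have mD : measurable_fun [set: T] (discounted_cost pb gamma).
  apply: measurable_limn => N; apply: measurable_sum => t.
  by apply: measurable_funM; [exact: measurable_cst | exact: mC].
have -> : ('E_P[discounted_cost pb gamma] = 'E_P[Y])%E.
  rewrite unlock; apply: ae_eq_integral => //; [exact/measurable_EFinP|exact/measurable_EFinP|].
  have := cost_clip_ae; apply: filterS => w hw _.
  congr (_%:E); congr (limn _); apply/funext => N; apply: eq_bigr => t _.
  by rewrite hw.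
rewrite -/(mean P Y).
have <- : gsum gamma (fun t => mean P (fun w => clip Cm (C t w))) = mean P Y.
  apply: (gsum_unique g01 (B := Cm / (1 - gamma))) => N.
  have -> : gpartial gamma (fun t => mean P (fun w => clip Cm (C t w))) N =
      mean P (fun w => gpartial gamma (fun t => clip Cm (C t w)) N).
    rewrite /gpartial mean_sum; last by move=> t; apply: bm_mul => //; exact: bm_cst.
    by apply: eq_bigr => t _; rewrite mean_scale.
  rewrite -mean_sub //; apply: mean_norm; first exact: bm_sub.
  by move=> w; exact: gsum_tail.
rewrite -(gsum_sum g01 xi (fun x t => Um theta t x)).
by congr gsum; apply/funext => t; rewrite mean_clip_cost.
Qed.

End trajectory_value.

Lemma sum_point (F : finType) (x : F) (f : F -> R) : \sum_y point_dist R x y * f y = f x.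
Proof.
rewrite (bigD1 x) //= /point_dist eqxx mul1r big1 ?addr0 // => y yx.
by rewrite (negPf yx) mul0r.
Qed.

Lemma QstarE theta s a : Qstar pb gamma theta s a = Qv theta (s, a).
Proof. by rewrite /Qstar mean_discounted_cost ?sum_point //; exact: point_is_dist. Qed.

Definition Jv theta s : R := \sum_a policy pb theta s a * Qv theta (s, a).

Lemma JstarE theta s : Jstar pb gamma theta s = Jv theta s.
Proof.
rewrite /Jstar mean_discounted_cost; last exact/start_dist/point_is_dist.
by rewrite (sum_policy pb theta (point_dist R s) (Qv theta)) sum_point.
Qed.

Lemma VE theta : V pb gamma theta = \sum_s Defs.eta pb s * Jv theta s.
Proof. by apply: eq_bigr => s _; rewrite JstarE. Qed.

Lemma Jv_bound theta s : `|Jv theta s| <= Cm / (1 - gamma).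
Proof. by apply: (dist_sum_bound (policyP pb theta s)) => a; exact: Qv_bound. Qed.

Lemma V_bound theta : `|V pb gamma theta| <= Cm / (1 - gamma).
Proof. by rewrite VE; apply: (dist_sum_bound (etaP pb)) => s; exact: Jv_bound. Qed.

Let pt theta t := iter t (push theta) (start pb theta (Defs.eta pb)).
Let ptd theta t : is_dist (pt theta t).
Proof. by apply: iter_push_dist; apply: start_dist; exact: etaP. Qed.

Definition sprob theta t s : R := \sum_a pt theta t (s, a).

(** At every time the action has just been drawn from the policy, so the joint law factors through
    its state marginal. *)
Lemma iter_start theta t x : pt theta t x = sprob theta t x.1 * policy pb theta x.1 x.2.
Proof.
have [g E] : exists g : S -> R, pt theta t = fun x => g x.1 * policy pb theta x.1 x.2.
  case: t => [|t]; first by exists (Defs.eta pb).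
  exists (fun s => \sum_x pt theta t x * trans pb x.1 x.2 s).
  apply/funext => y; rewrite /pt iterS /pushf mulr_suml.
  by apply: eq_bigr => z _; rewrite mulrA.
by rewrite /sprob E /= -mulr_sumr policy_sum mulr1.
Qed.

Lemma sprob_dist theta t : is_dist (sprob theta t).
Proof.
have [p0 p1] := ptd theta t; split => [s|]; first exact: sumr_ge0.
by rewrite -p1 sum_pair.
Qed.

Lemma sprob_le1 theta t s : `|sprob theta t s| <= 1.
Proof. exact: dist_le1 (sprob_dist theta t). Qed.

Lemma state_probE theta t s : state_prob pb t theta s = sprob theta t s.
Proof.
rewrite /state_prob /sprob /pt.
have xid := start_dist pb theta (etaP pb).
have [[mX mC] _ _] := lawP pb theta xid.
have ms : measurable [set w | (visit pb t w).1 = s].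
  have -> : [set w | (visit pb t w).1 = s] = \bigcup_(x in [set x : S * A | x.1 = s]) visit pb t @^-1` [set x].
    apply/seteqP; split => [w /= h|w [x /= <-] -> //].
    by exists (visit pb t w).
  by apply: fin_bigcup_measurable => //; exact: finite_finset.
rewrite -mean_indic //.
have -> : \1_[set w | (visit pb t w).1 = s] =
   fun w => \sum_a \1_(visit pb t @^-1` [set (s, a)]) w :> R.
  apply/funext => w; case E: (visit pb t w) => [s' a'].
  have [ss|ss] := eqVneq s' s.
    rewrite indicE mem_set /=; last by rewrite E.
    rewrite (bigD1 a') //= big1 ?addr0 ?indicE ?mem_set //= ?E ?ss // => a aa.
    rewrite indicE memNset //= E => -[_ h]; by rewrite h eqxx in aa.
  rewrite indicE memNset /=; last by rewrite E /= => h; rewrite h eqxx in ss.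
  rewrite big1 // => a _; rewrite indicE memNset //= E => -[h _].
  by rewrite h eqxx in ss.
rewrite mean_sum; last by move=> a; exact: bm_indic.
by apply: eq_bigr => a _; rewrite mean_visit.
Qed.

(** Discounted state occupancy without the factor [1 - gamma] of [nu], hence of total mass
    [(1 - gamma)^-1]. *)
Definition occ theta s : R := gsum gamma (fun t => sprob theta t s).

Lemma occ_ge0 theta s : 0 <= occ theta s.
Proof.
apply: limr_ge; first exact: (gsum_cvg g01 (fun t => sprob_le1 theta t s)).
near=> N; apply: sumr_ge0 => t _; rewrite mulr_ge0 ?exprn_ge0 //.
by have [] := sprob_dist theta t.
Unshelve. all: by end_near. Qed.

Lemma occ_sum theta : \sum_s occ theta s = (1 - gamma)^-1.
Proof.
have -> : \sum_s occ theta s = gsum gamma (fun t => \sum_s 1 * sprob theta t s).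
  rewrite (gsum_sum g01 (fun=> 1) (fun s t => sprob_le1 theta t s)).
  by apply: eq_bigr => s _; rewrite mul1r.
apply: (gsum_unique g01 (B := (1 - gamma)^-1)) => N.
have -> : gpartial gamma (fun t => \sum_s 1 * sprob theta t s) N = gpartial gamma (fun=> 1) N.
  apply: eq_bigr => t _; congr (_ * _); have [_ p1] := sprob_dist theta t.
  by rewrite -[RHS]p1; apply: eq_bigr => s _; rewrite mul1r.
rewrite gpartial_geometric // mulrBl mul1r opprB addrCA subrr addr0.
by rewrite mulrC ger0_norm // mulr_ge0 ?exprn_ge0 // invr_ge0 ltW.
Qed.

Lemma nuE theta x : nu pb gamma theta x = (1 - gamma) * occ theta x.1 * policy pb theta x.1 x.2.
Proof.
rewrite /nu -mulrA; congr (_ * _); rewrite mulrC.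
(* A one-term instance of [gsum_sum], over ['I_1], pulls the scalar out of the series. *)
have := gsum_sum g01 (fun=> policy pb theta x.1 x.2)
  (fun (_ : 'I_1) t => sprob_le1 theta t x.1).
rewrite big_ord1 => <-; congr (limn _); apply/funext => N.
apply: eq_bigr => t _; rewrite big_ord1 state_probE.
by rewrite -mulrA (mulrC (policy _ _ _ _)).
Qed.

Lemma nu_ge0 theta x : 0 <= nu pb gamma theta x.
Proof. by rewrite nuE !mulr_ge0 ?occ_ge0 ?policy_ge0 // ltW. Qed.

Lemma nu_sum theta : \sum_x nu pb gamma theta x = 1.
Proof.
under eq_bigr do rewrite nuE.
rewrite (sum_policy1 pb theta (fun s => (1 - gamma) * occ theta s)) -mulr_sumr occ_sum.
by rewrite divff // gt_eqF.
Qed.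

(** The difference [y] of the two state values satisfies [y = f + gamma * P y] with the kernel of
    [theta]; unrolling along the chain started from [eta] leaves a term of order [gamma ^+ N].
    Occupancies at [theta] with action values at [theta'] make the identity exact and explicit in
    the policy increment. *)
Lemma performance_difference theta theta' :
  V pb gamma theta' - V pb gamma theta =
  \sum_s occ theta s * \sum_a (policy pb theta' s a - policy pb theta s a) * Qv theta' (s, a).
Proof.
pose y s := Jv theta' s - Jv theta s.
pose f s := \sum_a (policy pb theta' s a - policy pb theta s a) * Qv theta' (s, a).
have yE s : y s = f s + gamma * \sum_a policy pb theta s a * \sum_s' trans pb s a s' * y s'.
  rewrite /y /f mulr_sumr -big_split -sumrB /=; apply: eq_bigr => a _.
  have -> : \sum_s' trans pb s a s' * (Jv theta' s' - Jv theta s') =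
     \sum_s' trans pb s a s' * Jv theta' s' - \sum_s' trans pb s a s' * Jv theta s'.
    by rewrite -sumrB; apply: eq_bigr => s' _; rewrite mulrBr.
  have h1 : Qv theta' (s, a) = cbar (s, a) + gamma * \sum_s' trans pb s a s' * Jv theta' s'.
    by rewrite QvE; congr (_ + _ * _); exact: (sum_policy pb theta' (trans pb s a) (Qv theta')).
  have h2 : Qv theta (s, a) = cbar (s, a) + gamma * \sum_s' trans pb s a s' * Jv theta s'.
    by rewrite QvE; congr (_ + _ * _); exact: (sum_policy pb theta (trans pb s a) (Qv theta)).
  rewrite h2 h1; ring.
have step t : \sum_s sprob theta t s * y s =
    \sum_s sprob theta t s * f s + gamma * \sum_s sprob theta t.+1 s * y s.
  under eq_bigr do rewrite yE mulrDr.
  rewrite big_split /=; congr (_ + _).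
  have -> : \sum_s sprob theta t.+1 s * y s = \sum_x pt theta t.+1 x * y x.1.
    rewrite [RHS](eq_bigr _ (fun x _ => congr1 ( *%R^~ _) (iter_start theta t.+1 x))).
    rewrite (sum_policy pb theta (sprob theta t.+1) (fun x => y x.1)).
    by apply: eq_bigr => s _; rewrite /= -mulr_suml policy_sum mul1r.
  rewrite /pt iterS push_pull mulr_sumr.
  under [RHS]eq_bigr do rewrite pullf_fst -/(pt theta t) iter_start.
  under [LHS]eq_bigr do rewrite mulrCA.
  rewrite -!mulr_sumr; congr (_ * _).
  by rewrite (sum_policy pb theta (sprob theta t) (fun x => \sum_s' trans pb x.1 x.2 s' * y s')).
have s0 s : sprob theta 0 s = Defs.eta pb s.
  by rewrite /sprob /pt /= /start /= -mulr_sumr policy_sum mulr1.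
have -> : V pb gamma theta' - V pb gamma theta = \sum_s sprob theta 0 s * y s.
  by rewrite !VE -sumrB; apply: eq_bigr => s _; rewrite s0 mulrBr.
under [RHS]eq_bigr do rewrite -/(f _) mulrC.
rewrite -(gsum_sum g01 f (fun s t => sprob_le1 theta t s)).
apply/esym; pose B := Cm / (1 - gamma) + Cm / (1 - gamma).
have yB s : `|y s| <= B by apply: le_trans (ler_normB _ _) _; apply: lerD; exact: Jv_bound.
apply: (gsum_unique g01 (B := B)) => N.
suff -> : \sum_s sprob theta 0 s * y s = gpartial gamma (fun t => \sum_s f s * sprob theta t s) N
    + gamma ^+ N * \sum_s sprob theta N s * y s.
  rewrite addrC addKr normrM ger0_norm ?exprn_ge0 // mulrC ler_wpM2r ?exprn_ge0 //.
  exact: dist_sum_bound (sprob_dist theta N) yB.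
elim: N => [|N IH]; first by rewrite /gpartial big_ord0 add0r expr0 mul1r.
rewrite IH step /gpartial big_ord_recr /= -/(gpartial _ _ N) exprSr.
have -> : \sum_s f s * sprob theta N s = \sum_s sprob theta N s * f s.
  by apply: eq_bigr => s _; rewrite mulrC.
ring.
Qed.

(** At a pair where the gap is largest, the two Bellman equations bound this gap [m] by [gamma]
    times the effect of the policy change plus [gamma * m]; then solve for [m]. *)
Lemma Qv_lip theta theta' e :
  (forall s a, `|policy pb theta' s a - policy pb theta s a| <= e) ->
  forall x, `|Qv theta' x - Qv theta x| <=
    gamma * (#|A|%:R * e * (Cm / (1 - gamma))) / (1 - gamma).
Proof.
move=> pe x; set B := Cm / (1 - gamma).
have [xm _ xmP] := @Order.TotalTheory.arg_maxP _ _ _ x xpredT (fun z => `|Qv theta' z - Qv theta z|) isT.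
have {}xmP z : `|Qv theta' z - Qv theta z| <= `|Qv theta' xm - Qv theta xm| by exact: xmP.
set m := `|Qv theta' xm - Qv theta xm| in xmP.
apply: le_trans (xmP x) _; rewrite ler_pdivlMr //.
suff : m <= gamma * (#|A|%:R * e * B + m) by lra.
have mE : m = gamma * `|\sum_y (ptrans pb theta' xm y - ptrans pb theta xm y) * Qv theta' y
             + pull theta (fun y => Qv theta' y - Qv theta y) xm|.
  rewrite /m (QvE theta') (QvE theta) opprD addrACA subrr add0r -mulrBr normrM ger0_norm //.
  congr (_ * `|_|); rewrite /pullf -sumrB -big_split /=; apply: eq_bigr => y _; ring.
rewrite {1}mE; apply: ler_wpM2l => //; apply: le_trans (ler_normD _ _) _; apply: lerD; last first.
  by apply: pullf_bound => z; exact: xmP.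
apply: le_trans (ler_norm_sum _ _ _) _.
apply: (@le_trans _ _ (\sum_y trans pb xm.1 xm.2 y.1 * (e * B))).
  apply: ler_sum => y _; rewrite /ptrans -mulrBr !normrM (ger0_norm (trans_ge0 _ _ _ _)) -mulrA.
  by apply: ler_wpM2l; [exact: trans_ge0 | apply: ler_pM => //; exact: Qv_bound].
rewrite sum_pair /=.
under eq_bigr do rewrite sumr_const -mulr_natl.
by rewrite -mulr_sumr -mulr_suml trans_sum mul1r mulrA.
Qed.

(** The first-order part of [performance_difference], with [Qv] frozen at [theta]. *)
Definition valuegrad theta : 'rV[R]_n := \sum_s occ theta s *:
  \sum_a Qv theta (s, a) *: grad (fun t => policy pb t s a) theta.

(** Mass of [occ], number of actions, then the two errors of freezing: the Taylor remainder of the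
    policy times the bound on [Qv], and the gradient of the policy times the Lipschitz constant from
    [Qv_lip] with [e = 2 * B * enorm h]. *)
Definition value_const (B : R) : R :=
  (1 - gamma)^-1 * (#|A|%:R * (B * (Cm / (1 - gamma)) +
    B * (gamma * (#|A|%:R * (2 * B) * (Cm / (1 - gamma))) / (1 - gamma)))).

Lemma V_taylor B : (forall s a, smooth B (fun t => policy pb t s a)) ->
  taylor (V pb gamma) valuegrad (value_const B).
Proof.
move=> sp theta h; rewrite performance_difference.
have [g hg] := choice (fun x : S * A => sp x.1 x.2).
have gE s a : grad (fun t => policy pb t s a) = g (s, a).
  by have [_ _ t] := hg (s, a); exact: taylor_grad t.
have lip s a : `|policy pb (theta + h) s a - policy pb theta s a| <= 2 * B * enorm h.
  exact: (smooth_lip (sp s a)).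
set Bq := Cm / (1 - gamma).
have Bq0 : 0 <= Bq by rewrite divr_ge0 // ltW.
have e0 := enorm_ge0 h.
pose K := gamma * (#|A|%:R * (2 * B) * Bq) / (1 - gamma).
have QL x : `|Qv (theta + h) x - Qv theta x| <= K * enorm h.
  apply: le_trans (Qv_lip lip x) _; apply: le_of_eq; rewrite /K -/Bq; ring.
have -> : dotv (valuegrad theta) h = \sum_s occ theta s *
    \sum_a Qv theta (s, a) * dotv (g (s, a) theta) h.
  rewrite /valuegrad dotv_suml; apply: eq_bigr => s _; rewrite dotvZl dotv_suml.
  by congr (_ * _); apply: eq_bigr => a _; rewrite dotvZl gE.
rewrite -sumrB; apply: le_trans (ler_norm_sum _ _ _) _.
rewrite /value_const; set K' := #|A|%:R * _.
rewrite -(occ_sum theta) -mulrA mulr_suml; apply: ler_sum => s _.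
rewrite -mulrBr normrM ger0_norm ?occ_ge0 // ler_wpM2l ?occ_ge0 //.
rewrite -sumrB; apply: le_trans (ler_norm_sum _ _ _) _.
rewrite /K' -mulrA mulr_natl -sumr_const; apply: ler_sum => a _.
have -> : (policy pb (theta + h) s a - policy pb theta s a) * Qv (theta + h) (s, a)
      - Qv theta (s, a) * dotv (g (s, a) theta) h =
  (policy pb (theta + h) s a - policy pb theta s a - dotv (g (s, a) theta) h) * Qv (theta + h) (s, a)
  + dotv (g (s, a) theta) h * (Qv (theta + h) (s, a) - Qv theta (s, a)) by ring.
apply: le_trans (ler_normD _ _) _; rewrite [leRHS]mulrDl !normrM; have [_ g1' gt] := hg (s, a).
apply: lerD.
  rewrite [leRHS]mulrAC; apply: ler_pM => //; last exact: Qv_bound.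
apply: (@le_trans _ _ ((B * enorm h) * (K * enorm h))).
  apply: ler_pM => //; apply: le_trans (dotv_le _ _) _; by rewrite ler_wpM2r // g1'.
by apply: le_of_eq; rewrite /K /Bq; ring.
Qed.

(** The policy factor inside [nu] cancels the denominator of the logarithmic derivative; the
    normalization of [nu] leaves [1 - gamma]. *)
Lemma policy_gradient theta :
  (forall s a, 0 < policy pb theta s a) ->
  (forall s a i z, derivable (fun t => policy pb t s a) z (delta_mx 0 i)) ->
  \sum_x (nu pb gamma theta x * Qv theta x) *: grad (fun t => ln (policy pb t x.1 x.2)) theta =
  (1 - gamma) *: valuegrad theta.
Proof.
move=> p0 dp; rewrite /valuegrad scaler_sumr.
rewrite sum_pair; apply: eq_bigr => s _; rewrite scalerA scaler_sumr.
apply: eq_bigr => a _; rewrite grad_ln //.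
by rewrite !scalerA nuE /=; congr (_ *: _); field; rewrite gt_eqF.
Qed.

End value.

(** * Smoothness of the stationary distribution *)

Lemma geometric_small (R : realType) (c lam e : R) : 0 <= lam < 1 -> 0 < e ->
  exists t, c * lam ^+ t <= e.
Proof.
move=> /andP[l0 l1] e0.
have h : (fun t => c * lam ^+ t) @ \oo --> 0.
  by rewrite -(mulr0 c); apply: cvgMr; apply: cvg_expr; rewrite ger0_norm.
have /cvgrPdist_le/(_ e e0)[t _ ht] := h; exists t.
have := ht t (leqnn t); rewrite sub0r normrN; exact: le_trans (ler_norm _).
Qed.

Section stationary.
Context (R : realType) (S A : finType) (n d : nat).
Context (dT : measure_display) (T : measurableType dT).
Context (pb : problem R S A n d T) (C lam : R).
Implicit Types (theta : 'rV[R]_n) (x y : S * A) (q f w : S * A -> R).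

Local Notation push := (pushf pb).
Local Notation N1 w := (\sum_x `|w x|).

Hypothesis lam01 : 0 <= lam < 1.
Hypothesis mix : uniform_mixing pb C lam.

Lemma rho_dist theta : is_dist (rho pb theta).
Proof. by have [] := mix theta. Qed.

Lemma rho_tE t theta xi x : is_dist xi ->
  rho_t pb t theta xi x = iter t (push theta) (start pb theta xi) x.
Proof. by move=> xid; rewrite /rho_t law_visit //; exact: start_dist. Qed.

Lemma pushf_sub theta q f x :
  push theta (fun z => q z - f z) x = push theta q x - push theta f x.
Proof. by rewrite /pushf -sumrB; apply: eq_bigr => z _; rewrite mulrBl. Qed.

Lemma iter_pushf_sub theta k q f :
  iter k (push theta) (fun z => q z - f z) =
  fun z => iter k (push theta) q z - iter k (push theta) f z.
Proof.
elim: k => [//|k IH]; rewrite !iterS IH; apply/funext => z; exact: pushf_sub.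
Qed.

Lemma N1_push theta w : N1 (push theta w) <= N1 w.
Proof.
apply: (@le_trans _ _ (\sum_y \sum_x `|w x| * ptrans pb theta x y)).
  apply: ler_sum => y _; apply: le_trans (ler_norm_sum _ _ _) _.
  by apply: ler_sum => x _; rewrite normrM (ger0_norm (ptrans_ge0 _ _ _ _)).
rewrite exchange_big; apply: ler_sum => x _.
by rewrite -mulr_sumr ptrans_sum mulr1.
Qed.

Lemma N1_iter_push theta k w : N1 (iter k (push theta) w) <= N1 w.
Proof. by elim: k => [//|k IH]; rewrite iterS; apply: le_trans (N1_push _ _) IH. Qed.

(** Mixing only states convergence. Here [q t.+1] is the push of [q t], both approach [rho], and
    pushing does not increase the 1-norm. *)
Lemma rho_stationary theta y : push theta (rho pb theta) y = rho pb theta y.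
Proof.
have etad := etaP pb; pose q t := iter t (push theta) (start pb theta (Defs.eta pb)).
have h t : N1 (fun x => q t x - rho pb theta x) <= C * lam ^+ t.
  have [_ /(_ _ t etad)] := mix theta; apply: le_trans.
  by apply: ler_sum => x _; rewrite rho_tE.
have le1 w x : `|w x| <= N1 w by rewrite (bigD1 x) //= lerDl sumr_ge0.
apply/eqP; rewrite -subr_eq0 -normr_le0; apply/ler_addgt0Pr => e e0; rewrite add0r.
have [t ht] := geometric_small (2 * `|C|) lam01 e0.
have -> : push theta (rho pb theta) y - rho pb theta y =
   (q t.+1 y - rho pb theta y) - push theta (fun x => q t x - rho pb theta x) y.
  by rewrite pushf_sub /q iterS; ring.
apply: le_trans (ler_normB _ _) _; apply: le_trans ht.
have lamt : C * lam ^+ t.+1 <= `|C| * lam ^+ t.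
  have /andP[l0 l1] := lam01; rewrite exprS mulrA; apply: ler_wpM2r; first exact: exprn_ge0.
  by apply: le_trans (ler_norm _) _; rewrite normrM (ger0_norm l0) ler_piMr // ltW.
have lamt' : C * lam ^+ t <= `|C| * lam ^+ t.
  by have /andP[l0 l1] := lam01; rewrite ler_wpM2r ?exprn_ge0 // ler_norm.
rewrite -mulrA mulr_natl mulr2n; apply: lerD.
  exact: le_trans (le_trans (le1 _ _) (h t.+1)) lamt.
apply: le_trans lamt'; apply: le_trans (h t); apply: le_trans (N1_push theta _); exact: le1.
Qed.

Lemma iter_push_kernel theta k w y :
  iter k (push theta) w y = \sum_x w x * iter k (pullf pb theta) (point_dist R y) x.
Proof.
rewrite -iter_push_pull (bigD1 y) //= /point_dist eqxx mulr1 big1 ?addr0 // => z zy.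
by rewrite (negPf zy) mulr0.
Qed.

(** As [w] has mass zero, [rho] may be subtracted from every row of the iterated kernel. A row after
    [k.+1] steps from [x] is the law after [k] steps from the state distribution [trans pb x.1 x.2],
    hence the shift in the exponent. *)
Lemma N1_mixing theta k w : \sum_x w x = 0 ->
  N1 (iter k.+1 (push theta) w) <= `|C| * lam ^+ k * N1 w.
Proof.
move=> w0; pose K x y := iter k.+1 (pullf pb theta) (point_dist R y) x.
have KE x y : K x y = rho_t pb k theta (trans pb x.1 x.2) y.
  rewrite rho_tE; last exact: transP.
  have -> : K x y = iter k.+1 (push theta) (point_dist R x) y.
    by rewrite iter_push_kernel sum_point.
  rewrite iterSr; congr (iter k _ _ _); apply/funext => z.
  by rewrite /pushf sum_point.
have h x : \sum_y `|K x y - rho pb theta y| <= `|C| * lam ^+ k.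
  have [_ /(_ _ k (transP pb x.1 x.2))] := mix theta => hm.
  apply: (@le_trans _ _ (C * lam ^+ k)).
    by apply: le_trans hm; apply: ler_sum => y _; rewrite KE.
  by have /andP[l0 _] := lam01; rewrite ler_wpM2r ?exprn_ge0 // ler_norm.
apply: (@le_trans _ _ (\sum_y \sum_x `|w x| * `|K x y - rho pb theta y|)).
  apply: ler_sum => y _; rewrite iter_push_kernel.
  have -> : \sum_x w x * iter k.+1 (pullf pb theta) (point_dist R y) x =
            \sum_x w x * (K x y - rho pb theta y).
    under [RHS]eq_bigr do rewrite mulrBr.
    by rewrite sumrB -mulr_suml w0 mul0r subr0.
  by apply: le_trans (ler_norm_sum _ _ _) _; apply: ler_sum => x _; rewrite normrM.
rewrite exchange_big mulr_sumr; apply: ler_sum => x _.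
by rewrite -mulr_sumr mulrC ler_wpM2r.
Qed.

(** With [P] for [push theta], [w] is [P^k w] plus the sum of [P^j (w - P w)] over [j < k], and [P]
    does not increase the 1-norm. *)
Lemma N1_telescope theta k w :
  N1 w <= N1 (iter k (push theta) w) + k%:R * N1 (fun x => w x - push theta w x).
Proof.
elim: k => [|k IH]; first by rewrite mul0r addr0.
apply: le_trans IH _; rewrite -natr1 mulrDl mul1r addrA addrAC lerD2r.
apply: (@le_trans _ _ (N1 (iter k.+1 (push theta) w) +
   N1 (iter k (push theta) (fun x => w x - push theta w x)))); last first.
  by rewrite lerD2l N1_iter_push.
rewrite -big_split; apply: ler_sum => x _ /=; rewrite iter_pushf_sub -iterSr -iterS.
set a := iter k _ w x; set b := iter k.+1 _ w x.
rewrite -{1}(subrK b a) addrC; exact: ler_normD.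
Qed.

(** The choice of [m] makes [m.+1] steps at least halve a weight of mass zero, so the first term of
    [N1_telescope] is absorbed: identity minus kernel has a uniformly bounded inverse on mass
    zero. *)
Lemma N1_inverse m : `|C| * lam ^+ m <= 2^-1 -> forall theta w, \sum_x w x = 0 ->
  N1 w <= 2 * m.+1%:R * N1 (fun x => w x - push theta w x).
Proof.
move=> hm theta w w0; have h1 := N1_telescope theta m.+1 w.
have h2 := N1_mixing theta m w0.
have h3 : `|C| * lam ^+ m * N1 w <= 2^-1 * N1 w by rewrite ler_wpM2r // sumr_ge0.
rewrite -mulrA; lra.
Qed.

(* rho solves rho (I - P + 1 v) = v for any fixed distribution v, and mixing
   bounds the inverse of this matrix uniformly in theta. *)
Definition rho_const (m : nat) (B : R) : R :=
  system_const n #|{: S * A}| (2 + B) * ((4 * m%:R + 5) * #|{: S * A}|%:R + 1) ^+ 2.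

Lemma rho_smooth m B x : `|C| * lam ^+ m <= 2^-1 ->
  (forall s a, smooth B (fun t => policy pb t s a)) ->
  smooth (rho_const m B) (fun t => rho pb t x).
Proof.
move=> hm sp; set N := #|{: S * A}|.
have B0 : 0 <= B by case: x => s0 a0; exact: smooth_ge0 (sp s0 a0).
pose v := rho pb 0; have [v0 v1] := rho_dist 0.
have sumN (f : S * A -> R) : \sum_(i < N) f (enum_val i) = \sum_y f y.
  by rewrite -(big_enum_val f); apply: eq_bigl.
pose xx (t : 'rV[R]_n) : 'rV[R]_N := \row_i rho pb t (enum_val i).
pose bb (t : 'rV[R]_n) : 'rV[R]_N := \row_i v (enum_val i).
pose M (t : 'rV[R]_n) : 'M[R]_N := \matrix_(i, j)
  ((i == j)%:R + v (enum_val j) +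
   - trans pb (enum_val i).1 (enum_val i).2 (enum_val j).1 *
     policy pb t (enum_val j).1 (enum_val j).2).
have prodE t (y : 'rV[R]_N) (q : S * A -> R) j : (forall i, y 0 i = q (enum_val i)) ->
    (y *m M t) 0 j = q (enum_val j) - push t q (enum_val j) + (\sum_z q z) * v (enum_val j).
  move=> yq; rewrite mxE.
  under eq_bigr do rewrite mxE yq mulrDr mulrDr.
  rewrite !big_split /= -mulr_suml (sumN q) addrAC; congr (_ + _ + _).
    rewrite (bigD1 j) //= eqxx mulr1 big1 ?addr0 // => i ij.
    by rewrite (negPf ij) mulr0.
  rewrite /pushf -(sumN (fun z => q z * ptrans pb t z (enum_val j))) -sumrN.
  by apply: eq_bigr => i _; rewrite /ptrans mulNr mulrN.
have sys t : xx t *m M t = bb t.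
  apply/rowP => j; rewrite (prodE _ _ (rho pb t)); last by move=> i; rewrite mxE.
  by rewrite rho_stationary subrr add0r mxE; have [_ ->] := rho_dist t; rewrite mul1r.
have sM i j : smooth (2 + B) (fun t => M t i j).
  under eq_fun do rewrite mxE.
  apply: smooth_add.
    apply: smooth_cst; apply: le_trans (ler_normD _ _) _; rewrite (_ : 2 = 1 + 1) //.
    apply: lerD; last exact: dist_le1 (rho_dist 0).
    by case: (i == j); rewrite ?normr1 ?normr0.
  rewrite -[B]mul1r; apply: smooth_mulc; last exact: sp.
  by rewrite normrN; exact: dist_le1 (transP pb _ _).
have sb i : smooth (2 + B) (fun t => bb t 0 i).
  under eq_fun do rewrite mxE.
  apply: smooth_cst; apply: le_trans (dist_le1 _ (rho_dist 0)) _; lra.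
have xB t i : `|xx t 0 i| <= 2 + B.
  rewrite mxE; apply: le_trans (dist_le1 _ (rho_dist t)) _; lra.
have m0 : 0 <= m%:R :> R by rewrite ler0n.
have N0 : 0 <= N%:R :> R by rewrite ler0n.
(* [4 * m + 5] is [2 * (m + 1) * 2 + 1]: the inverse bound applied to a residual of norm at most
   [2 * N1 z], plus the stationary component. *)
set k1 : R := 4 * m%:R + 5; have k10 : 0 <= k1 by rewrite /k1; lra.
have kap1 : 1 <= k1 * N%:R + 1 by rewrite lerDr mulr_ge0.
(* Pushing preserves mass, so [z] has the same mass [sg] as [q]. Subtracting [sg] times [rho] leaves
   a weight of mass zero, to which [N1_inverse] applies; passing from the 1-norm to [enorm] costs
   the factor [N]. *)
have inv t (y : 'rV[R]_N) : enorm y <= (k1 * N%:R + 1) * enorm (y *m M t).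
  pose q z := y 0 (enum_rank z).
  have yq i : y 0 i = q (enum_val i) by rewrite /q enum_valK.
  pose z (u : S * A) := q u - push t q u + (\sum_u' q u') * v u.
  have zE j : (y *m M t) 0 j = z (enum_val j) by exact: prodE.
  set sg := \sum_u q u in z zE.
  have sz : \sum_u z u = sg.
    by rewrite big_split /= sumrB pushf_sum -mulr_sumr v1 mulr1 subrr add0r.
  have sN : `|sg| <= N1 z by rewrite -sz; exact: ler_norm_sum.
  pose w (u : S * A) := q u - sg * rho pb t u.
  have [r0 r1] := rho_dist t.
  have w0 : \sum_u w u = 0 by rewrite sumrB -mulr_sumr r1 mulr1 subrr.
  have rN : N1 (rho pb t) = 1 by rewrite -r1; apply: eq_bigr => u _; rewrite ger0_norm.
  have vN : N1 v = 1 by rewrite -v1; apply: eq_bigr => u _; rewrite ger0_norm.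
  have wz u : w u - push t w u = z u - sg * v u.
    rewrite /w pushf_sub.
    have -> : push t (fun u => sg * rho pb t u) u = sg * rho pb t u.
      rewrite -[in RHS](rho_stationary t) /pushf mulr_sumr.
      by apply: eq_bigr => u' _; rewrite mulrA.
    rewrite /z; ring.
  have h1 := N1_inverse hm t w0.
  have h2 : N1 (fun u => w u - push t w u) <= N1 z + `|sg|.
    apply: (@le_trans _ _ (\sum_u (`|z u| + `|sg| * `|v u|))).
      by apply: ler_sum => u _; rewrite wz -normrM; exact: ler_normB.
    by rewrite big_split /= -mulr_sumr vN mulr1.
  have h3 : N1 q <= N1 w + `|sg|.
    apply: (@le_trans _ _ (\sum_u (`|w u| + `|sg| * `|rho pb t u|))).
      apply: ler_sum => u _; rewrite -normrM -{1}(subrK (sg * rho pb t u) (q u)).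
      exact: ler_normD.
    by rewrite big_split /= -mulr_sumr rN mulr1.
  have z0 : 0 <= N1 z by apply: sumr_ge0.
  have h4 : N1 q <= k1 * N1 z.
    apply: le_trans h3 _; apply: (@le_trans _ _ (2 * m.+1%:R * (N1 z + N1 z) + N1 z)).
      apply: lerD => //; apply: le_trans h1 _; apply: ler_wpM2l; first by rewrite mulr_ge0.
      by apply: le_trans h2 _; rewrite lerD2l.
    by rewrite /k1 -natr1; apply: le_of_eq; ring.
  apply: le_trans (enorm_le_sum _) _.
  have -> : \sum_i `|y 0 i| = N1 q.
    by rewrite -sumN; apply: eq_bigr => i _; rewrite yq.
  apply: le_trans h4 _.
  have h5 : N1 z <= N%:R * enorm (y *m M t).
    apply: (@le_trans _ _ (\sum_(i < N) enorm (y *m M t))).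
      by rewrite -sumN; apply: ler_sum => i _; rewrite -zE; exact: coord_enorm.
    by rewrite sumr_const card_ord mulr_natl.
  rewrite [leRHS]mulrDl mul1r; apply: (@le_trans _ _ (k1 * N%:R * enorm (y *m M t))).
    by rewrite -mulrA ler_wpM2l.
  by rewrite lerDl enorm_ge0.
have := smooth_system sys sM sb xB kap1 inv (enum_rank x).
by under eq_fun do rewrite mxE enum_rankK.
Qed.

End stationary.

(** * Measurable vectors and projections *)

Section measurable_vectors.
Context (R : realType) (d : measure_display) (T : measurableType d).

Lemma measurable_countable_comp (I : countType) (g : T -> I) (h : I -> R) :
  (forall v, measurable (g @^-1` [set v])) -> measurable_fun [set: T] (h \o g).
Proof.
move=> mg _ B mB; rewrite setTI.
have -> : (h \o g) @^-1` B = \bigcup_v (if `[< B (h v) >] then g @^-1` [set v] else set0).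
  apply/seteqP; split => [t /= Bt|t [v _]].
    by exists (g t) => //; rewrite asboolT.
  by case: asboolP => // Bv /= gv; rewrite /= gv.
apply: countable_bigcupT_measurable; first exact: countableP.
by move=> v; case: ifP.
Qed.

Lemma measurable_continuous n (f : 'rV[R]_n -> R) (X : T -> 'rV[R]_n) :
  continuous f -> (forall i, measurable_fun [set: T] (fun t => X t 0 i)) ->
  measurable_fun [set: T] (fun t => f (X t)).
Proof.
move=> cf mX.
(* Rounding X to the grid of mesh 1/(k+1) gives countably valued maps. *)
pose g (k : nat) t : 'rV[int]_n := \row_i Num.floor (k.+1%:R * X t 0 i).
pose r (k : nat) (v : 'rV[int]_n) : 'rV[R]_n := \row_i ((v 0 i)%:~R / k.+1%:R).
apply: (@measurable_fun_cvg _ T R _ (fun k t => f (r k (g k t)))).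
  move=> k; apply: (@measurable_countable_comp _ (g k) (f \o r k)) => v.
  have -> : g k @^-1` [set v] = \bigcap_(i in [set: 'I_n])
      ((fun t => (v 0 i)%:~R <= k.+1%:R * X t 0 i) @^-1` [set true] `&`
       (fun t => k.+1%:R * X t 0 i < (v 0 i + 1)%:~R) @^-1` [set true]).
    apply/seteqP; split => [t /= gv i _|t /= h].
      by rewrite -gv !mxE /= floor_le floorD1_gt.
    apply/rowP => i; rewrite mxE; have /= [h1 h2] := h i I.
    by apply/eqP; rewrite floor_eq ?h1 ?h2.
  apply: fin_bigcap_measurable => [|i _]; first exact: finite_finset.
  have m1 : measurable_fun [set: T] (fun t => k.+1%:R * X t 0 i).
    by apply: measurable_funM.
  apply: measurableI; rewrite -[X in measurable X]setTI.
    exact: (measurable_fun_ler (measurable_cst _) m1 measurableT).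
  exact: (measurable_fun_ltr m1 (measurable_cst _) measurableT).
move=> t _; apply: (@cvg_comp _ _ _ (fun k => r k (g k t)) f _ (nbhs (X t))); last exact: cf.
apply/cvgrPdist_le => e e0; near=> k.
rewrite [`|_|]mx_normrE; apply/bigmax_leP; split; first exact: ltW.
move=> [i0 i] _ /=; rewrite (ord1 i0) !mxE.
set x := X t 0 i.
have k0 : 0 < k.+1%:R :> R by [].
have fl : (Num.floor (k.+1%:R * x))%:~R <= k.+1%:R * x by exact: floor_le.
have fg : k.+1%:R * x < (Num.floor (k.+1%:R * x) + 1)%:~R by exact: floorD1_gt.
rewrite intrD in fg.
have -> : x - (Num.floor (k.+1%:R * x))%:~R / k.+1%:R =
   (k.+1%:R * x - (Num.floor (k.+1%:R * x))%:~R) / k.+1%:R by field; rewrite gt_eqF.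
rewrite ger0_norm; last by rewrite divr_ge0 ?subr_ge0 // ltW.
apply: (@le_trans _ _ (k.+1%:R^-1)).
  by rewrite -[leRHS]mul1r ler_wpM2r ?invr_ge0 // lerBlDr addrC ltW.
apply: ltW; near: k; exact: (near_infty_natSinv_lt (PosNum e0)).
Unshelve. all: by end_near. Qed.

Lemma measurable_select (F : finType) (Z : T -> F) (H : F -> T -> R) :
  (forall z, measurable (Z @^-1` [set z])) ->
  (forall z, measurable_fun [set: T] (H z)) ->
  measurable_fun [set: T] (fun t => H (Z t) t).
Proof.
move=> mZ mH.
have -> : (fun t => H (Z t) t) = fun t => \sum_z \1_(Z @^-1` [set z]) t * H z t.
  apply/funext => t; rewrite (bigD1 (Z t)) //= big1 ?addr0 ?indicE ?mem_set ?mul1r // => z zZ.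
  by rewrite indicE memNset ?mul0r // => /= /esym/eqP; exact/negP.
apply: measurable_sum => z; apply: measurable_funM => //.
Qed.

Lemma bm_select (F : finType) (Z : T -> F) (H : F -> T -> R) :
  (forall z, measurable (Z @^-1` [set z])) ->
  (forall z, bm (H z)) ->
  bm (fun t => H (Z t) t).
Proof.
move=> mZ bH; split; first by apply: measurable_select => // z; have [] := bH z.
have [B hB] := choice (fun z => (bH z).2).
exists (\sum_z `|B z|) => t; apply: le_trans (hB _ _) _.
apply: le_trans (ler_norm _) _; rewrite (bigD1 (Z t)) //= lerDl.
exact: sumr_ge0.
Qed.

Lemma bm_dot k (X Y : T -> 'rV[R]_k) :
  (forall i, bm (fun u => X u 0 i)) ->
  (forall i, bm (fun u => Y u 0 i)) ->
  bm (fun u => dotv (X u) (Y u)).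
Proof. by move=> bX bY; apply: bm_sum => i; exact: bm_mul. Qed.

Lemma bm_dot_cst k (v : 'rV[R]_k) (X : T -> 'rV[R]_k) :
  (forall i, bm (fun u => X u 0 i)) ->
  bm (fun u => dotv v (X u)).
Proof. by move=> bX; apply: bm_dot => // i; exact: bm_cst. Qed.

Lemma bm_norm2 k (X : T -> 'rV[R]_k) :
  (forall i, bm (fun u => X u 0 i)) ->
  bm (fun u => enorm (X u) ^+ 2).
Proof. by move=> bX; under eq_fun do rewrite sqr_enorm; exact: bm_dot. Qed.

End measurable_vectors.

Section projection.
Context (R : realType) (d : nat) (Om : set 'rV[R]_d).
Hypothesis convOm : convex_set Om.

(** If the angle were acute, moving from [y] towards [z] by the fraction [s] would approach [x]: the
    choice of [s] keeps the quadratic term below the linear gain. *)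
Lemma proj_angle x y z : is_proj Om x y -> Om z -> dotv (x - y) (z - y) <= 0.
Proof.
move=> [Oy hy] Oz; rewrite leNgt; apply/negP => p0.
set p := dotv (x - y) (z - y) in p0.
have q0 : 0 < enorm (z - y) ^+ 2.
  rewrite exprn_gt0 // lt0r enorm_ge0 andbT; apply/eqP => /enorm0_eq0 e.
  by move: p0; rewrite /p e dotv0r ltxx.
pose s := Num.min 1 (p / enorm (z - y) ^+ 2).
have s0 : 0 < s by rewrite /s lt_min ltr01 divr_gt0.
have s1 : s <= 1 by rewrite /s ge_min lexx.
have sp : s * enorm (z - y) ^+ 2 <= p.
  by rewrite -ler_pdivlMr // /s ge_min lexx orbT.
have Ow : Om (y + s *: (z - y)).
  have := @convOm z y (Itv01 (ltW s0) s1) (mem_set Oz) (mem_set Oy).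
  rewrite inE; congr Om; rewrite /conv /= /unstable.onem scalerBl scale1r scalerBr.
  by rewrite addrCA.
have h := hy _ Ow.
have {}h : enorm (x - y) ^+ 2 <= enorm (x - y - s *: (z - y)) ^+ 2.
  by rewrite ler_pXn2r ?nnegrE ?enorm_ge0 //; apply: le_trans h _; rewrite opprD addrA.
have ps : 0 < s * p by rewrite mulr_gt0.
have ss : s * (s * enorm (z - y) ^+ 2) <= s * p by rewrite ler_wpM2l // ltW.
rewrite [X in _ <= X]sqr_enormB dotvZr -/p enormZ exprMn real_normK ?num_real // in h.
rewrite expr2 -mulrA in h; lra.
Qed.

Lemma proj_le x y z : is_proj Om x y -> Om z -> enorm (y - z) <= enorm (x - z).
Proof.
move=> pxy Oz; have h := proj_angle pxy Oz.
rewrite -(@ler_pXn2r _ 2) ?nnegrE ?enorm_ge0 //.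
have -> : x - z = (x - y) - (z - y) by rewrite opprB addrA subrK.
rewrite [X in _ <= X]sqr_enormB (enormB y z).
have := sqr_ge0 (enorm (x - y)); lra.
Qed.

(** Adding the two obtuse-angle inequalities bounds the squared distance of the projections by
    [dotv (x - x') (y - y')]. *)
Lemma proj_lip x y x' y' : is_proj Om x y -> is_proj Om x' y' ->
  enorm (y - y') <= enorm (x - x').
Proof.
move=> p p'; have h := proj_angle p (proj1 p'); have h' := proj_angle p' (proj1 p).
have key : enorm (y - y') ^+ 2 <= dotv (x - x') (y - y').
  rewrite sqr_enorm; move: h h'; rewrite !dotvBl !dotvBr.
  rewrite (dotvC y' y); lra.
have [e0|e0] := eqVneq (enorm (y - y')) 0; first by rewrite e0 enorm_ge0.
have ep : 0 < enorm (y - y') by rewrite lt0r e0 enorm_ge0.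
by rewrite -(ler_pM2r ep) -expr2 (le_trans key) // dotv_le_r.
Qed.

Lemma proj_exists x : compact Om -> Om !=set0 -> exists y, is_proj Om x y.
Proof.
move=> cOm Om0.
have cf : continuous (fun y : 'rV[R]_d => enorm (x - y)).
  apply: (@lip_continuous R d _ 1) => y h; rewrite mul1r.
  apply: le_trans (enorm_lipschitz _ _) _.
  by rewrite (_ : x - (y + h) - (x - y) = - h) ?enormN //; apply/rowP => i; rewrite !mxE; ring.
have [|y yO hy] := compact_EVT_min Om0 cOm (f := fun y : 'rV[R]_d => enorm (x - y)).
  exact: continuous_subspaceT.
exists y; split; first by rewrite inE in yO.
by move=> z Oz; apply: hy; rewrite inE.
Qed.

End projection.

(** * Temporal differences *)

Section robbins_monro.
Context (R : realType) (x alpha : nat -> R) (mu K : R).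
Hypothesis mu0 : 0 < mu.
Hypothesis K0 : 0 <= K.
Hypothesis x0 : forall t, 0 <= x t.
Hypothesis a0 : forall t, 0 < alpha t.
Hypothesis adiv : series alpha @ \oo --> +oo.
Hypothesis asq : cvgn (series (fun t => alpha t ^+ 2)).
Hypothesis rec : forall t,
  x t.+1 <= (1 - mu * alpha t + K * alpha t ^+ 2) * x t + K * alpha t ^+ 2.

(** [x + 1] grows at most by the factors [1 + K * alpha ^+ 2], whose product is bounded. If [x]
    stayed above [e], summing the recursion would bound [mu * e] times the divergent sum of the
    steps. Smallness infinitely often is enough, as convergence is part of [is_td_limit]. *)
Lemma robbins_monro_small (e : R) (N : nat) : 0 < e -> exists2 t, (N <= t)%N & x t <= e.
Proof.
move=> e0; pose S2 := limn (series (fun t => alpha t ^+ 2)).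
have sS t : series (fun t => alpha t ^+ 2) t <= S2.
  apply: nondecreasing_cvgn_le => //.
  by apply: nondecreasing_series => i _ _; exact: sqr_ge0.
have s0 t : 0 <= series (fun t => alpha t ^+ 2) t.
  by apply: sumr_ge0 => i _; exact: sqr_ge0.
pose Y := expR (K * S2) * (x 0%N + 1).
have y t : x t + 1 <= expR (K * series (fun t => alpha t ^+ 2) t) * (x 0%N + 1).
  elim: t => [|t IH].
    by rewrite /series /= big_geq // mulr0 expR0 mul1r.
  rewrite /series /= big_nat_recr //= (mulrDr K) expRD -/(series _ t).
  set E := expR (K * _) in IH *.
  have h1 : 1 + K * alpha t ^+ 2 <= expR (K * alpha t ^+ 2) by exact: expR_ge1Dx.
  have p : 0 <= K * alpha t ^+ 2 by rewrite mulr_ge0 // sqr_ge0.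
  have q : 0 <= mu * alpha t * x t by rewrite !mulr_ge0 // ltW.
  apply: (@le_trans _ _ ((1 + K * alpha t ^+ 2) * (x t + 1))).
    have := rec t; lra.
  have xt := x0 t.
  apply: (@le_trans _ _ (expR (K * alpha t ^+ 2) * (x t + 1))).
    by apply: ler_wpM2r => //; lra.
  by rewrite [E * _]mulrC -mulrA ler_wpM2l // expR_ge0.
have yY t : x t + 1 <= Y.
  apply: le_trans (y t) _; apply: ler_wpM2r; first by have := x0 0%N; lra.
  by rewrite ler_expR ler_wpM2l.
have Y1 : 1 <= Y by have := yY 0%N; have := x0 0%N; lra.
apply: contrapT => hN.
have hx t : (N <= t)%N -> e < x t.
  by move=> Nt; rewrite ltNge; apply/negP => xe; apply: hN; exists t.
have key k : x (N + k)%N + mu * e * (series alpha (N + k)%N - series alpha N) <=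
   x N + K * Y * (series (fun t => alpha t ^+ 2) (N + k)%N - series (fun t => alpha t ^+ 2) N).
  elim: k => [|k IH]; first by rewrite addn0 !subrr !mulr0.
  rewrite addnS /series /= !big_nat_recr //= -/(series alpha _) -/(series (fun t => alpha t ^+ 2) _).
  have Nk : (N <= N + k)%N by rewrite leq_addr.
  have h1 := rec (N + k)%N; have h2 := hx _ Nk; have h3 := yY (N + k)%N.
  set t := (N + k)%N in h1 h2 h3 IH *.
  have p : K * alpha t ^+ 2 * (x t + 1) <= K * alpha t ^+ 2 * Y.
    by apply: ler_wpM2l => //; rewrite mulr_ge0 // sqr_ge0.
  have q : mu * alpha t * e <= mu * alpha t * x t.
    by apply: ler_wpM2l; [rewrite mulr_ge0 // ltW | exact: ltW].
  move: IH; rewrite /series /=; lra.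
have : \forall t \near \oo, (Y + K * Y * S2) / (mu * e) + series alpha N < series alpha t.
  by move/cvgryPgt: adiv; apply.
move=> [M _ hM].
have hk := hM (N + M)%N; rewrite /= leq_addl in hk; have {}hk := hk isT.
have := key M; have x1 := x0 (N + M)%N; have yN := yY N.
have me : 0 < mu * e by rewrite mulr_gt0.
have h1 : (Y + K * Y * S2) < mu * e * (series alpha (N + M)%N - series alpha N).
  by rewrite [ltRHS]mulrC -ltr_pdivrMr // ltrBrDr.
have h2 : K * Y * (series (fun t => alpha t ^+ 2) (N + M)%N - series (fun t => alpha t ^+ 2) N) <= K * Y * S2.
  apply: ler_wpM2l; first by rewrite mulr_ge0 //; lra.
  by have := sS (N + M)%N; have := s0 N; lra.
lra.
Qed.

End robbins_monro.

(** * Mean field and mean-square recursion of TD(0) *)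

Section critic.
Context (R : realType) (S A : finType) (n d : nat).
Context (dT : measure_display) (T : measurableType dT).
Context (pb : problem R S A n d T) (gamma Cmax C lam : R).
Implicit Types (theta : 'rV[R]_n) (y : (S * A) * (S * A)) (w D : 'rV[R]_d).

Local Notation Cm := `|Cmax|.

Hypothesis g01 : 0 < gamma < 1.
Hypothesis mix : uniform_mixing pb C lam.
Hypothesis phi1 : forall s a, enorm (feature pb s a) <= 1.

Let g0 : 0 <= gamma. Proof. by case/andP: g01 => /ltW. Qed.
Let g1 : gamma <= 1. Proof. by case/andP: g01 => _ /ltW. Qed.

Definition ft y : 'rV[R]_d := feature pb y.1.1 y.1.2.
Definition ft' y : 'rV[R]_d := feature pb y.2.1 y.2.2.
Definition tdrow y : 'rV[R]_d := gamma *: ft' y - ft y.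

Definition ycost y : R := mcost pb Cmax y.1.1 y.1.2 y.2.1.

Lemma tdrow_norm y : enorm (tdrow y) <= 2.
Proof.
apply: le_trans (enormD _ _) _; rewrite enormN enormZ ger0_norm // (_ : 2 = 1 + 1) //.
apply: lerD; last exact: phi1.
by apply: mulr_ile1 => //; [exact: enorm_ge0 | exact: phi1].
Qed.

Lemma td_stepE alpha y c w :
  td_step pb gamma alpha y c w = w + (alpha * (c + dotv (tdrow y) w)) *: ft y.
Proof. by rewrite /td_step dotvBl dotvZl addrA. Qed.

Lemma mu_law_ge0 theta y : 0 <= mu_law pb theta y.
Proof.
have [r0 _] := rho_dist mix theta.
by rewrite !mulr_ge0 ?trans_ge0 ?policy_ge0.
Qed.

Lemma mu_law_sum theta : \sum_y mu_law pb theta y = 1.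
Proof.
have [_ <-] := rho_dist mix theta.
rewrite sum_pair; apply: eq_bigr => x _.
rewrite (eq_bigr (fun z => rho pb theta x * ptrans pb theta x z)) => [|z _].
  by rewrite -mulr_sumr ptrans_sum mulr1.
by rewrite /mu_law /ptrans mulrA.
Qed.

Definition bvec theta : 'rV[R]_d := \sum_y (mu_law pb theta y * ycost y) *: ft y.

(** Vectors are rows, so the product of the matrix with a column reads
    [w *m (A_mx pb gamma theta)^T]. *)
Lemma mulmx_A theta w : w *m (A_mx pb gamma theta)^T =
  \sum_y (mu_law pb theta y * dotv (tdrow y) w) *: ft y.
Proof.
rewrite /A_mx linear_sum mulmx_sumr; apply: eq_bigr => y _.
apply/rowP => i; rewrite [LHS]mxE [RHS]mxE.
under eq_bigr do rewrite 3!mxE big_ord1 mxE.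
rewrite /dotv mulr_sumr mulr_suml; apply: eq_bigr => k _.
by rewrite -[gamma *: _ - _]/(tdrow y) -/(ft y); ring.
Qed.

Lemma mean_field theta w D :
  \sum_y mu_law pb theta y * ((ycost y + dotv (tdrow y) w) * dotv (ft y) D) =
  dotv (bvec theta + w *m (A_mx pb gamma theta)^T) D.
Proof.
rewrite mulmx_A /bvec -big_split /= dotv_suml; apply: eq_bigr => y _.
by rewrite -scalerDl dotvZl -mulrDr mulrA.
Qed.

Lemma dotv_trmx (M : 'M[R]_d) w D : dotv (w *m M^T) D = dotv (D *m M) w.
Proof.
rewrite /dotv; under eq_bigr do rewrite mxE mulr_suml.
under [RHS]eq_bigr do rewrite mxE mulr_suml.
rewrite exchange_big; apply: eq_bigr => i _; apply: eq_bigr => j _.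
by rewrite mxE; ring.
Qed.

Section conditioned.
Variable mu : R.
Hypothesis cond : critic_conditioning pb gamma mu.

Let mu0 : 0 < mu. Proof. by case: cond => /andP[]. Qed.

Lemma A_negative theta w :
  dotv (w *m (A_mx pb gamma theta)^T) w <= - (mu / 2) * enorm w ^+ 2.
Proof.
rewrite dotv_trmx; have [w0|w0] := eqVneq (enorm w) 0.
  by rewrite (enorm0_eq0 w0) dotv0r enorm0 expr0n mulr0.
have wp : 0 < enorm w by rewrite lt0r w0 enorm_ge0.
have [_ /(_ theta ((enorm w)^-1 *: w))] := cond.
rewrite enormZ ger0_norm ?invr_ge0 ?enorm_ge0 // mulVf // => /(_ erefl).
rewrite -scalemxAl dotvZl dotvZr mulrA -expr2 mulrC.
rewrite -ler_pdivlMr ?exprn_gt0 ?invr_gt0 //.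
by rewrite exprVn invrK.
Qed.

(** Coercivity ([A_negative]) against Cauchy-Schwarz; the bound on the inverse needs no symmetry. *)
Lemma A_inverse theta w :
  enorm w <= (2 / mu) * enorm (w *m (A_mx pb gamma theta)^T).
Proof.
have h := A_negative theta w.
have k := dotv_le (w *m (A_mx pb gamma theta)^T) w.
set a := enorm (w *m _) in k *.
rewrite ler_norml in k; case/andP: k => k _.
have {}k : (mu / 2) * enorm w ^+ 2 <= a * enorm w by lra.
have [w0|w0] := eqVneq (enorm w) 0.
  by rewrite w0 mulr_ge0 ?enorm_ge0 // divr_ge0 // ltW.
have wp : 0 < enorm w by rewrite lt0r w0 enorm_ge0.
rewrite expr2 mulrA ler_pM2r // in k.
by rewrite -ler_pdivrMl ?divr_gt0 // invf_div.
Qed.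

Lemma mu_inv_ge1 : 1 <= 2 / mu.
Proof. by case: cond => /andP[m0 m1] _; rewrite ler_pdivlMr // mul1r; lra. Qed.

Lemma A_unit theta : (A_mx pb gamma theta)^T \in unitmx.
Proof. exact: (system_unit A_inverse). Qed.

Section td_run.
Context (theta : 'rV[R]_n) (dU : measure_display) (U : measurableType dU).
Context (P : probability U R) (Y : nat -> U -> (S * A) * (S * A)) (Co : nat -> U -> R).
Context (alpha : nat -> R) (w0 ws : 'rV[R]_d).
Hypothesis obs : observable Y Co.
Hypothesis fresh : forall t,
  fresh_sample P Y Co 0 t (fun=> mu_law pb theta) (mu_cost pb).
Hypothesis alpha0 : forall t, 0 < alpha t.
Hypothesis wsE : bvec theta + ws *m (A_mx pb gamma theta)^T = 0.

(** The TD run with clipped costs: bounded everywhere at each time, so its moments exist, and almost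
    surely equal to the original run. *)
Fixpoint tdclip (t : nat) (u : U) : 'rV[R]_d :=
  if t is t'.+1 then
    td_step pb gamma (alpha t') (Y t' u) (clip Cm (Co t' u)) (tdclip t' u)
  else w0.

Lemma tdclip_bm t i : past_bm Y Co 0 t (fun u => tdclip t u 0 i).
Proof.
elim: t i => [|t IH] i /=; first exact: bm_cst.
have IH' j : past_bm Y Co 0 t.+1 (fun u => tdclip t u 0 j).
  by apply: past_bm_le (IH j).
have -> : (fun u => td_step pb gamma (alpha t) (Y t u) (clip Cm (Co t u)) (tdclip t u) 0 i) =
  fun u => tdclip t u 0 i + (alpha t * (clip Cm (Co t u) + dotv (tdrow (Y t u)) (tdclip t u))) * ft (Y t u) 0 i.
  by apply/funext => u; rewrite td_stepE !mxE.
apply: bm_add; first exact: IH'.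
pose H y (u : U) := (alpha t * (clip Cm (Co t u) + dotv (tdrow y) (tdclip t u))) * ft y 0 i.
apply: (@bm_select R _ (history Y Co 0 t.+1) _ (Y t) H) => z.
  by apply: sub_sigma_algebra; exists t; split; [exact: ltnSn | left; exists z].
apply: bm_mul; last exact: bm_cst.
apply: bm_mul; first exact: bm_cst.
apply: bm_add; last exact: bm_dot_cst.
by apply: past_cost; [rewrite /= ltnSn | exact: clip_bm].
Qed.

(** The squared temporal difference is at most [(p + 2 * q) ^+ 2 <= 2 * p ^+ 2 + 8 * q ^+ 2], with
    [p = Cm + 2 * enorm ws] and [q] the current error. *)
Definition td_noise : R := 8 + 2 * (Cm + 2 * enorm ws) ^+ 2.

Definition td_error t : R := mean P (fun u => enorm (tdclip t u - ws) ^+ 2).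

Lemma td_mean_recursion t : td_error t.+1 <=
  (1 - mu * alpha t + td_noise * alpha t ^+ 2) * td_error t + td_noise * alpha t ^+ 2.
Proof.
set K := td_noise; pose D u := tdclip t u - ws.
pose e u := clip Cm (Co t u) + dotv (tdrow (Y t u)) (tdclip t u).
have a0 := alpha0 t.
have bDp i : past_bm Y Co 0 t (fun u => D u 0 i).
  under eq_fun do rewrite coordB; apply: bm_sub; [exact: tdclip_bm | exact: bm_cst].
have bD i : bm (fun u => D u 0 i) := past_bm_bm obs (bDp i).
have bft i : bm (fun u => ft (Y t u) 0 i).
  have [mY _] := obs.
  by apply: (@bm_select R _ U _ (Y t) (fun y _ => ft y 0 i)) => // z; exact: bm_cst.
have btd i : bm (fun u => tdrow (Y t u) 0 i).
  have [mY _] := obs.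
  by apply: (@bm_select R _ U _ (Y t) (fun y _ => tdrow y 0 i)) => // z; exact: bm_cst.
have btc i : bm (fun u => tdclip t u 0 i) := past_bm_bm obs (tdclip_bm t i).
have bcl : bm (fun u => clip Cm (Co t u)).
  by have [_ mC] := obs; exact: (bm_comp (mC t) (clip_bm (normr_ge0 Cmax))).
have be : bm e by apply: bm_add => //; exact: bm_dot.
have bDD : bm (fun u => enorm (D u) ^+ 2).
  by under eq_fun do rewrite sqr_enorm; exact: bm_dot.
have bfD : bm (fun u => dotv (ft (Y t u)) (D u)) by exact: bm_dot.
have step u : enorm (tdclip t.+1 u - ws) ^+ 2 <=
   enorm (D u) ^+ 2 + (2 * alpha t) * (e u * dotv (ft (Y t u)) (D u)) +
   (alpha t ^+ 2 * (K * enorm (D u) ^+ 2) + alpha t ^+ 2 * K).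
  have -> : tdclip t.+1 u - ws = D u + (alpha t * e u) *: ft (Y t u).
    by rewrite /= td_stepE /D -/(e u) addrAC.
  rewrite sqr_enormD dotvZr enormZ -addrA; rewrite -[in leRHS]addrA lerD2l.
  apply: lerD; first by apply: le_of_eq; rewrite (dotvC (D u)); ring.
  rewrite -mulrDr !exprMn real_normK ?num_real // exprMn -mulrA ler_wpM2l ?sqr_ge0 //.
  have f1 : enorm (ft (Y t u)) ^+ 2 <= 1 by apply: exprn_ile1; [exact: enorm_ge0 | exact: phi1].
  have e1 : `|e u| <= (Cm + 2 * enorm ws) + 2 * enorm (D u).
    apply: le_trans (ler_normD _ _) _.
    have h1 : `|clip Cm (Co t u)| <= Cm by exact: clip_le.
    have h2 : `|dotv (tdrow (Y t u)) (tdclip t u)| <= 2 * enorm (tdclip t u).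
      by apply: le_trans (dotv_le _ _) _; rewrite ler_wpM2r ?enorm_ge0 ?tdrow_norm.
    have h3 : enorm (tdclip t u) <= enorm (D u) + enorm ws.
      by rewrite -{1}(subrK ws (tdclip t u)) enormD.
    lra.
  set p := Cm + 2 * enorm ws in e1 *; set q := enorm (D u) in e1 *.
  have p0 : 0 <= p by rewrite addr_ge0 // mulr_ge0 // enorm_ge0.
  have q0 : 0 <= q by exact: enorm_ge0.
  have e2 : e u ^+ 2 <= (p + 2 * q) ^+ 2.
    rewrite -(real_normK (num_real (e u))) ler_pXn2r ?nnegrE //; lra.
  apply: (@le_trans _ _ (e u ^+ 2)); first by rewrite ler_piMr ?sqr_ge0.
  apply: le_trans e2 _.
  have -> : K = 8 + 2 * p ^+ 2 by [].
  have s1 := sqr_ge0 (p - 2 * q); have s2 : 0 <= p ^+ 2 * q ^+ 2 by rewrite mulr_ge0 ?sqr_ge0.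
  clearbody p q; nra.
have b1 : bm (fun u => enorm (tdclip t.+1 u - ws) ^+ 2).
  under eq_fun do rewrite sqr_enorm.
  have b i : bm (fun u => (tdclip t.+1 u - ws) 0 i).
    under eq_fun do rewrite coordB.
    by apply: bm_sub; [exact: (past_bm_bm obs (tdclip_bm t.+1 i)) | exact: bm_cst].
  exact: bm_dot.
have beD : bm (fun u => e u * dotv (ft (Y t u)) (D u)) by exact: bm_mul.
have c k : bm (fun=> k : R) := bm_cst _ k.
set x := td_error.
have xS : x t.+1 <= x t + (2 * alpha t) * mean P (fun u => e u * dotv (ft (Y t u)) (D u)) +
  (alpha t ^+ 2 * (K * x t) + alpha t ^+ 2 * K).
  have b2 : bm (fun u => 2 * alpha t * (e u * dotv (ft (Y t u)) (D u))).
    exact: bm_mul.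
  have b3 : bm (fun u => alpha t ^+ 2 * K * enorm (D u) ^+ 2) by exact: bm_mul.
  pose G u := enorm (D u) ^+ 2 + 2 * alpha t * (e u * dotv (ft (Y t u)) (D u)) +
    (alpha t ^+ 2 * K * enorm (D u) ^+ 2 + alpha t ^+ 2 * K).
  have bG : bm G.
    by apply: bm_add; apply: bm_add.
  have stepG u : enorm (tdclip t.+1 u - ws) ^+ 2 <= G u.
    by apply: le_trans (step u) _; rewrite /G !mulrA.
  have h := mean_le P b1 bG stepG.
  apply: (le_trans h); rewrite /G.
  rewrite !mean_add //; try exact: bm_add.
  have xE : x t = mean P (fun u => enorm (D u) ^+ 2) by [].
  rewrite !mean_scale // mean_cst xE; apply: le_of_eq; ring.
(* The fresh sample averages the cross term to the mean field at the iterate; as [ws] is a root,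
   this is the matrix applied to the error, and [A_negative] concludes. *)
have main : mean P (fun u => e u * dotv (ft (Y t u)) (D u)) <= - (mu / 2) * x t.
  have -> : (fun u => e u * dotv (ft (Y t u)) (D u)) = fun u =>
     dotv (ft (Y t u)) (D u) * clip Cm (Co t u) +
     dotv (tdrow (Y t u)) (tdclip t u) * dotv (ft (Y t u)) (D u).
    by apply/funext => u; rewrite /e; ring.
  have pc z : past_bm Y Co 0 t ((fun=> mu_law pb theta) ^~ z : U -> R) by exact: bm_cst.
  have pD z : past_bm Y Co 0 t (fun u => dotv (ft z) (D u)) by exact: bm_dot_cst.
  have pW z : past_bm Y Co 0 t (fun u => dotv (tdrow z) (tdclip t u)).
    by apply: bm_dot_cst => i; exact: tdclip_bm.
  rewrite mean_add; [|exact: bm_mul|by apply: bm_mul => //; exact: bm_dot].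
  rewrite (mean_fresh_cost obs (@fresh t) pc pD (clip_bm (normr_ge0 Cmax))).
  rewrite (mean_fresh obs (@fresh t) pc (H := fun z u => dotv (tdrow z) (tdclip t u) * dotv (ft z) (D u))); last first.
    by move=> z; exact: (bm_mul (pW z) (pD z)).
  have bs1 z := past_bm_bm obs (pD z); have bs2 z := past_bm_bm obs (pW z).
  rewrite -mean_add; last 2 first.
  - by apply: bm_sum => z; do ?apply: bm_mul.
  - by apply: bm_sum => z; do ?apply: bm_mul.
  rewrite -mean_scale //; apply: mean_le.
  - by apply: bm_add; apply: bm_sum => z; do ?apply: bm_mul.
  - exact: bm_mul.
  move=> u; rewrite -big_split /=.
  apply: le_trans (A_negative theta (D u)).
  have -> : D u *m (A_mx pb gamma theta)^T = bvec theta + tdclip t u *m (A_mx pb gamma theta)^T.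
    rewrite mulmxBl addrC; congr (_ + _); apply/esym/eqP.
    by rewrite -addr_eq0 wsE.
  rewrite -mean_field; apply: le_of_eq; apply: eq_bigr => y _.
  by rewrite -mulrDr /ycost /mcost /mu_cost; ring.
have am : alpha t * mean P (fun u => e u * dotv (ft (Y t u)) (D u)) <= alpha t * (- (mu / 2) * x t).
  by rewrite ler_wpM2l // ltW.
lra.
Qed.

End td_run.

End conditioned.

End critic.

(** * The limit of TD(0) is the root of the mean field *)

Section td_limit.
Context (R : realType) (S A : finType) (n d : nat).
Context (dT : measure_display) (T : measurableType dT).
Context (pb : problem R S A n d T) (gamma Cmax mu : R).

Local Notation Cm := `|Cmax|.

Hypothesis g01 : 0 < gamma < 1.
Hypothesis bc : bounded_costs pb Cmax.
Hypothesis phi1 : forall s a, enorm (feature pb s a) <= 1.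
Hypothesis cond : critic_conditioning pb gamma mu.

Let mu0 : 0 < mu. Proof. by case: cond => /andP[]. Qed.

Local Notation AT theta := ((A_mx pb gamma theta)^T).

Lemma mu_cost_bounded y :
  mu_cost pb y [set` `[- Cm, Cm]] = 1%E \/ forall theta, mu_law pb theta y = 0.
Proof.
have [t0|t0] := eqVneq (trans pb y.1.1 y.1.2 y.2.1) 0.
  by right=> theta; rewrite /mu_law t0 mulr0 mul0r.
by left; apply: costlaw_bounded; rewrite // lt0r t0 trans_ge0.
Qed.

Lemma td_limit_eq theta w : is_td_limit pb gamma theta w ->
  bvec pb Cmax theta + w *m AT theta = 0.
Proof.
have fin (a b c : R) : a <= b + c / 4 -> b <= c / 4 -> c - a < c / 4 -> 0 < c -> False by lra.
move=> [dU [U [P [Y [Co [alpha [w0 [om [obs fresh [a0 adiv asq] [om0 omS] cvg_om]]]]]]]]].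
pose ws : 'rV[R]_d := - (bvec pb Cmax theta *m invmx (AT theta)).
have wsE : bvec pb Cmax theta + ws *m AT theta = 0.
  by rewrite mulNmx mulmxKV ?subrr //; exact: A_unit cond theta.
suff -> : w = ws by [].
apply/eqP; rewrite -subr_eq0; apply/eqP/enorm0_eq0/eqP; apply/negPn/negP => r0.
have {}r0 : 0 < enorm (w - ws) by rewrite lt0r r0 enorm_ge0.
(* The truncated distance is bounded, so its mean converges along with the
   iterates; the L2 estimate makes it small infinitely often. *)
pose f (v : 'rV[R]_d) : R := Num.min (enorm (v - ws)) 1.
pose r := f w; have rp : 0 < r by rewrite lt_min r0 ltr01.
have cf : continuous f.
  apply: (@lip_continuous R d _ 1) => x h; rewrite mul1r.
  have e1 := enorm_lipschitz (x + h - ws) (x - ws).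
  have e2 : x + h - ws - (x - ws) = h by apply/rowP => i; rewrite !mxE; ring.
  rewrite e2 in e1; apply: le_trans e1; rewrite /f.
  have [a1|a1] := leP (enorm (x + h - ws)) 1; have [b1|b1] := leP (enorm (x - ws)) 1.
  - by [].
  - rewrite ler0_norm; last lra.
    by rewrite ler0_norm; lra.
  - rewrite ger0_norm; last lra.
    by rewrite ger0_norm; lra.
  - by rewrite subrr normr0.
pose z t := tdclip pb gamma Cmax Y Co alpha w0 t.
have omz : {ae P, forall u, forall t, om t u = z t u}.
  have : {ae P, forall u, forall t, clip Cm (Co t u) = Co t u}.
    apply: ae_foralln => t.
    have := @fresh_cost_ae _ _ _ _ P Y Co obs 0 t _ _ (fresh t)
      (fun=> [set` `[- Cm, Cm]]) (fun=> measurable_itv _) _.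
    move=> /(_ _)/filterS; apply => [u|y].
      by rewrite /= in_itv /= => h; exact: clip_id.
    by case: (mu_cost_bounded y) => h; [left | right=> _; exact: h].
  apply: filterS => u hu t; elim: t => [|t IH]; first by rewrite om0.
  by rewrite omS /z /= -/(z t) IH hu.
have bz t i : bm (fun u => z t u 0 i).
  have h := past_bm_bm obs (tdclip_bm pb gamma Cmax Y Co alpha w0 t i).
  exact: h.
have bsq t : bm (fun u => enorm (z t u - ws) ^+ 2).
  by apply: bm_norm2 => i; under eq_fun do rewrite coordB; apply: bm_sub => //; exact: bm_cst.
have bf t : bm (fun u => f (z t u)).
  split; first by apply: measurable_continuous => // i; have [] := bz t i.
  exists 1 => u; rewrite ger0_norm; first by rewrite /f ge_min lexx orbT.
  by rewrite le_min enorm_ge0 ler01.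
have conv : (fun t => mean P (fun u => f (z t u))) @ \oo --> r.
  have mf t : measurable_fun [set: U] (fun u => (f (z t u))%:E).
    by apply/measurable_EFinP; have [] := bf t.
  have hcv : {ae P, forall u, setT u -> (fun t => (f (z t u))%:E) @ \oo --> cst r%:E u}.
    move: omz cvg_om; apply: filterS2 => u hz hw _.
    have hf : (fun t => f (z t u)) @ \oo --> r.
      have -> : (fun t => f (z t u)) = fun t => f (om t u) by apply/funext => t; rewrite hz.
      by apply: (@cvg_comp _ _ _ (fun t => om t u) f _ (nbhs w)); [exact: hw | exact: cf].
    by apply: cvg_EFin; [near=> t | exact: hf].
  have hdom : {ae P, forall u t, setT u -> (`|(f (z t u))%:E| <= cst 1 u)%E}.
    apply: aeW => u t _; rewrite lee_fin ger0_norm; first by rewrite /f ge_min lexx orbT.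
    by rewrite le_min enorm_ge0 ler01.
  have hint : P.-integrable setT (EFin \o cst (1 : R)) by exact: (bm_integrable P (bm_cst _ 1)).
  have [_ _ h] := dominated_convergence measurableT mf (measurable_cst _) hcv hint hdom.
  have hr : (\int[P]_u cst r%:E u = r%:E)%E.
    rewrite integral_cst // -[RHS]mule1; congr (_ * _)%E; exact: probability_setT.
  rewrite hr in h.
  have -> : (fun t => mean P (fun u => f (z t u))) =
      fine \o (fun t => \int[P]_u (f (z t u))%:E)%E.
    by apply/funext => t; rewrite /mean unlock.
  exact: (fine_cvg h).
have r2 : 0 < r / 4 by rewrite divr_gt0.
have e0 : 0 < (r / 4) ^+ 2 by rewrite exprn_gt0.
have /cvgrPdist_lt/(_ _ r2)[N _ hN] := conv.
have K0 : 0 <= td_noise Cmax ws by rewrite /td_noise addr_ge0 // mulr_ge0 // sqr_ge0.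
have x0 t : 0 <= td_error pb gamma Cmax P Y Co alpha w0 ws t.
  rewrite /td_error -(mean_cst P 0); apply: (mean_le P (bm_cst _ 0) (bsq t)).
  by move=> u; exact: sqr_ge0.
have [t Nt xt] := robbins_monro_small mu0 K0 x0 a0 adiv asq
  (td_mean_recursion g01 phi1 cond w0 obs fresh a0 wsE) N e0.
(* From [q <= q ^+ 2 / (r / 4) + r / 4]. At the time [t] supplied by [robbins_monro_small] the mean
   is thus at most [r / 2], while convergence to [r] keeps it above [3 * r / 4]. *)
have h1 : mean P (fun u => f (z t u)) <= (r / 4)^-1 * td_error pb gamma Cmax P Y Co alpha w0 ws t + r / 4.
  rewrite /td_error -mean_scale // -[X in _ + X](mean_cst P) -mean_add; last 2 first.
  - by apply: bm_mul => //; exact: bm_cst.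
  - exact: bm_cst.
  apply: mean_le => //.
    by apply: bm_add; [apply: bm_mul => //; exact: bm_cst | exact: bm_cst].
  move=> u; apply: (@le_trans _ _ (enorm (z t u - ws))); first by rewrite /f ge_min lexx.
  rewrite -/(z t u); set q := enorm _; have q0 : 0 <= q by exact: enorm_ge0.
  rewrite -(ler_pM2l r2) mulrDr mulVKf ?gt_eqF //.
  have := sqr_ge0 (q - r / 4); rewrite sqrrB; nra.
have h2 : (r / 4)^-1 * td_error pb gamma Cmax P Y Co alpha w0 ws t <= r / 4.
  by rewrite ler_pdivrMl // -expr2.
have h3 : `|r - mean P (fun u => f (z t u))| < r / 4 by exact: hN.
exact: (fin _ _ _ h1 h2 (le_lt_trans (ler_norm _) h3) rp).
Unshelve. all: by end_near. Qed.

End td_limit.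

(** * Smoothness of the critic's target and the small-gain argument *)

Section omega_smooth.
Context (R : realType) (S A : finType) (n d : nat).
Context (dT : measure_display) (T : measurableType dT).
Context (pb : problem R S A n d T) (gamma Cmax mu : R).

Local Notation Cm := `|Cmax|.

Hypothesis g01 : 0 < gamma < 1.
Hypothesis phi1 : forall s a, enorm (feature pb s a) <= 1.
Hypothesis cond : critic_conditioning pb gamma mu.

Variables (Bp Br Bo : R).
Hypothesis sp : forall s a, smooth Bp (fun t => policy pb t s a).
Hypothesis sr : forall x, smooth Br (fun t => rho pb t x).
Hypothesis omB : forall theta i, `|omega pb theta 0 i| <= Bo.
Hypothesis omE : forall theta,
  bvec pb Cmax theta + omega pb theta *m (A_mx pb gamma theta)^T = 0.

(** A bound free of [mu] on the data and the solution: [6 * Br * Bp] comes from the product of [rho]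
    and the policy, 2 bounds the coordinates of [tdrow], [Cm] the costs and [Bo] the solution. *)
Definition moment_const : R := #|{: (S * A) * (S * A)}|%:R * ((2 + Cm) * (6 * Br * Bp)) + Bo.

Lemma mu_law_smooth y : smooth (6 * Br * Bp) (fun t => mu_law pb t y).
Proof.
have sm := smooth_mul (sr y.1) (sp y.2.1 y.2.2).
have t1 : `|trans pb y.1.1 y.1.2 y.2.1| <= 1 by exact: dist_le1 (transP pb _ _).
have := smooth_mulc t1 sm; rewrite mul1r.
by congr smooth; apply/funext => t; rewrite /mu_law mulrCA mulrA.
Qed.

(** An instance of [smooth_system] with [kappa = 2 / mu], so that [mu] enters only through the
    displayed power. *)
Lemma omega_smooth i :
  smooth (system_const n d moment_const * (2 / mu) ^+ 2) (fun t => omega pb t 0 i).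
Proof.
have Bo0 : 0 <= Bo by apply: le_trans (omB 0 i).
have sBB y : 0 <= 6 * Br * Bp := smooth_ge0 (mu_law_smooth y).
have N0 : 0 <= #|{: (S * A) * (S * A)}|%:R :> R by rewrite ler0n.
have Cm0 : 0 <= Cm by [].
have NB : 0 <= #|{: (S * A) * (S * A)}|%:R * ((2 + Cm) * (6 * Br * Bp)).
  (* The sign of [6 * Br * Bp] is read off from a four-tuple; if there is none, the cardinality is
     0. *)
  case: (pickP (fun _ : (S * A) * (S * A) => true)) => [y _|h].
    by apply: mulr_ge0 => //; apply: mulr_ge0; [exact: addr_ge0 | exact: sBB y].
  by rewrite (eq_card0 h) mul0r.
have ft1 y j : `|ft pb y 0 j| <= 1 by apply: le_trans (coord_enorm _ _) _; exact: phi1.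
have td2 y j : `|tdrow pb gamma y 0 j| <= 2.
  by apply: le_trans (coord_enorm _ _) _; exact: tdrow_norm.
have sM j k : smooth moment_const (fun t => (A_mx pb gamma t)^T j k).
  have -> : (fun t => (A_mx pb gamma t)^T j k) = fun t =>
      \sum_y (ft pb y 0 k * tdrow pb gamma y 0 j) * mu_law pb t y.
    apply/funext => t; rewrite mxE /A_mx summxE; apply: eq_bigr => y _.
    by rewrite mxE [X in _ * X]mxE big_ord1 mxE mulrC.
  apply: (@smooth_le _ _ (#|{: (S * A) * (S * A)}|%:R * ((2 + Cm) * (6 * Br * Bp)))).
    by rewrite lerDl.
  apply: smooth_sum => y; apply: smooth_mulc; last exact: mu_law_smooth.
  rewrite normrM; apply: (@le_trans _ _ (1 * 2)); first exact: ler_pM.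
  by rewrite mul1r lerDl.
have sb j : smooth moment_const (fun t => (- bvec pb Cmax t) 0 j).
  have -> : (fun t => (- bvec pb Cmax t) 0 j) = fun t =>
      \sum_y (- (ycost pb Cmax y * ft pb y 0 j)) * mu_law pb t y.
    apply/funext => t; rewrite mxE /bvec summxE -sumrN; apply: eq_bigr => y _.
    by rewrite mxE; ring.
  apply: (@smooth_le _ _ (#|{: (S * A) * (S * A)}|%:R * ((2 + Cm) * (6 * Br * Bp)))).
    by rewrite lerDl.
  apply: smooth_sum => y; apply: smooth_mulc; last exact: mu_law_smooth.
  rewrite normrN normrM; apply: (@le_trans _ _ (Cm * 1)).
    by apply: ler_pM => //; exact: mcost_bound.
  by rewrite mulr1 lerDr.
have xB t j : `|omega pb t 0 j| <= moment_const.
  by apply: le_trans (omB t j) _; rewrite lerDr.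
have sys t : omega pb t *m (A_mx pb gamma t)^T = - bvec pb Cmax t.
  by apply/eqP; rewrite -addr_eq0 addrC omE.
exact: (smooth_system sys sM sb xB (mu_inv_ge1 cond) (A_inverse cond)).
Qed.

End omega_smooth.

(** * First-order motion of the critic's target *)

Section jacobian.
Context (R : realType) (n d : nat) (f : 'rV[R]_n -> 'rV[R]_d) (H : R).
Hypothesis fH : forall i, smooth H (fun t => f t 0 i).

Definition jac (t h : 'rV[R]_n) : 'rV[R]_d :=
  \row_i dotv (grad (fun u => f u 0 i) t) h.

(** [sup_grad] is a real supremum; the smoothness hypothesis shows its set bounded, so the value is
    a true bound and not the default 0. The factor [d] passes from coordinates to the norm. *)
Lemma jac_sup_grad t h : enorm (jac t h) <= d%:R * (`|sup_grad f| * enorm h).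
Proof.
apply: enorm_le_bound => i; rewrite mxE; apply: le_trans (dotv_le _ _) _.
rewrite ler_wpM2r ?enorm_ge0 //; apply: le_trans (ler_norm _).
apply: ub_le_sup; last by exists t, i.
exists H => _ [x [j ->]]; have [g [_ g2 gt]] := fH j.
by rewrite (taylor_grad gt).
Qed.

Lemma jac_taylor t h : enorm (f (t + h) - f t - jac t h) <= d%:R * (H * enorm h ^+ 2).
Proof.
apply: enorm_le_bound => i; have [g [_ _ gt]] := fH i.
rewrite !coordB [jac t h 0 i]mxE (taylor_grad gt); exact: gt.
Qed.

Lemma jac_sum t (I : finType) (c : I -> R) (v : I -> 'rV[R]_n) :
  jac t (\sum_i c i *: v i) = \sum_i c i *: jac t (v i).
Proof.
apply/rowP => j; rewrite mxE summxE dotv_sumr; apply: eq_bigr => i _.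
by rewrite dotvZr !mxE.
Qed.

Lemma jacZ t c h : jac t (c *: h) = c *: jac t h.
Proof. by apply/rowP => j; rewrite !mxE dotvZr. Qed.

End jacobian.

(** * Two coupled recursions with steps of order [1 / sqrt k] *)

Section small_gain.
Context (R : realType) (a b v : nat -> R).
Context (k1 k2 k3 k4 k5 Bv Bd mu delta : R).

(** One common coefficient for the three terms of [actor_window]: [2 * Bv] is the range of the
    shifted values, [2 * k3] comes from the sum of inverse roots. *)
Definition actor_gain : R := (2 * Bv + 2 * k3 + k2) / k1.

(* Small enough that the error fed from the critic through the actor back to the
   critic is at least halved, see step_ratio_small. *)
Definition step_ratio : R := (1 + 2 * k4 * (1 + actor_gain))^-1.

(** The outer 2 undoes the absorption of half of the critic sum; the final 1 pays for the
    [delta ^+ 2] term left by that absorption. *)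
Definition critic_gain : R := 2 * (Bd + 2 * k5 + k4 * actor_gain) + 1.

(** The outer 2 comes from normalizing by [t / 2], and the inverse of [step_ratio] from writing
    [sq t / c] in terms of [sq t / mu]. *)
Definition gain_const : R :=
  2 * (critic_gain + actor_gain * (step_ratio^-1 + 1 + critic_gain)).

Hypothesis k10 : 0 < k1.
Hypothesis k20 : 0 <= k2.
Hypothesis k30 : 0 <= k3.
Hypothesis k40 : 0 <= k4.
Hypothesis k50 : 0 <= k5.
Hypothesis vB : forall k, (0 < k)%N -> `|v k| <= Bv.
Hypothesis b0 : forall k, (0 < k)%N -> 0 <= b k.
Hypothesis bB : forall k, (0 < k)%N -> b k <= Bd.
Hypothesis a0 : forall k, (0 < k)%N -> 0 <= a k.
Hypothesis mu01 : 0 < mu < 1.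

Local Notation sq k := (Num.sqrt (k%:R : R)).

Let c := step_ratio * mu.

Hypothesis actor : forall k, (0 < k)%N ->
  v k.+1 <= v k - (c / sq k) * (k1 * a k) + (c / sq k) * (k2 * (delta ^+ 2 + b k))
            + (c / sq k) ^+ 2 * k3.
Hypothesis critic : forall k, (0 < k)%N ->
  b k.+1 <= b k - mu * (sq k)^-1 * b k + (c / sq k) * (k4 * (a k + b k + delta ^+ 2))
            + k5 * (sq k)^-1 ^+ 2.

Let sq0 k : (0 < k)%N -> 0 < sq k.
Proof. by move=> k0; rewrite sqrtr_gt0 ltr0n. Qed.

Let sq_le k l : (k <= l)%N -> sq k <= sq l.
Proof. by move=> kl; rewrite ler_wsqrtr // ler_nat. Qed.

(** Summation by parts: the increments of [sq] add up to at most [sq t]. The term [sq t * w t] is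
    kept in the claim so that the induction closes. *)
Lemma sum_sqrt_telescope (w : nat -> R) B m t : (0 < m)%N -> (m <= t)%N ->
  (forall k, (0 < k)%N -> 0 <= w k <= B) ->
  \sum_(m <= k < t) sq k * (w k - w k.+1) <= sq t * B.
Proof.
move=> m0 mt wB.
suff : \sum_(m <= k < t) sq k * (w k - w k.+1) + sq t * w t <= sq t * B.
  have t0 : (0 < t)%N := leq_trans m0 mt.
  have : 0 <= sq t * w t by rewrite mulr_ge0 ?(ltW (sq0 t0)) //; have /andP[] := wB _ t0.
  lra.
elim: t mt => [|t IH] mt; first by rewrite leqNgt m0 in mt.
move: mt; rewrite leq_eqVlt => /predU1P[E|].
  rewrite -E big_geq // add0r ler_wpM2l ?(ltW (sq0 m0)) //.
  by have /andP[] := wB _ m0.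
rewrite ltnS => mt; have {}IH := IH mt; rewrite big_nat_recr //=.
have /andP[_ w1] := wB t.+1 isT.
have : (sq t.+1 - sq t) * w t.+1 <= (sq t.+1 - sq t) * B.
  by rewrite ler_wpM2l // subr_ge0 sq_le.
lra.
Qed.

Lemma sum_inv_sqrt m t : (0 < m)%N -> \sum_(m <= k < t) (sq k)^-1 <= 2 * sq t.
Proof.
move=> m0; have [tm|mt] := leqP t m.
  by rewrite big_geq // mulr_ge0 // sqrtr_ge0.
(* With the bound taken at the last index of the sum, a step amounts to [1 / p <= 2 * (p - q)] for
   consecutive roots, that is [(p - q) ^+ 2 >= 0]. *)
suff h j : \sum_(m <= k < m + j) (sq k)^-1 <= 2 * sq (m + j).-1.
  rewrite -(subnKC (ltnW mt)) (le_trans (h _)) // ler_wpM2l //.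
  by apply: sq_le; exact: leq_pred.
elim: j => [|j IH]; first by rewrite addn0 big_geq // mulr_ge0 // sqrtr_ge0.
rewrite addnS big_nat_recr ?leq_addr //=; set k := (m + j)%N in IH *.
have k0 : (0 < k)%N by rewrite (leq_trans m0) // leq_addr.
have s0 := sq0 k0; set p := sq k in s0 *; set q := sq k.-1 in IH.
have q0 : 0 <= q by exact: sqrtr_ge0.
have pE : p ^+ 2 = k%:R by rewrite sqr_sqrtr.
have qE : q ^+ 2 = k%:R - 1.
  by rewrite sqr_sqrtr // -[in RHS](prednK k0) -natr1 addrK.
apply: le_trans (lerD IH (lexx _)) _.
rewrite -(ler_pM2r s0) mulrDl mulVf ?gt_eqF //.
have := sqr_ge0 (p - q); rewrite sqrrB pE qE => h.
have : 2 * p * p = 2 * k%:R by rewrite -mulrA -expr2 pE.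
lra.
Qed.

Lemma actor_gain_ge0 : 0 <= actor_gain.
Proof.
have Bv0 : 0 <= Bv by apply: le_trans (vB (ltn0Sn 0)).
rewrite /actor_gain; apply: divr_ge0; [|exact: ltW]. have h2 := k20; have h3 := k30; lra.
Qed.

Lemma step_ratio_gt0 : 0 < step_ratio.
Proof.
have := actor_gain_ge0 => h; rewrite /step_ratio invr_gt0.
have : 0 <= 2 * k4 * (1 + actor_gain) by rewrite !mulr_ge0 // addr_ge0.
lra.
Qed.

Lemma step_ratio_le1 : step_ratio <= 1.
Proof.
have := actor_gain_ge0 => h; rewrite /step_ratio invf_le1.
  have : 0 <= 2 * k4 * (1 + actor_gain) by rewrite !mulr_ge0 // addr_ge0.
  lra.
by have := step_ratio_gt0; rewrite invr_gt0.
Qed.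

Lemma step_ratio_small : step_ratio * k4 * (1 + actor_gain) <= 2^-1.
Proof.
have h := step_ratio_gt0; have ag := actor_gain_ge0.
have z0 : 0 <= k4 * (1 + actor_gain) by rewrite mulr_ge0 // addr_ge0.
have e : step_ratio * (1 + 2 * k4 * (1 + actor_gain)) = 1.
  by rewrite mulVf // gt_eqF // -invr_gt0.
nra.
Qed.

Let mu0 : 0 < mu. Proof. by case/andP: mu01. Qed.

Let c0 : 0 < c. Proof. by rewrite mulr_gt0 // step_ratio_gt0. Qed.

Let c1 : c <= 1.
Proof.
apply: mulr_ile1; [exact: ltW step_ratio_gt0 | exact: ltW mu0 | exact: step_ratio_le1 |].
by case/andP: mu01 => _ /ltW.
Qed.

Section window.
Variables (m t : nat).
Hypothesis m0 : (0 < m)%N.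
Hypothesis mt : (m < t)%N.

Local Notation sa := (\sum_(m <= k < t) a k).
Local Notation sb := (\sum_(m <= k < t) b k).

Let window_card : \sum_(m <= k < t) delta ^+ 2 <= t%:R * delta ^+ 2.
Proof.
by rewrite sumr_const_nat -[leLHS]mulr_natl ler_wpM2r ?sqr_ge0 // ler_nat leq_subr.
Qed.

Let win k : (m <= k < t)%N -> (0 < k)%N.
Proof. by case/andP => mk _; exact: leq_trans m0 mk. Qed.

(** Multiplying by [sq k / c] makes the coefficient of [a k] constant; adding [Bv] to the values
    makes them nonnegative for [sum_sqrt_telescope]. *)
Lemma actor_window : sa <= actor_gain * (sq t / c + t%:R * delta ^+ 2 + sb).
Proof.
have step k : (m <= k < t)%N ->
    k1 * a k <= c^-1 * (sq k * ((v k + Bv) - (v k.+1 + Bv))) +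
       (k2 * (delta ^+ 2 + b k) + k3 * (sq k)^-1).
  move=> /win kp; have s0 := sq0 kp; have := actor kp.
  set p := sq k in s0 *; move=> h.
  rewrite -(ler_pM2l (divr_gt0 c0 s0)).
  have -> : c / p * (c^-1 * (p * (v k + Bv - (v k.+1 + Bv))) + (k2 * (delta ^+ 2 + b k) + k3 / p)) =
     v k - v k.+1 + c / p * (k2 * (delta ^+ 2 + b k)) + c * (k3 / p ^+ 2).
    by field; rewrite !gt_eqF.
  have : (c / p) ^+ 2 * k3 <= c * (k3 / p ^+ 2).
    have -> : (c / p) ^+ 2 * k3 = c * (c * (k3 / p ^+ 2)) by field; rewrite gt_eqF.
    by rewrite ler_pM2l // ler_piMl // divr_ge0 // sqr_ge0.
  lra.
have Bv0 : 0 <= Bv by apply: le_trans (vB (ltn0Sn 0)).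
have h1 := @sum_sqrt_telescope (fun k => v k + Bv) (2 * Bv) m t m0 (ltnW mt).
have {}h1 : \sum_(m <= k < t) sq k * ((v k + Bv) - (v k.+1 + Bv)) <= sq t * (2 * Bv).
  by apply: h1 => k /vB; rewrite ler_norml => /andP[l1 l2]; apply/andP; split; lra.
have h2 := sum_inv_sqrt t m0.
have h3 := ler_sum_nat step.
rewrite !big_split /= -!mulr_sumr big_split /= in h3.
have ic : 1 <= c^-1 by rewrite invf_ge1.
have T0 : 0 <= sq t by exact: sqrtr_ge0.
rewrite /actor_gain mulrAC ler_pdivlMr // mulrC.
apply: le_trans h3 _.
have h4 : c^-1 * (\sum_(m <= k < t) sq k * ((v k + Bv) - (v k.+1 + Bv))) <= c^-1 * (sq t * (2 * Bv)).
  by rewrite ler_wpM2l // invr_ge0 ltW.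
have h5 : k3 * \sum_(m <= k < t) (sq k)^-1 <= k3 * (2 * sq t) by rewrite ler_wpM2l.
have h6 : k3 * (2 * sq t) <= 2 * k3 * (sq t / c).
  rewrite mulrCA -!mulrA ler_wpM2l // ler_wpM2l //.
  by rewrite -{1}[sq t]mulr1 ler_wpM2l.
have h7 : k2 * (\sum_(m <= k < t) delta ^+ 2 + sb) <= k2 * (t%:R * delta ^+ 2 + sb).
  by rewrite ler_wpM2l // lerD2r.
have sb0 : 0 <= sb by rewrite big_nat_cond; apply: sumr_ge0 => k; rewrite andbT => /win/b0.
have td0 : 0 <= t%:R * delta ^+ 2 by rewrite mulr_ge0 // sqr_ge0.
have tc0 : 0 <= sq t / c by rewrite divr_ge0 // ltW.
have h8 : 0 <= (2 * Bv + 2 * k3) * (t%:R * delta ^+ 2 + sb).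
  by rewrite mulr_ge0 ?addr_ge0 // mulr_ge0.
have h9 : 0 <= k2 * (sq t / c) by rewrite mulr_ge0.
have E : c^-1 * (sq t * (2 * Bv)) = 2 * Bv * (sq t / c) by ring.
lra.
Qed.

(** After multiplication by [sq k], [actor_window] eliminates the actor sum. Since [c] is
    proportional to [mu], the feedback is at most [mu * (sb + W) / 2] by [step_ratio_small]: half of
    the left side, after which [mu] cancels. *)
Lemma critic_window : sb <= critic_gain * (sq t / mu + t%:R * delta ^+ 2).
Proof.
have step k : (m <= k < t)%N ->
    mu * b k <= sq k * (b k - b k.+1) + (c * (k4 * (a k + b k + delta ^+ 2)) + k5 * (sq k)^-1).
  move=> /win kp; have s0 := sq0 kp; have := critic kp.
  set p := sq k in s0 *; move=> h.
  rewrite -(ler_pM2l (_ : 0 < p^-1)) ?invr_gt0 //.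
  have -> : p^-1 * (p * (b k - b k.+1) + (c * (k4 * (a k + b k + delta ^+ 2)) + k5 / p)) =
     b k - b k.+1 + c / p * (k4 * (a k + b k + delta ^+ 2)) + k5 * p^-1 ^+ 2.
    by field; rewrite gt_eqF.
  lra.
have h1 : \sum_(m <= k < t) sq k * (b k - b k.+1) <= sq t * Bd.
  by apply: sum_sqrt_telescope => // [|k k0]; [exact: ltnW | rewrite b0 ?bB].
have h2 := sum_inv_sqrt t m0.
have h3 := ler_sum_nat step.
rewrite !big_split /= -!mulr_sumr !big_split /= in h3.
have ha := actor_window.
have sb0 : 0 <= sb by rewrite big_nat_cond; apply: sumr_ge0 => k; rewrite andbT => /win/b0.
have T0 : 0 <= sq t by exact: sqrtr_ge0.
have td0 : 0 <= t%:R * delta ^+ 2 by rewrite mulr_ge0 // sqr_ge0.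
have ag := actor_gain_ge0; have sr0 := step_ratio_gt0; have srs := step_ratio_small.
set X := sq t / mu; set W := t%:R * delta ^+ 2 in ha td0 *.
have X0 : 0 <= X by rewrite divr_ge0 // ltW.
have h5 : k5 * \sum_(m <= k < t) (sq k)^-1 <= k5 * (2 * sq t) by rewrite ler_wpM2l.
have h6 : k4 * (sa + sb + \sum_(m <= k < t) delta ^+ 2) <=
          k4 * (actor_gain * (sq t / c) + (1 + actor_gain) * (sb + W)).
  by rewrite ler_wpM2l //; have wc : \sum_(m <= k < t) delta ^+ 2 <= W := window_card; lra.
have h7 : c * (k4 * (sa + sb + \sum_(m <= k < t) delta ^+ 2)) <=
          c * (k4 * (actor_gain * (sq t / c) + (1 + actor_gain) * (sb + W))).
  by rewrite ler_wpM2l // ltW.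
have E1 : c * (k4 * (actor_gain * (sq t / c) + (1 + actor_gain) * (sb + W))) =
   k4 * actor_gain * sq t + mu * (step_ratio * k4 * (1 + actor_gain) * (sb + W)).
  by rewrite /c; field; rewrite !gt_eqF.
have h8 : mu * (step_ratio * k4 * (1 + actor_gain) * (sb + W)) <= mu * (2^-1 * (sb + W)).
  by rewrite ler_pM2l // ler_wpM2r // addr_ge0.
have ET : sq t = mu * X by rewrite /X; field; rewrite gt_eqF.
have h9 : mu * sb <= mu * ((Bd + 2 * k5 + k4 * actor_gain) * X + 2^-1 * (sb + W)).
  have E2 : mu * ((Bd + 2 * k5 + k4 * actor_gain) * X + 2^-1 * (sb + W)) =
    sq t * Bd + k5 * (2 * sq t) + k4 * actor_gain * sq t + mu * (2^-1 * (sb + W)).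
    by rewrite ET; ring.
  rewrite E2; lra.
rewrite ler_pM2l // in h9.
have Bd0 : 0 <= Bd by apply: le_trans (b0 m0) (bB m0).
have gg0 : 0 <= Bd + 2 * k5 + k4 * actor_gain.
  by apply: addr_ge0; [apply: addr_ge0 => //; exact: mulr_ge0 | exact: mulr_ge0].
have gg : 0 <= 2 * (Bd + 2 * k5 + k4 * actor_gain) * W.
  by apply: mulr_ge0 => //; exact: mulr_ge0.
rewrite /critic_gain; lra.
Qed.

Lemma small_gain_window : (t%:R / 2)^-1 * sa <= gain_const * (delta ^+ 2 + mu^-1 / sq t) /\
  (t%:R / 2)^-1 * sb <= gain_const * (delta ^+ 2 + mu^-1 / sq t).
Proof.
have ha := actor_window; have hb := critic_window.
have t0 : (0 < t)%N := ltn_trans m0 mt.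
have T0 := sq0 t0; have tE : sq t ^+ 2 = t%:R by rewrite sqr_sqrtr.
have tp : 0 < t%:R :> R by rewrite ltr0n.
have ag := actor_gain_ge0; have sr0 := step_ratio_gt0.
have Bd0 : 0 <= Bd by apply: le_trans (b0 m0) (bB m0).
have gg0 : 0 <= Bd + 2 * k5 + k4 * actor_gain.
  by apply: addr_ge0; [apply: addr_ge0 => //; exact: mulr_ge0 | exact: mulr_ge0].
have cg : 0 <= critic_gain by rewrite /critic_gain; lra.
pose Z := sq t / mu + t%:R * delta ^+ 2.
have Z0 : 0 <= Z.
  by apply: addr_ge0; [apply: divr_ge0; exact: ltW | rewrite mulr_ge0 // sqr_ge0].
have ZE : delta ^+ 2 + mu^-1 / sq t = Z / t%:R.
  rewrite /Z; move: T0 tE; set q := sq t => q0 <-.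
  by field; rewrite !gt_eqF.
have ag2 : 0 <= actor_gain * (step_ratio^-1 + 1 + critic_gain).
  by apply: mulr_ge0 => //; apply: addr_ge0 => //; apply: addr_ge0 => //; rewrite invr_ge0 ltW.
have sab : sa <= (critic_gain + actor_gain * (step_ratio^-1 + 1 + critic_gain)) * Z.
  apply: (@le_trans _ _ (actor_gain * (step_ratio^-1 + 1 + critic_gain) * Z)); last first.
    by rewrite ler_wpM2r // lerDr.
  apply: le_trans ha _; rewrite -mulrA ler_wpM2l // mulrDl lerD //.
  rewrite mulrDl mul1r; apply: (@le_trans _ _ (step_ratio^-1 * (sq t / mu) + t%:R * delta ^+ 2)).
    by rewrite lerD2r /c invfM mulrCA mulrA.
  apply: lerD.
    apply: ler_wpM2l; first by rewrite invr_ge0 ltW.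
    by rewrite /Z lerDl mulr_ge0 // sqr_ge0.
  by rewrite /Z lerDr divr_ge0 // ltW.
have sbb : sb <= (critic_gain + actor_gain * (step_ratio^-1 + 1 + critic_gain)) * Z.
  by apply: le_trans hb _; rewrite ler_wpM2r // lerDl.
rewrite ZE /gain_const; set kk := critic_gain + _ in sab sbb *.
have E : 2 * kk * (Z / t%:R) = (t%:R / 2)^-1 * (kk * Z) by field; rewrite gt_eqF.
by rewrite E; split; rewrite ler_pM2l // invr_gt0 divr_gt0.
Qed.

End window.

End small_gain.

(** * Single sample actor critic *)

Section ssac.
Context (R : realType) (S A : finType) (n d : nat).
Context (dT : measure_display) (T : measurableType dT).
Context (pb : problem R S A n d T) (gamma Cmax C lam K mu delta : R).
Context (Om : set 'rV[R]_d) (theta1 : 'rV[R]_n) (omega1 : 'rV[R]_d).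
Context (Bp Br H RO LV BV : R).

Local Notation Cm := `|Cmax|.
Local Notation sample := ((S * A) * ((S * A) * (S * A)))%type.
Local Notation gl x th := (grad (fun t => ln (policy pb t x.1 x.2)) th).
Local Notation G := (valuegrad pb gamma Cmax).
Local Notation L := `|sup_grad (omega pb)|.
Local Notation Q := (Qv pb gamma Cmax).

Hypothesis g01 : 0 < gamma < 1.
Hypothesis bc : bounded_costs pb Cmax.
Hypothesis mix : uniform_mixing pb C lam.
Hypothesis phi1 : forall s a, enorm (feature pb s a) <= 1.
Hypothesis cond : critic_conditioning pb gamma mu.
Hypothesis approx : approximation_error pb gamma delta.
Hypothesis convOm : convex_set Om.
Hypothesis compOm : compact Om.
Hypothesis inOm : forall theta, Om (omega pb theta).
Hypothesis pi_gt0 : forall theta s a, 0 < policy pb theta s a.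
Hypothesis pi_der : forall s a i (t : 'rV[R]_n),
  derivable (fun t => policy pb t s a) t (delta_mx 0 i).
Hypothesis pi_ln : forall theta s a, enorm (gl (s, a) theta) <= K.
Hypothesis sp : forall s a, smooth Bp (fun t => policy pb t s a).
Hypothesis sr : forall x, smooth Br (fun t => rho pb t x).
Hypothesis sw : forall i, smooth H (fun t => omega pb t 0 i).
Hypothesis omE : forall theta,
  bvec pb Cmax theta + omega pb theta *m (A_mx pb gamma theta)^T = 0.
Hypothesis OmB : forall z, Om z -> enorm z <= RO.
Hypothesis om1B : enorm omega1 <= RO.
Hypothesis VT : taylor (V pb gamma) G LV.
Hypothesis VB : forall theta, `|V pb gamma theta| <= BV.

Context (alpha beta : nat -> R).
Context (dU : measure_display) (U : measurableType dU) (P : probability U R).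
Context (Z : nat -> U -> (S * A) * ((S * A) * (S * A))) (cst : nat -> U -> R).
Context (th : nat -> U -> 'rV[R]_n) (om : nat -> U -> 'rV[R]_d).
Hypothesis run : is_ssac pb gamma Om theta1 omega1 alpha beta P Z cst th om.
Hypothesis alpha0 : forall t, (0 < t)%N -> 0 <= alpha t.
Hypothesis beta0 : forall t, (0 < t)%N -> 0 <= beta t.

Let g0 : 0 <= gamma. Proof. by case/andP: g01 => /ltW. Qed.
Let g1 : 0 < 1 - gamma. Proof. by rewrite subr_gt0; case/andP: g01. Qed.

Let obs : observable Z cst. Proof. by have [] := run. Qed.

Let mZ t z : measurable (Z t @^-1` [set z]). Proof. by have [+ _] := obs. Qed.

Local Notation adapted t f := (past_bm Z cst 1 t f).
Local Notation qlaw t := (fun u z => nu pb gamma (th t u) z.1 * mu_law pb (th t u) z.2).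

Lemma om_bound t u : (0 < t)%N -> enorm (om t u) <= RO.
Proof.
have [_ _ /(_ u) [_ o1] _ hp] := run.
case: t => [//|[|t]] _; first by rewrite o1.
by have [Oy _] := hp t.+1 u isT; exact: OmB.
Qed.

Lemma RO_ge0 : 0 <= RO.
Proof. exact: le_trans (enorm_ge0 _) om1B. Qed.

(** [K] bounds a norm as soon as some state and some action exist, which follows from probabilities
    summing to 1. *)
Lemma K_ge0 : 0 <= K.
Proof.
have [_ e1] := etaP pb; have [s _|s0] := pickP (fun _ : S => true); last first.
  by move: e1; rewrite big_pred0 // => /esym/eqP; rewrite oner_eq0.
have [a _|a0] := pickP (fun _ : A => true); last first.
  by have := policy_sum pb 0 s; rewrite big_pred0 // => /esym/eqP; rewrite oner_eq0.
exact: le_trans (enorm_ge0 _) (pi_ln 0 s a).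
Qed.

Lemma actor_step t u : (0 < t)%N ->
  th t.+1 u = th t u + - (beta t * dotv (feature pb (Z t u).1.1 (Z t u).1.2) (om t u))
    *: gl (Z t u).1 (th t u).
Proof. by move=> t0; have [_ _ _ hth _] := run; rewrite hth // scaleNr. Qed.

Lemma gl_continuous x i : continuous (fun t => gl x t 0 i).
Proof.
have -> : (fun t => gl x t 0 i) = fun t => (policy pb t x.1 x.2)^-1 *
    grad (fun t => policy pb t x.1 x.2) t 0 i.
  apply/funext => t; rewrite grad_ln ?mxE // => j z; exact: pi_der.
have cpi := lip_continuous (smooth_lip (sp x.1 x.2)).
have [g [_ _ gt]] := sp x.1 x.2.
have cg : continuous (fun t => grad (fun t => policy pb t x.1 x.2) t 0 i).
  apply: (@lip_continuous R n _ (6 * Bp)) => t h.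
  rewrite (taylor_grad gt) -coordB; apply: le_trans (coord_enorm _ _) _.
  exact: (taylor_grad_lip gt).
move=> t; have F := nbhs_filter (t : 'rV[R]_n).
exact: (cvgM (cvgV (lt0r_neq0 (pi_gt0 t x.1 x.2)) (cpi t)) (cg t)).
Qed.

Lemma grad_omega_continuous i j : continuous (fun t => grad (fun t => omega pb t 0 i) t 0 j).
Proof.
have [g [_ _ gt]] := sw i.
apply: (@lip_continuous R n _ (6 * H)) => t h.
rewrite (taylor_grad gt) -coordB; apply: le_trans (coord_enorm _ _) _.
exact: (taylor_grad_lip gt).
Qed.

Lemma G_continuous i : continuous (fun t => G t 0 i).
Proof.
apply: (@lip_continuous R n _ (6 * LV)) => t h.
rewrite -coordB; apply: le_trans (coord_enorm _ _) _.
exact: (taylor_grad_lip VT).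
Qed.

Lemma history_sample t z : (0 < t)%N ->
  measurable ((Z t : history Z cst 1 t.+1 -> _) @^-1` [set z]).
Proof.
by move=> t0; apply: sub_sigma_algebra; exists t; split; [rewrite t0 ltnSn | left; exists z].
Qed.

Lemma history_cost t : (0 < t)%N ->
  measurable_fun [set: history Z cst 1 t.+1] (cst t : history Z cst 1 t.+1 -> R).
Proof.
move=> t0 _ B mB; rewrite setTI; apply: sub_sigma_algebra; exists t.
by split; [rewrite t0 ltnSn | right; exists B].
Qed.

(** The algorithm gives the projection only as a relation; uniqueness ([proj_eq]) makes it a
    function, whose continuity yields measurability of the critic. *)
Definition proj (x : 'rV[R]_d) : 'rV[R]_d :=
  xget 0 [set y | is_proj Om x y].

Lemma projP x : is_proj Om x (proj x).
Proof.
have [y hy] := @proj_exists R d Om x compOm (ex_intro _ _ (inOm 0)).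
by rewrite /proj; case: xgetP => [z _ //|/(_ y)].
Qed.

Lemma proj_eq x y : is_proj Om x y -> y = proj x.
Proof.
move=> hy; have := proj_lip convOm hy (projP x); rewrite subrr enorm0 => h.
apply/eqP; rewrite -subr_eq0; apply/eqP/enorm0_eq0/le_anti.
by rewrite h enorm_ge0.
Qed.

Lemma proj_continuous i : continuous (fun x => proj x 0 i).
Proof.
apply: (@lip_continuous R d _ 1) => x h; rewrite mul1r -coordB.
apply: le_trans (coord_enorm _ _) _.
by have := proj_lip convOm (projP (x + h)) (projP x); rewrite addrAC subrr add0r.
Qed.

Lemma adapted_cont t f : continuous f -> (exists B, forall x, `|f x| <= B) ->
  (forall i, adapted t (fun u => th t u 0 i)) -> adapted t (fun u => f (th t u)).
Proof.
move=> cf [B fB] ad; split; last by exists B => u; exact: fB.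
apply: (@measurable_continuous R _ (history Z cst 1 t) n f (th t)) => // i.
by have [] := ad i.
Qed.

Lemma gl_coord_bound x i : exists B, forall t, `|gl x t 0 i| <= B.
Proof.
exists K => t; apply: le_trans (coord_enorm _ _) _; case: x => s a; exact: pi_ln.
Qed.

(** Each update is, for every fixed sample value, a continuous or measurable function of past data,
    and the samples are finitely valued. The critic uses the unclipped cost, so its boundedness
    comes from the projection instead. *)
Lemma iterates_adapted t : (0 < t)%N ->
  (forall i, adapted t (fun u => th t u 0 i)) /\ (forall i, adapted t (fun u => om t u 0 i)).
Proof.
have [_ _ init _ hom] := run.
elim: t => [//|[|t] IH] _.
  have -> : th 1 = fun=> theta1 by apply/funext => u; have [] := init u.
  have -> : om 1 = fun=> omega1 by apply/funext => u; have [] := init u.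
  by split => i; exact: bm_cst.
set k := t.+1 in IH *; have k0 : (0 < k)%N by [].
have [ath aom] := IH k0.
have ath' i : adapted k.+1 (fun u => th k u 0 i) := past_bm_le (leqnSn k) (ath i).
have aom' i : adapted k.+1 (fun u => om k u 0 i) := past_bm_le (leqnSn k) (aom i).
have agl x i : adapted k.+1 (fun u => gl x (th k u) 0 i).
  apply: past_bm_le (leqnSn k) _.
  exact: adapted_cont (@gl_continuous x i) (gl_coord_bound x i) ath.
have adot (v : 'rV[R]_d) : adapted k.+1 (fun u => dotv v (om k u)).
  exact: bm_dot_cst aom'.
split => i.
  have -> : (fun u => th k.+1 u 0 i) = fun u => th k u 0 i +
     - (beta k * dotv (feature pb (Z k u).1.1 (Z k u).1.2) (om k u)) * gl (Z k u).1 (th k u) 0 i.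
    by apply/funext => u; rewrite actor_step // !mxE.
  apply: bm_add; first exact: ath'.
  pose F (z : sample) (u : U) := - (beta k * dotv (feature pb z.1.1 z.1.2) (om k u)) * gl z.1 (th k u) 0 i.
  apply: (@bm_select R _ (history Z cst 1 k.+1) _ (Z k) F) => z; first exact: history_sample.
  apply: bm_mul; last exact: agl.
  by apply: bm_opp; apply: bm_mul; [exact: bm_cst | exact: adot].
split; last first.
  by exists RO => u; apply: le_trans (coord_enorm _ _) _; exact: om_bound.
have -> : (fun u => om k.+1 u 0 i) =
    fun u => proj (td_step pb gamma (alpha k) (Z k u).2 (cst k u) (om k u)) 0 i.
  by apply/funext => u; rewrite (proj_eq (hom k u k0)).
apply: (@measurable_continuous R _ (history Z cst 1 k.+1) d _ _ (@proj_continuous i)) => j.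
have -> : (fun u => td_step pb gamma (alpha k) (Z k u).2 (cst k u) (om k u) 0 j) = fun u =>
    om k u 0 j + (alpha k * (cst k u + dotv (tdrow pb gamma (Z k u).2) (om k u))) * ft pb (Z k u).2 0 j.
  by apply/funext => u; rewrite td_stepE !mxE.
apply: measurable_funD; first by have [] := aom' j.
pose F (z : sample) (u : U) := (alpha k * (cst k u + dotv (tdrow pb gamma z.2) (om k u))) * ft pb z.2 0 j.
apply: (@measurable_select R _ (history Z cst 1 k.+1) _ (Z k) F) => z; first exact: history_sample.
apply: measurable_funM; last exact: measurable_cst.
apply: measurable_funM; first exact: measurable_cst.
apply: measurable_funD; first exact: history_cost.
by have [] := adot (tdrow pb gamma z.2).
Qed.

Lemma policy_adapted t s a : (0 < t)%N -> adapted t (fun u => policy pb (th t u) s a).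
Proof.
move=> t0; have [ath _] := iterates_adapted t0.
apply: (@adapted_cont t (fun x => policy pb x s a)) => //.
  exact: (lip_continuous (smooth_lip (sp s a))).
by have [g [h _ _]] := sp s a; exists Bp.
Qed.

Lemma nu_le1 theta x : `|nu pb gamma theta x| <= 1.
Proof. by apply: dist_le1; split => [y|]; [exact: nu_ge0 | exact: nu_sum]. Qed.

Lemma mu_law_le1 theta y : `|mu_law pb theta y| <= 1.
Proof. by apply: dist_le1; split => [z|]; [exact: (mu_law_ge0 mix) | exact: (mu_law_sum mix)]. Qed.

(** Measurability only: [nu] is a limit of polynomials in the policy probabilities, so no regularity
    of the occupancy in [theta] has to be proved. *)
Lemma nu_adapted t x : (0 < t)%N -> adapted t (fun u => nu pb gamma (th t u) x).
Proof.
move=> t0; split; last by exists 1 => u; exact: nu_le1.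
have api s a := policy_adapted s a t0.
have aiter k z : adapted t (fun u => iter k (pushf pb (th t u)) (start pb (th t u) (Defs.eta pb)) z).
  elim: k z => [|k IH] z; first by apply: bm_mul; [exact: bm_cst | exact: api].
  apply: bm_sum => y; apply: bm_mul; first exact: IH.
  by apply: bm_mul; [exact: bm_cst | exact: api].
have -> : (fun u => nu pb gamma (th t u) x) = fun u =>
    (1 - gamma) * occ pb gamma (th t u) x.1 * policy pb (th t u) x.1 x.2.
  by apply/funext => u; rewrite nuE.
apply: measurable_funM; last by have [] := api x.1 x.2.
apply: measurable_funM; first exact: measurable_cst.
apply: (@measurable_limn R _ (history Z cst 1 t)
  (fun N u => gpartial gamma (fun k => sprob pb (th t u) k x.1) N)) => N.
suff [] : adapted t (fun u => gpartial gamma (fun k => sprob pb (th t u) k x.1) N) by [].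
apply: bm_sum => k; apply: bm_mul; first exact: bm_cst.
by apply: bm_sum => a; exact: aiter.
Qed.

Lemma mu_law_adapted t y : (0 < t)%N -> adapted t (fun u => mu_law pb (th t u) y).
Proof.
move=> t0; have [ath _] := iterates_adapted t0.
apply: (@adapted_cont t (fun x => mu_law pb x y)) => //.
  exact: (lip_continuous (smooth_lip (mu_law_smooth sp sr y))).
by exists 1 => x; exact: mu_law_le1.
Qed.

Lemma qlaw_adapted t z : (0 < t)%N -> adapted t ((qlaw t) ^~ z).
Proof. by move=> t0; apply: bm_mul; [exact: nu_adapted | exact: mu_law_adapted]. Qed.

Lemma sum_qlaw1 t u (f : S * A -> R) :
  \sum_z qlaw t u z * f z.1 = \sum_x nu pb gamma (th t u) x * f x.
Proof.
rewrite sum_pair; apply: eq_bigr => x _ /=.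
rewrite -mulr_suml -mulr_sumr; congr (_ * _).
by rewrite (mu_law_sum mix) mulr1.
Qed.

Lemma sum_qlaw2 t u (f : (S * A) * (S * A) -> R) :
  \sum_z qlaw t u z * f z.2 = \sum_y mu_law pb (th t u) y * f y.
Proof.
rewrite sum_pair exchange_big; apply: eq_bigr => y _ /=.
rewrite -mulr_suml; congr (_ * _).
by rewrite -mulr_suml (nu_sum pb g01) mul1r.
Qed.

(** The mean actor direction. With the exact [Q] in place of the linear critic it would be
    [(1 - gamma) *: G] by [policy_gradient]. *)
Definition avec theta (w : 'rV[R]_d) : 'rV[R]_n :=
  \sum_x (nu pb gamma theta x * dotv (feature pb x.1 x.2) w) *: gl x theta.

Lemma G_bound theta : enorm (G theta) <= (1 - gamma)^-1 * (Cm / (1 - gamma) * K).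
Proof.
rewrite ler_pdivlMl //.
have -> : (1 - gamma) * enorm (G theta) = enorm ((1 - gamma) *: G theta).
  by rewrite enormZ ger0_norm // ltW.
rewrite -(policy_gradient Cmax g01) //.
apply: le_trans (enorm_sum _ _ _) _.
apply: (@le_trans _ _ (\sum_x nu pb gamma theta x * (Cm / (1 - gamma) * K))).
  apply: ler_sum => x _; rewrite enormZ normrM (ger0_norm (nu_ge0 pb g01 theta x)) -[leLHS]mulrA.
  apply: ler_wpM2l; first exact: nu_ge0.
  apply: ler_pM => //; [exact: enorm_ge0 | exact: Qv_bound|].
  by case: x => s a; exact: pi_ln.
by rewrite -mulr_suml (nu_sum pb g01) mul1r.
Qed.

(** The critic's error against [Q] splits into the approximation error of [omega], at most [delta]
    on average under [nu], and the distance of [w] to [omega]. *)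
Lemma avec_diff theta w :
  enorm (avec theta w - (1 - gamma) *: G theta) <= K * (delta + enorm (w - omega pb theta)).
Proof.
have K0 := K_ge0.
rewrite -(policy_gradient Cmax g01) // /avec -sumrB.
apply: le_trans (enorm_sum _ _ _) _.
have [_ ap] := approx.
set D := w - omega pb theta.
apply: (@le_trans _ _ (\sum_x (K * (nu pb gamma theta x * `|Q theta x - dotv (feature pb x.1 x.2) (omega pb theta)|)
    + nu pb gamma theta x * (K * enorm D)))).
  apply: ler_sum => x _; have n0 := nu_ge0 pb g01 theta x.
  rewrite -scalerBl enormZ -mulrBr normrM (ger0_norm n0).
  have k1 : enorm (gl x theta) <= K by case: x {n0} => s a; exact: pi_ln.
  set q := `|Q theta x - _|.
  have -> : K * (nu pb gamma theta x * q) + nu pb gamma theta x * (K * enorm D) =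
    nu pb gamma theta x * (K * (q + enorm D)) by ring.
  rewrite -[leLHS]mulrA; apply: ler_wpM2l => //.
  rewrite [leLHS]mulrC; apply: ler_pM => //; first exact: enorm_ge0.
  have -> : dotv (feature pb x.1 x.2) w - Q theta x =
    - (Q theta x - dotv (feature pb x.1 x.2) (omega pb theta)) + dotv (feature pb x.1 x.2) D.
    by rewrite /D dotvBr; ring.
  apply: le_trans (ler_normD _ _) _; rewrite normrN lerD2l.
  apply: le_trans (dotv_le _ _) _; rewrite ler_piMl ?enorm_ge0 //.
rewrite big_split /= -mulr_sumr -mulr_suml (nu_sum pb g01) mul1r mulrDr lerD2r.
apply: ler_wpM2l => //; apply: le_trans (ap theta).
by apply: ler_sum => x _; rewrite (@QstarE _ _ _ _ _ _ _ pb _ Cmax) // -surjective_pairing.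
Qed.

Definition actor_move (b : R) theta (w : 'rV[R]_d) (x : S * A) : 'rV[R]_n :=
  - (b * dotv (feature pb x.1 x.2) w) *: gl x theta.

Lemma sum_actor_move b theta w :
  \sum_x nu pb gamma theta x *: actor_move b theta w x = - b *: avec theta w.
Proof.
rewrite /avec scaler_sumr; apply: eq_bigr => x _.
by rewrite /actor_move !scalerA; congr (_ *: _); ring.
Qed.

Lemma actor_move_norm b theta w x : 0 <= b -> enorm w <= RO ->
  enorm (actor_move b theta w x) <= b * (RO * K).
Proof.
move=> b0 wRO; rewrite enormZ normrN normrM (ger0_norm b0) -mulrA; apply: ler_wpM2l => //.
apply: ler_pM => //; first exact: enorm_ge0.
  apply: le_trans (dotv_le _ _) _; apply: (@le_trans _ _ (1 * RO)); last by rewrite mul1r.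
  by apply: ler_pM; rewrite ?enorm_ge0.
by case: x => s a; exact: pi_ln.
Qed.

Lemma omega_adapted t i : (0 < t)%N -> adapted t (fun u => omega pb (th t u) 0 i).
Proof.
move=> t0; have [ath _] := iterates_adapted t0.
apply: (@adapted_cont t (fun x => omega pb x 0 i)) => //.
  exact: (lip_continuous (smooth_lip (sw i))).
by have [g [hh _ _]] := sw i; exists H.
Qed.

Lemma error_adapted t i : (0 < t)%N ->
  adapted t (fun u => (om t u - omega pb (th t u)) 0 i).
Proof.
move=> t0; under eq_fun do rewrite coordB.
have [_ aom] := iterates_adapted t0.
by apply: bm_sub; [exact: aom | exact: omega_adapted].
Qed.

Lemma G_adapted t i : (0 < t)%N -> adapted t (fun u => G (th t u) 0 i).
Proof.
move=> t0; have [ath _] := iterates_adapted t0.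
apply: (@adapted_cont t (fun x => G x 0 i)) => //; first exact: G_continuous.
exists ((1 - gamma)^-1 * (Cm / (1 - gamma) * K)) => x.
by apply: le_trans (coord_enorm _ _) _; exact: G_bound.
Qed.

Lemma gl_adapted t x i : (0 < t)%N -> adapted t (fun u => gl x (th t u) 0 i).
Proof.
move=> t0; have [ath _] := iterates_adapted t0.
exact: adapted_cont (@gl_continuous x i) (gl_coord_bound x i) ath.
Qed.

Lemma adaptedW t f : adapted t f -> bm f.
Proof. exact: (@past_bm_bm _ _ _ _ _ _ obs 1 t f). Qed.

Lemma bm_V t : (0 < t)%N -> bm (fun u => V pb gamma (th t u)).
Proof.
move=> t0; have [ath _] := iterates_adapted t0.
apply: (@adaptedW t); apply: adapted_cont => //; last by exists BV.
pose B := BV + (1 - gamma)^-1 * (Cm / (1 - gamma) * K) + `|LV|.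
have B0 : 0 <= BV by apply: le_trans (VB 0).
have B1 : 0 <= (1 - gamma)^-1 * (Cm / (1 - gamma) * K) by apply: le_trans (G_bound 0); exact: enorm_ge0.
have B2 := normr_ge0 LV; have B3 := ler_norm LV.
have sV : smooth B (V pb gamma).
  exists G; split => [x|x|x v].
  - by apply: le_trans (VB x) _; rewrite /B; lra.
  - by apply: le_trans (G_bound x) _; rewrite /B; lra.
  - by apply: le_trans (VT x v) _; rewrite ler_wpM2r ?sqr_ge0 // /B; lra.
exact: (lip_continuous (smooth_lip sV)).
Qed.

Lemma bm_grad t : (0 < t)%N -> bm (fun u => enorm (G (th t u)) ^+ 2).
Proof. by move=> t0; apply: bm_norm2 => i; apply: (@adaptedW t); exact: G_adapted. Qed.

Lemma bm_error t : (0 < t)%N ->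
  bm (fun u => enorm (om t u - omega pb (th t u)) ^+ 2).
Proof. by move=> t0; apply: bm_norm2 => i; apply: (@adaptedW t); exact: error_adapted. Qed.

Lemma actor_move_adapted t x i : (0 < t)%N ->
  adapted t (fun u => actor_move (beta t) (th t u) (om t u) x 0 i).
Proof.
move=> t0; have [_ aom] := iterates_adapted t0.
under eq_fun do rewrite mxE.
apply: bm_mul; last exact: gl_adapted.
apply: bm_opp; apply: bm_mul; first exact: bm_cst.
exact: bm_dot_cst.
Qed.

Lemma bm_at_sample t (F : sample -> U -> R) :
  (forall z, bm (F z)) -> bm (fun u => F (Z t u) u).
Proof. by move=> bF; apply: bm_select => // z; exact: mZ. Qed.

Lemma fresh_t t : (0 < t)%N ->
  fresh_sample P Z cst 1 t (qlaw t) (fun z => mu_cost pb z.2).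
Proof. by have [_ h _ _ _] := run; exact: h. Qed.

Lemma error_bound t u : (0 < t)%N -> enorm (om t u - omega pb (th t u)) <= 2 * RO.
Proof.
move=> t0; have h1 := om_bound u t0; have h2 := OmB (inOm (th t u)).
have h3 := enormD (om t u) (- omega pb (th t u)); rewrite enormN in h3; lra.
Qed.

Definition grad_mean t := mean P (fun u => enorm (G (th t u)) ^+ 2).
Definition error_mean t := mean P (fun u => enorm (om t u - omega pb (th t u)) ^+ 2).
Definition value_mean t := mean P (fun u => V pb gamma (th t u)).

Lemma actor_progress theta w :
  - dotv (G theta) (avec theta w) <= - ((1 - gamma) / 2) * enorm (G theta) ^+ 2 +
    K ^+ 2 / (1 - gamma) * (delta ^+ 2 + enorm (w - omega pb theta) ^+ 2).
Proof.
have fin (k g q x D : R) : 0 < k -> q <= g * (K * (delta + D)) ->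
    x = - (k * g ^+ 2) + q ->
    x <= - (k / 2) * g ^+ 2 + K ^+ 2 / k * (delta ^+ 2 + D ^+ 2).
  move=> k0 hq ->; rewrite -subr_ge0.
  suff : 0 <= k / 2 * g ^+ 2 + K ^+ 2 / k * (delta ^+ 2 + D ^+ 2) - g * (K * (delta + D)) by lra.
  (* Young's inequality as an explicit sum of squares. *)
  have -> : k / 2 * g ^+ 2 + K ^+ 2 / k * (delta ^+ 2 + D ^+ 2) - g * (K * (delta + D)) =
    ((k * g - K * (delta + D)) ^+ 2 + K ^+ 2 * (delta - D) ^+ 2) / (2 * k).
    by field; rewrite lt0r_neq0.
  apply: divr_ge0; last by rewrite pmulr_rge0 // ?ltW.
  by apply: addr_ge0; [exact: sqr_ge0 | apply: mulr_ge0; exact: sqr_ge0].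
set g := enorm (G theta); set D := enorm _.
apply: (fin _ _ (- dotv (G theta) (avec theta w - (1 - gamma) *: G theta))) => //.
  apply: le_trans (ler_norm _) _; rewrite normrN; apply: le_trans (dotv_le _ _) _.
  by rewrite ler_wpM2l ?enorm_ge0 // avec_diff.
by rewrite dotvBr dotvZr /g sqr_enorm; ring.
Qed.

(** [VT] is applied to the realized step; only its linear term needs averaging, and the fresh sample
    turns that into [avec]. *)
Lemma actor_recursion t : (0 < t)%N ->
  value_mean t.+1 <= value_mean t - beta t * ((1 - gamma) / 2) * grad_mean t
    + beta t * (K ^+ 2 / (1 - gamma)) * (delta ^+ 2 + error_mean t)
    + beta t ^+ 2 * (`|LV| * (RO * K) ^+ 2).
Proof.
move=> t0; have b0 := beta0 t0.
pose F (z : sample) u := dotv (G (th t u)) (actor_move (beta t) (th t u) (om t u) z.1).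
have aF z : adapted t (F z).
  by apply: bm_dot => i; [exact: G_adapted | exact: actor_move_adapted].
have bF : bm (fun u => F (Z t u) u).
  by apply: bm_at_sample => z; exact: (@adaptedW t).
have bV := bm_V t0; have bg := bm_grad t0; have be := bm_error t0.
have c (k : R) : bm (fun _ : U => k) := bm_cst _ k.
apply: (@le_trans _ _ (mean P (fun u => V pb gamma (th t u) + F (Z t u) u + beta t ^+ 2 * (`|LV| * (RO * K) ^+ 2)))).
  apply: mean_le.
  - exact: (@bm_V t.+1).
  - exact: (bm_add (bm_add bV bF) (c _)).
  move=> u.
  have := VT (th t u) (actor_move (beta t) (th t u) (om t u) (Z t u).1).
  rewrite -/(F (Z t u) u) -actor_step // => /(le_trans (ler_norm _)) h1.
  have h2 : LV * enorm (actor_move (beta t) (th t u) (om t u) (Z t u).1) ^+ 2 <=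
      beta t ^+ 2 * (`|LV| * (RO * K) ^+ 2).
    have e1 := actor_move_norm (th t u) (Z t u).1 b0 (om_bound u t0).
    rewrite [leRHS]mulrCA -exprMn; apply: (@le_trans _ _ (`|LV| * enorm (actor_move (beta t) (th t u) (om t u) (Z t u).1) ^+ 2)).
      by rewrite ler_wpM2r ?sqr_ge0 ?ler_norm.
    rewrite ler_wpM2l // ler_pXn2r ?nnegrE ?enorm_ge0 //.
    exact: le_trans (enorm_ge0 _) e1.
  lra.
have -> : mean P (fun u => V pb gamma (th t u) + F (Z t u) u + beta t ^+ 2 * (`|LV| * (RO * K) ^+ 2)) =
    value_mean t + mean P (fun u => F (Z t u) u) + beta t ^+ 2 * (`|LV| * (RO * K) ^+ 2).
  by rewrite (mean_add _ (bm_add bV bF) (c _)) (mean_add _ bV bF) mean_cst.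
rewrite (mean_fresh obs (fresh_t t0) (fun z => qlaw_adapted z t0) aF).
suff : mean P (fun u => \sum_z qlaw t u z * F z u) <=
    mean P (fun u => beta t * (- ((1 - gamma) / 2) * enorm (G (th t u)) ^+ 2 +
      K ^+ 2 / (1 - gamma) * (delta ^+ 2 + enorm (om t u - omega pb (th t u)) ^+ 2))).
  have bde : bm (fun u => delta ^+ 2 + enorm (om t u - omega pb (th t u)) ^+ 2) by exact: bm_add.
  rewrite mean_scale; last by apply: bm_add; exact: bm_mul.
  rewrite mean_lin // mean_add // mean_cst -/(grad_mean t) -/(error_mean t).
  set lhs := mean P _; lra.
apply: mean_le.
- by apply: bm_sum => z; apply: (@adaptedW t); apply: bm_mul; [exact: qlaw_adapted | exact: aF].
- apply: bm_mul => //; apply: bm_add; apply: bm_mul => //; exact: bm_add.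
move=> u; rewrite (sum_qlaw1 t u (fun x => dotv (G (th t u)) (actor_move (beta t) (th t u) (om t u) x))).
apply: le_trans (ler_wpM2l b0 (actor_progress (th t u) (om t u))).
rewrite mulrN -dotvZr -dotvNr -scaleNr -sum_actor_move dotv_sumr.
by apply: ler_sum => x _; rewrite dotvZr.
Qed.

Definition jac_gain := d%:R * `|sup_grad (omega pb)|.

Lemma jac_coord_adapted t (X : U -> 'rV[R]_n) i : (0 < t)%N ->
  (forall j, adapted t (fun u => X u 0 j)) ->
  adapted t (fun u => jac (omega pb) (th t u) (X u) 0 i).
Proof.
move=> t0 aX; have [ath _] := iterates_adapted t0.
under eq_fun do rewrite mxE; apply: bm_dot => // j.
apply: (@adapted_cont t (fun x => grad (fun y => omega pb y 0 i) x 0 j)) => //.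
  exact: grad_omega_continuous.
have [g [_ gH gt]] := sw i; exists H => x.
by rewrite (taylor_grad gt); apply: le_trans (coord_enorm _ _) _.
Qed.

Lemma avec_bound theta w :
  enorm (avec theta w) <= enorm (G theta) + K * (delta + enorm (w - omega pb theta)).
Proof.
have -> : avec theta w = (avec theta w - (1 - gamma) *: G theta) + (1 - gamma) *: G theta.
  by rewrite subrK.
apply: le_trans (enormD _ _) _; rewrite addrC; apply: lerD; last exact: avec_diff.
have h := ltW g1; have h' := g0.
rewrite enormZ ger0_norm // ler_piMl ?enorm_ge0 //; lra.
Qed.

(* The conditional mean of the actor step is - beta * avec, so this bounds the
   mean effect on the error of the motion of the critic's target. *)
Lemma drift_bound theta w :
  dotv (w - omega pb theta) (jac (omega pb) theta (avec theta w)) <=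
  jac_gain * (1 + 3 * K) / 2 *
    (enorm (G theta) ^+ 2 + enorm (w - omega pb theta) ^+ 2 + delta ^+ 2).
Proof.
have K0 := K_ge0; have G0 := enorm_ge0 (G theta).
set D := w - omega pb theta; have D0 := enorm_ge0 D.
have [d0 _] := approx; have j0 : 0 <= jac_gain by rewrite mulr_ge0 ?ler0n.
apply: le_trans (ler_norm _) _; apply: le_trans (dotv_le _ _) _.
apply: (@le_trans _ _ (enorm D * (jac_gain * (enorm (G theta) + K * (delta + enorm D))))).
  rewrite ler_wpM2l //; apply: le_trans (jac_sup_grad sw _ _) _.
  by rewrite mulrA ler_wpM2l // avec_bound.
move: (enorm (G theta)) (enorm D) jac_gain G0 D0 j0 => g e q g0' e0 j0.
have -> : e * (q * (g + K * (delta + e))) = q * (e * (g + K * (delta + e))) by ring.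
rewrite -!mulrA; apply: ler_wpM2l => //.
have h : (1 + 3 * K) * (2^-1 * (g ^+ 2 + e ^+ 2 + delta ^+ 2)) - e * (g + K * (delta + e)) =
    2^-1 * ((g - e) ^+ 2 + delta ^+ 2 + K * (3 * g ^+ 2 + 2 * delta ^+ 2 + (delta - e) ^+ 2)).
  by field.
rewrite -subr_ge0 h.
apply: mulr_ge0; first by rewrite invr_ge0.
have q1 := sqr_ge0 (g - e); have q2 := sqr_ge0 delta; have q3 := sqr_ge0 (delta - e).
have q4 := sqr_ge0 g; have q5 : 0 <= K * (3 * g ^+ 2 + 2 * delta ^+ 2 + (delta - e) ^+ 2).
  by apply: mulr_ge0 => //; lra.
lra.
Qed.

(** The error times the second-order part of the target's motion, then the squares of the TD step,
    of the linearized motion and of its remainder. *)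
Definition critic_noise (a b : R) :=
  4 * RO * (d%:R * (H * (b * (RO * K)) ^+ 2)) + 2 * (a * (Cm + 2 * RO)) ^+ 2 +
  4 * (jac_gain * (b * (RO * K))) ^+ 2 + 4 * (d%:R * (H * (b * (RO * K)) ^+ 2)) ^+ 2.

Lemma H_ge0 : (0 < d)%N -> 0 <= H.
Proof. by move=> d0; exact: smooth_ge0 (sw (Ordinal d0)). Qed.

Section critic_step.
Variable t : nat.
Hypothesis t0 : (0 < t)%N.

Let D u := om t u - omega pb (th t u).
Let e u := clip Cm (cst t u) + dotv (tdrow pb gamma (Z t u).2) (om t u).
Let h u := actor_move (beta t) (th t u) (om t u) (Z t u).1.
Let J u := jac (omega pb) (th t u) (h u).

Let a0 : 0 <= alpha t := alpha0 t0.
Let b0 : 0 <= beta t := beta0 t0.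

Let D_bound u : enorm (D u) <= 2 * RO := error_bound u t0.

(** The new error is [D + (g - J - r)]: TD step, linearized target motion, remainder. The cross
    terms with [g] and [J] stay exact because their conditional means are the contraction and the
    drift; a norm bound on them would be of first order in the steps. *)
Lemma critic_expand u :
  enorm (D u + (alpha t * e u) *: ft pb (Z t u).2 - (omega pb (th t.+1 u) - omega pb (th t u))) ^+ 2
  <= enorm (D u) ^+ 2 + 2 * alpha t * (e u * dotv (ft pb (Z t u).2) (D u))
     - 2 * dotv (D u) (J u) + critic_noise (alpha t) (beta t).
Proof.
set g := (alpha t * e u) *: _.
set r := omega pb (th t.+1 u) - omega pb (th t u) - J u.
have -> : D u + g - (omega pb (th t.+1 u) - omega pb (th t u)) = D u + (g - J u - r).
  by rewrite /r; apply/rowP => i; rewrite !mxE; ring.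
have hb : enorm (h u) <= beta t * (RO * K) by apply: actor_move_norm; rewrite ?om_bound.
set hm := beta t * (RO * K) in hb *.
have hm0 : 0 <= hm by apply: le_trans hb; exact: enorm_ge0.
have rb : enorm r <= d%:R * (H * hm ^+ 2).
  have := jac_taylor sw (th t u) (h u); rewrite /r actor_step // => /le_trans; apply.
  have [dn|dn] := posnP d.
    have -> : d%:R = 0 :> R by rewrite dn.
    by rewrite !mul0r.
  rewrite ler_wpM2l ?ler0n // ler_wpM2l ?H_ge0 // ler_pXn2r ?nnegrE ?enorm_ge0 //.
have Jb : enorm (J u) <= jac_gain * hm.
  apply: le_trans (jac_sup_grad sw _ _) _; rewrite [leLHS]mulrA; exact: ler_wpM2l.
have eb : `|e u| <= Cm + 2 * RO.
  apply: le_trans (ler_normD _ _) _; apply: lerD; first exact: clip_le.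
  apply: le_trans (dotv_le _ _) _; apply: ler_pM; rewrite ?enorm_ge0 ?om_bound //.
  exact: tdrow_norm.
have gb : enorm g <= alpha t * (Cm + 2 * RO).
  rewrite enormZ normrM (ger0_norm a0) -mulrA ler_wpM2l //.
  rewrite -[leRHS]mulr1; apply: ler_pM => //; first exact: enorm_ge0.
  exact: phi1.
have Dr : - (2 * dotv (D u) r) <= 4 * RO * (d%:R * (H * hm ^+ 2)).
  have : `|dotv (D u) r| <= (2 * RO) * (d%:R * (H * hm ^+ 2)).
    by apply: le_trans (dotv_le _ _) _; apply: ler_pM; rewrite ?enorm_ge0.
  have := ler_norm (- dotv (D u) r); rewrite normrN; lra.
have X2 : enorm (g - J u - r) ^+ 2 <= 2 * (alpha t * (Cm + 2 * RO)) ^+ 2 +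
    4 * (jac_gain * hm) ^+ 2 + 4 * (d%:R * (H * hm ^+ 2)) ^+ 2.
  have h1 := sqr_enormB_le g (J u + r); rewrite opprD addrA in h1.
  have h2 := sqr_enormD_le (J u) r.
  have sq (x : 'rV[R]_d) y : enorm x <= y -> enorm x ^+ 2 <= y ^+ 2.
    by move=> xy; rewrite ler_pXn2r ?nnegrE ?enorm_ge0 // (le_trans (enorm_ge0 _) xy).
  have h3 := sq _ _ gb; have h4 := sq _ _ Jb; have h5 := sq _ _ rb; lra.
rewrite sqr_enormD 2!dotvBr dotvZr (dotvC (D u) (ft _ _)) /critic_noise -/hm.
move: (dotv (ft pb (Z t u).2) (D u)) => fd; lra.
Qed.

Let aD i : adapted t (fun u => D u 0 i) := @error_adapted t i t0.
Let aom i : adapted t (fun u => om t u 0 i).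
Proof. by have [_] := iterates_adapted t0; exact. Qed.

Let bm_clip : bm (fun u => clip Cm (cst t u)).
Proof.
by have [_ mC] := obs; exact: (bm_comp (mC t) (clip_bm (normr_ge0 Cmax))).
Qed.

Let bm_ft i : bm (fun u => ft pb (Z t u).2 0 i).
Proof. by apply: (@bm_at_sample t (fun z _ => ft pb z.2 0 i)) => z; exact: bm_cst. Qed.

Let bm_e : bm e.
Proof.
apply: bm_add => //.
apply: (@bm_at_sample t (fun z u => dotv (tdrow pb gamma z.2) (om t u))) => z.
by apply: (@adaptedW t); exact: bm_dot_cst.
Qed.

Let bm_fD : bm (fun u => dotv (ft pb (Z t u).2) (D u)).
Proof.
apply: (@bm_at_sample t (fun z u => dotv (ft pb z.2) (D u))) => z.
by apply: (@adaptedW t); exact: bm_dot_cst.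
Qed.

Lemma mean_td_drift : mean P (fun u => e u * dotv (ft pb (Z t u).2) (D u)) <=
  - (mu / 2) * error_mean t.
Proof.
have -> : (fun u => e u * dotv (ft pb (Z t u).2) (D u)) = fun u =>
   dotv (ft pb (Z t u).2) (D u) * clip Cm (cst t u) +
   dotv (tdrow pb gamma (Z t u).2) (om t u) * dotv (ft pb (Z t u).2) (D u).
  by apply/funext => u; rewrite /e; ring.
pose F (z : sample) u := dotv (ft pb z.2) (D u).
pose F' (z : sample) u :=
  dotv (tdrow pb gamma z.2) (om t u) * dotv (ft pb z.2) (D u).
have aF z : adapted t (F z) := bm_dot_cst (ft pb z.2) aD.
have aF' z : adapted t (F' z) := bm_mul (bm_dot_cst (tdrow pb gamma z.2) aom) (aF z).
have bF' : bm (fun u => F' (Z t u) u).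
  by apply: bm_at_sample => z; exact: (@adaptedW t).
have aq z := qlaw_adapted z t0.
rewrite mean_add //; last exact: bm_mul.
rewrite (mean_fresh_cost obs (fresh_t t0) aq aF (clip_bm (normr_ge0 Cmax))).
rewrite (mean_fresh obs (fresh_t t0) aq aF').
have bq z := adaptedW (aq z); have bF z := adaptedW (aF z); have bF2 z := adaptedW (aF' z).
have c (k : R) : bm (fun _ : U => k) := bm_cst _ k.
have s1 : bm (fun u => \sum_z qlaw t u z *
    (mean (mu_cost pb z.2) (clip Cm : measurableTypeR R -> R) * F z u)).
  by apply: bm_sum => z; apply: bm_mul => //; apply: bm_mul.
have s2 : bm (fun u => \sum_z qlaw t u z * F' z u).
  by apply: bm_sum => z; apply: bm_mul.
rewrite -mean_add // -mean_scale; last exact: bm_error.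
apply: mean_le; [exact: bm_add | by apply: bm_mul => //; exact: bm_error |] => u.
rewrite -big_split /=; apply: le_trans (A_negative cond (th t u) (D u)).
have -> : D u *m (A_mx pb gamma (th t u))^T =
    bvec pb Cmax (th t u) + om t u *m (A_mx pb gamma (th t u))^T.
  rewrite mulmxBl addrC; congr (_ + _); apply/esym/eqP.
  by rewrite -addr_eq0 omE.
rewrite -mean_field -(sum_qlaw2 t u (fun y => (ycost pb Cmax y + dotv (tdrow pb gamma y) (om t u)) * dotv (ft pb y) (D u))).
apply: le_of_eq; apply: eq_bigr => z _.
by rewrite -mulrDr -mulrDl.
Qed.

(** The Jacobian is linear in the actor step, so averaging over the fresh sample puts [avec] inside
    it, as in [drift_bound]. *)
Lemma mean_target_drift : - mean P (fun u => dotv (D u) (J u)) <=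
  beta t * (jac_gain * (1 + 3 * K) / 2 * (grad_mean t + error_mean t + delta ^+ 2)).
Proof.
pose F (z : sample) u :=
  dotv (D u) (jac (omega pb) (th t u) (actor_move (beta t) (th t u) (om t u) z.1)).
have aF z : adapted t (F z).
  apply: bm_dot => // i; apply: jac_coord_adapted => // j; exact: actor_move_adapted.
have aq z := qlaw_adapted z t0.
have c (k : R) : bm (fun _ : U => k) := bm_cst _ k.
have bg := bm_grad t0; have be := bm_error t0.
rewrite (mean_fresh obs (fresh_t t0) aq aF) -mulN1r -mean_scale; last first.
  by apply: bm_sum => z; apply: bm_mul; exact: (@adaptedW t).
have bge : bm (fun u => enorm (G (th t u)) ^+ 2 + enorm (D u) ^+ 2) by exact: bm_add.
have bged : bm (fun u => enorm (G (th t u)) ^+ 2 + enorm (D u) ^+ 2 + delta ^+ 2) by exact: bm_add.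
have -> : beta t * (jac_gain * (1 + 3 * K) / 2 * (grad_mean t + error_mean t + delta ^+ 2)) =
    mean P (fun u => beta t * (jac_gain * (1 + 3 * K) / 2) *
      (enorm (G (th t u)) ^+ 2 + enorm (D u) ^+ 2 + delta ^+ 2)).
  by rewrite mean_scale // (mean_add _ bge (c _)) mean_add // mean_cst mulrA.
apply: mean_le => [||u].
- by apply: bm_mul => //; apply: bm_sum => z; apply: bm_mul; exact: (@adaptedW t).
- exact: bm_mul.
rewrite (sum_qlaw1 t u (fun x => dotv (D u) (jac (omega pb) (th t u) (actor_move (beta t) (th t u) (om t u) x)))).
have -> : -1 * \sum_x nu pb gamma (th t u) x * dotv (D u) (jac (omega pb) (th t u) (actor_move (beta t) (th t u) (om t u) x)) =
    beta t * dotv (D u) (jac (omega pb) (th t u) (avec (th t u) (om t u))).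
  have -> : beta t * dotv (D u) (jac (omega pb) (th t u) (avec (th t u) (om t u))) =
      - dotv (D u) (jac (omega pb) (th t u) (- beta t *: avec (th t u) (om t u))).
    by rewrite jacZ dotvZr; ring.
  rewrite -sum_actor_move jac_sum dotv_sumr mulN1r; congr (- _).
  by apply: eq_bigr => x _; rewrite dotvZr.
by rewrite -[leRHS]mulrA ler_wpM2l // drift_bound.
Qed.

Lemma critic_recursion : error_mean t.+1 <= (1 - mu * alpha t) * error_mean t +
  beta t * (jac_gain * (1 + 3 * K)) * (grad_mean t + error_mean t + delta ^+ 2) +
  critic_noise (alpha t) (beta t).
Proof.
have c (k : R) : bm (fun _ : U => k) := bm_cst _ k.
pose X u := D u + (alpha t * e u) *: ft pb (Z t u).2 - (omega pb (th t.+1 u) - omega pb (th t u)).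
have bX : bm (fun u => enorm (X u) ^+ 2).
  apply: bm_norm2 => i.
  have -> : (fun u => X u 0 i) = fun u => D u 0 i + (alpha t * e u) * ft pb (Z t u).2 0 i
     - (omega pb (th t.+1 u) 0 i - omega pb (th t u) 0 i).
    by apply/funext => u; rewrite !mxE.
  apply: bm_sub; first apply: bm_add.
  - exact: (@adaptedW t).
  - by apply: bm_mul => //; apply: bm_mul.
  - by apply: bm_sub; apply: adaptedW; exact: omega_adapted.
(* Projecting brings the iterate no farther from the new target, a point of [Om]. The comparison
   holds only almost surely, as [X] uses the clipped cost. *)
apply: (@le_trans _ _ (mean P (fun u => enorm (X u) ^+ 2))).
  apply: mean_le_ae => //; first exact: bm_error.
  - by move=> u; exact: sqr_ge0.
  - by move=> u; exact: sqr_ge0.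
  pose I (z : sample) : set (measurableTypeR R) := [set` `[- Cm, Cm]].
  have mI z : measurable (I z) by exact: measurable_itv.
  have hI z : mu_cost pb z.2 (I z) = 1%E \/ (forall u, qlaw t u z = 0).
    have [|m0] := mu_cost_bounded bc z.2; first by left.
    by right=> u; rewrite m0 mulr0.
  apply: filterS (fresh_cost_ae obs (fresh_t t0) mI hI) => u.
  rewrite /I /= in_itv /= => /clip_id cE.
  have [_ _ _ _ /(_ t u t0) hp] := run.
  have h1 := proj_le convOm hp (inOm (th t.+1 u)).
  have -> : X u = td_step pb gamma (alpha t) (Z t u).2 (cst t u) (om t u) - omega pb (th t.+1 u).
    by rewrite td_stepE -[cst t u in RHS]cE; apply/rowP => i; rewrite !mxE /e; ring.
  by rewrite ler_pXn2r ?nnegrE ?enorm_ge0.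
pose F u := enorm (D u) ^+ 2 + 2 * alpha t * (e u * dotv (ft pb (Z t u).2) (D u))
     - 2 * dotv (D u) (J u).
have bJ : bm (fun u => dotv (D u) (J u)).
  apply: (@bm_at_sample t (fun z u => dotv (D u)
    (jac (omega pb) (th t u) (actor_move (beta t) (th t u) (om t u) z.1)))) => z.
  apply: (@adaptedW t); apply: bm_dot => // i; apply: jac_coord_adapted => // j; exact: actor_move_adapted.
have be := bm_error t0.
have b1 : bm (fun u => 2 * alpha t * (e u * dotv (ft pb (Z t u).2) (D u))).
  by apply: bm_mul => //; exact: bm_mul.
have b2 : bm (fun u => 2 * dotv (D u) (J u)) by exact: bm_mul.
have b3 : bm (fun u => enorm (D u) ^+ 2 + 2 * alpha t * (e u * dotv (ft pb (Z t u).2) (D u))).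
  exact: bm_add.
have bF : bm F by exact: bm_sub.
apply: (@le_trans _ _ (mean P (fun u => F u + critic_noise (alpha t) (beta t)))).
  apply: mean_le => //; [exact: bm_add | exact: critic_expand].
rewrite (mean_add _ bF (c _)) mean_cst lerD2r /F (mean_sub _ b3 b2) mean_add //.
rewrite (mean_scale _ _ bJ) mean_scale; last exact: bm_mul.
have h1 : alpha t * mean P (fun u => e u * dotv (ft pb (Z t u).2) (D u)) <= alpha t * (- (mu / 2) * error_mean t).
  by rewrite ler_wpM2l // mean_td_drift.
have h2 := mean_target_drift.
rewrite -/(error_mean t); lra.
Qed.

End critic_step.

Section step_sizes.
Variable s : R.
Hypothesis s0 : 0 <= s.
Hypothesis HE : H = s * (2 / mu) ^+ 2.

Local Notation sq k := (Num.sqrt (k%:R : R)).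

Definition actor_k1 := (1 - gamma) / 2.
Definition actor_k2 := K ^+ 2 / (1 - gamma).
Definition actor_k3 := `|LV| * (RO * K) ^+ 2.
(** [l] stands for [sup_grad (omega pb)], the one quantity here that varies with the instance. In
    [critic_k5], [4 * s] is [H * mu ^+ 2], so neither constant contains [mu]. *)
Definition critic_k4 (l : R) := d%:R * `|l| * (1 + 3 * K).
Definition critic_k5 (l : R) := 4 * RO * (d%:R * (4 * s * (RO * K) ^+ 2)) + 2 * (Cm + 2 * RO) ^+ 2 +
  4 * (d%:R * `|l| * (RO * K)) ^+ 2 + 4 * (d%:R * (4 * s * (RO * K) ^+ 2)) ^+ 2.

Local Notation k4 := (critic_k4 (sup_grad (omega pb))).
Local Notation k5 := (critic_k5 (sup_grad (omega pb))).

Lemma gains_ge0 : [/\ 0 < actor_k1, 0 <= actor_k2, 0 <= actor_k3 & 0 <= k4].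
Proof.
have K0 := K_ge0; have g1' := g1; split.
- by rewrite divr_gt0.
- by rewrite divr_ge0 ?sqr_ge0 // ltW.
- by rewrite mulr_ge0 ?sqr_ge0.
- by rewrite mulr_ge0 ?mulr_ge0 ?ler0n // addr_ge0 // mulr_ge0.
Qed.

Let ratio := step_ratio actor_k1 actor_k2 actor_k3 k4 BV.

Lemma ratio_gt0 : 0 < ratio.
Proof.
have [k1 k2 k3 k4p] := gains_ge0.
apply: (step_ratio_gt0 (v := fun=> 0)) => // _ _; rewrite normr0.
exact: le_trans (normr_ge0 _) (VB 0).
Qed.

Hypothesis alphaE : forall k, (0 < k)%N -> alpha k = (sq k)^-1.
Hypothesis betaE : forall k, (0 < k)%N -> beta k = ratio * mu / sq k.

Lemma ssac_window m t : (0 < m)%N -> (m < t)%N ->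
  let gain := gain_const actor_k1 actor_k2 actor_k3 k4 k5 BV ((2 * RO) ^+ 2) in
  (t%:R / 2)^-1 * (\sum_(m <= k < t) grad_mean k) <= gain * (delta ^+ 2 + mu^-1 / sq t) /\
  (t%:R / 2)^-1 * (\sum_(m <= k < t) error_mean k) <= gain * (delta ^+ 2 + mu^-1 / sq t).
Proof.
have K0 := K_ge0; have RO0 := RO_ge0; have g1' := g1.
have j0 : 0 <= jac_gain by rewrite mulr_ge0 ?ler0n.
have [k1 k2 k3 k4p] := gains_ge0.
have e0 : 0 <= d%:R * (4 * s * (RO * K) ^+ 2) by rewrite !mulr_ge0 ?ler0n ?sqr_ge0.
have k5p : 0 <= k5.
  rewrite /critic_k5; do ?apply: addr_ge0.
  - by apply: mulr_ge0 => //; apply: mulr_ge0.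
  - by apply: mulr_ge0 => //; exact: sqr_ge0.
  - by apply: mulr_ge0 => //; exact: sqr_ge0.
  - by apply: mulr_ge0 => //; exact: sqr_ge0.
have mu01 : 0 < mu < 1 by case: cond.
have /andP[mu0 mu1] := mu01.
have vB k : (0 < k)%N -> `|value_mean k| <= BV by move=> kp; apply: mean_norm => //; exact: bm_V.
have r0 := step_ratio_gt0 k1 k2 k3 k4p vB; have r1 := step_ratio_le1 k1 k2 k3 k4p vB.
rewrite -/ratio in r0 r1.
apply: (small_gain_window (v := value_mean)) => //.
- move=> k kp; have := mean_le P (bm_cst _ 0) (bm_error kp) (fun u => sqr_ge0 _).
  by rewrite mean_cst.
- move=> k kp; have := mean_le P (bm_error kp) (bm_cst _ ((2 * RO) ^+ 2)).
  rewrite mean_cst; apply => u.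
  by rewrite ler_pXn2r ?nnegrE ?enorm_ge0 ?mulr_ge0 ?error_bound.
- move=> k kp; rewrite -/ratio -betaE //; apply: le_trans (actor_recursion kp) _.
  by rewrite le_eqVlt; apply/orP; left; apply/eqP; rewrite /actor_k1 /actor_k2 /actor_k3; ring.
move=> k kp; rewrite -/ratio -betaE //; apply: le_trans (critic_recursion kp) _.
have noise : critic_noise (alpha k) (beta k) <= k5 * (sq k)^-1 ^+ 2.
  rewrite alphaE // betaE //; set q := (sq k)^-1; set b1 := RO * K.
  have q0 : 0 <= q by rewrite invr_ge0 sqrtr_ge0.
  have q1 : q <= 1 by rewrite invf_le1 ?sqrtr_gt0 ?ltr0n // -[leLHS]sqrtr1 ler_wsqrtr // ler1n.
  have b0 : 0 <= b1 by exact: mulr_ge0.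
  have rm1 : ratio * mu <= 1 by apply: mulr_ile1 => //; exact: ltW.
  set Hb := H * (ratio * mu / sq k * b1) ^+ 2.
  (* The factor [mu] in the actor step cancels the [mu ^- 2] in [H]; terms of fourth order in [q]
     are then reduced to second order by [q <= 1]. *)
  have X0 : Hb = 4 * s * b1 ^+ 2 * (ratio * q) ^+ 2.
    by rewrite /Hb HE -/q; field; rewrite lt0r_neq0.
  have rq : ratio * q <= q by rewrite ler_piMl.
  have rq0 : 0 <= ratio * q by rewrite mulr_ge0 // ltW.
  have rq2 : (ratio * q) ^+ 2 <= q ^+ 2 by rewrite ler_pXn2r.
  have X1 : d%:R * Hb <= d%:R * (4 * s * b1 ^+ 2) * q ^+ 2.
    by rewrite X0 -[leRHS]mulrA ler_wpM2l ?ler0n // ler_wpM2l // !mulr_ge0 ?sqr_ge0.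
  have X3 : 0 <= d%:R * Hb.
    rewrite X0; apply: mulr_ge0 => //; apply: mulr_ge0; last exact: sqr_ge0.
    by apply: mulr_ge0; [exact: mulr_ge0 | exact: sqr_ge0].
  have X2 : (d%:R * Hb) ^+ 2 <= (d%:R * (4 * s * b1 ^+ 2)) ^+ 2 * q ^+ 2.
    apply: (@le_trans _ _ ((d%:R * (4 * s * b1 ^+ 2) * q) ^+ 2)); last by rewrite exprMn.
    rewrite ler_pXn2r ?nnegrE //; last exact: mulr_ge0.
    by apply: le_trans X1 _; rewrite ler_wpM2l // expr2 ler_piMr.
  have J1 : (jac_gain * (ratio * mu / sq k * b1)) ^+ 2 <= (jac_gain * b1) ^+ 2 * q ^+ 2.
    rewrite -exprMn ler_pXn2r ?nnegrE ?mulr_ge0 // ?(ltW r0) ?(ltW mu0) //.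
    have -> : jac_gain * b1 * q = jac_gain * (1 * q * b1) by ring.
    by rewrite ler_wpM2l // ler_wpM2r // ler_wpM2r.
  have X4 : 4 * RO * (d%:R * Hb) <= 4 * RO * (d%:R * (4 * s * b1 ^+ 2) * q ^+ 2).
    by rewrite ler_wpM2l // mulr_ge0.
  rewrite /critic_noise /critic_k5 -/jac_gain -/b1 -/Hb -/q; rewrite -/q in J1.
  rewrite (exprMn _ q); lra.
rewrite /critic_k4 -/jac_gain -alphaE //; rewrite -alphaE // in noise; move: noise.
set N := critic_noise _ _; set M := k5 * _ => noise; lra.
Qed.

End step_sizes.

End ssac.

Theorem theorem4p1 (R : realType) (S A : finType) (n d : nat)
    (gamma Cmax C lam K K' K'' : R) (Om : set 'rV[R]_d)
    (theta1 : 'rV[R]_n) (omega1 : 'rV[R]_d) :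
  0 < gamma < 1 -> 0 <= lam < 1 -> compact Om -> convex_set Om ->
  (* the constant in O(.); it sees the problem only through the quantities
     bound above and the bounds on the first two derivatives of omega_theta *)
  exists M : R -> R -> R,
  forall (dT : measure_display) (T : measurableType dT)
         (pb : problem R S A n d T) (delta mu : R),
    bounded_costs pb Cmax ->
    uniform_mixing pb C lam ->
    smooth_policy pb K K' K'' ->
    good_features pb ->
    (forall theta, is_td_limit pb gamma theta (omega pb theta)) ->
    approximation_error pb gamma delta ->
    critic_conditioning pb gamma mu ->
    contains_critics pb Om ->
    exists c : R, 0 < c /\
    forall (dU : measure_display) (U : measurableType dU) (P : probability U R)
           (Z : nat -> U -> (S * A) * ((S * A) * (S * A))) (cst : nat -> U -> R)
           (th : nat -> U -> 'rV[R]_n) (om : nat -> U -> 'rV[R]_d),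
      is_ssac pb gamma Om theta1 omega1
        (fun t => (Num.sqrt t%:R)^-1) (fun t => c / Num.sqrt t%:R)
        P Z cst th om ->
      forall t : nat, (2 <= t)%N ->
        let bound := M (sup_grad (omega pb)) (sup_hess (omega pb)) *
                     (delta ^+ 2 + mu^-1 / Num.sqrt t%:R) in
        (((t%:R / 2)^-1)%:E *
           (\sum_(t./2 <= k < t)
              'E_P[(fun u => enorm (grad (V pb gamma) (th k u)) ^+ 2)%R])
         <= bound%:E)%E /\
        (((t%:R / 2)^-1)%:E *
           (\sum_(t./2 <= k < t)
              'E_P[(fun u => enorm (om k u - omega pb (th k u)) ^+ 2)%R])
         <= bound%:E)%E.
Proof.
move=> g01 lam01 cOm vOm.
(* [m.+1] transitions at least halve a weight of mass zero; [m] depends on [C] and [lam] alone, so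
   it may enter the constant. *)
have [m hm] : exists m, `|C| * lam ^+ m <= 2^-1 by apply: geometric_small.
have [r [_ hr]] := compact_bounded cOm.
(* Compactness bounds the sup norm by any number above [r], and [d] converts it to [enorm]. The
   maximum accounts for [omega1], which need not lie in [Om]. *)
pose RO := Num.max (d%:R * (r + 1)) (enorm omega1).
have OmB z : Om z -> enorm z <= RO.
  move=> Oz; rewrite le_max; apply/orP; left; apply: le_trans (enorm_le_norm _) _.
  by apply: ler_wpM2l => //; apply: (hr (r + 1)) Oz; rewrite ltrDl.
have om1B : enorm omega1 <= RO by rewrite le_max lexx orbT.
pose Bp := 1 + `|K'| + n%:R ^+ 3 * `|K''|.
pose Br := rho_const S A n m Bp.
pose s := `|system_const n d (moment_const S A Cmax Bp Br RO)|.
pose LV := value_const A gamma Cmax Bp.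
pose BV := `|Cmax| / (1 - gamma).
pose k1 := actor_k1 gamma; pose k2 := actor_k2 gamma K; pose k3 := actor_k3 K RO LV.
(* The second derivatives of omega are controlled through the equation it
   solves, hence the unused argument. *)
exists (fun l _ => gain_const k1 k2 k3 (critic_k4 d K l) (critic_k5 d Cmax K RO s l) BV ((2 * RO) ^+ 2)).
move=> dT T pb delta mu bc mix spi [_ phi1] td approx cond cont.
have inOm theta : Om (omega pb theta) := interior_subset (cont theta).
have pi_gt0 theta x a : 0 < policy pb theta x a by have [_ /(_ theta) []] := spi x a.
have pi_ln theta x a : enorm (grad (fun t => ln (policy pb t (x, a).1 (x, a).2)) theta) <= K.
  by have [_ /(_ theta) []] := spi x a.
have pi_der x a i (t : 'rV[R]_n) : derivable (fun t => policy pb t x a) t (delta_mx 0 i).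
  by have [[_ /(_ i) []]] := spi x a.
have sp x a : smooth Bp (fun t => policy pb t x a).
  have [cd hb] := spi x a.
  apply: c3_smooth => // t; last 2 first.
  - by have [] := hb t.
  - by have [] := hb t.
  exact: dist_le1 (policyP pb t x).
have sr x : smooth Br (fun t => rho pb t x) by apply: (rho_smooth lam01 mix).
have omE theta : bvec pb Cmax theta + omega pb theta *m (A_mx pb gamma theta)^T = 0.
  exact: (td_limit_eq g01 bc phi1 cond (td theta)).
have omB theta i : `|omega pb theta 0 i| <= RO.
  by apply: le_trans (coord_enorm _ _) _; exact: OmB.
have sw i : smooth (s * (2 / mu) ^+ 2) (fun t => omega pb t 0 i).
  apply: smooth_le (omega_smooth g01 phi1 cond sp sr omB omE i).
  by rewrite ler_wpM2r ?sqr_ge0 // ler_norm.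
have VT := V_taylor g01 bc sp; have VB := V_bound g01 bc.
(* Chosen after the instance: [c] is proportional to [mu] and uses the instance's [sup_grad], which
   the constant in O(.) receives as an argument. *)
pose c := step_ratio k1 k2 k3 (critic_k4 d K (sup_grad (omega pb))) BV * mu.
have mu0 : 0 < mu by case: cond => /andP[].
have c0 : 0 < c.
  by apply: mulr_gt0 => //; exact: (ratio_gt0 RO LV g01 pi_ln VB).
exists c; split => // dU U P Z cst th om run t t2.
have a0 k : (0 < k)%N -> 0 <= (Num.sqrt k%:R)^-1 :> R by rewrite invr_ge0 sqrtr_ge0.
have b0 k : (0 < k)%N -> 0 <= c / Num.sqrt k%:R by rewrite divr_ge0 ?sqrtr_ge0 ?ltW.
(* Times start at 1, so [2 <= t] ensures that the window avoids the meaningless index 0. *)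
have m0 : (0 < t./2)%N by rewrite half_gt0.
have mt : (t./2 < t)%N by rewrite ltn_half_double -addnn -{1}[t]addn0 ltn_add2l (ltn_trans _ t2).
have [h1 h2] := ssac_window g01 bc mix phi1 cond approx vOm cOm inOm pi_gt0 pi_der pi_ln
  sp sr sw omE OmB om1B VT VB run a0 b0 (normr_ge0 _) erefl (fun k _ => erefl) (fun k _ => erefl) m0 mt.
have conv (f : nat -> U -> R) : (forall k, (0 < k)%N -> bm (f k)) ->
    (((t%:R / 2)^-1)%:E * (\sum_(t./2 <= k < t) 'E_P[f k]) =
     ((t%:R / 2)^-1 * \sum_(t./2 <= k < t) mean P (f k))%:E)%E.
  move=> bf; rewrite EFinM -sumEFin; congr (_ * _)%E.
  rewrite big_nat_cond [RHS]big_nat_cond; apply: eq_bigr => k; rewrite andbT => /andP[mk _].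
  by rewrite (bm_expectation P (bf k (leq_trans m0 mk))).
rewrite (taylor_grad VT); split.
- rewrite conv ?lee_fin // => k k0.
  exact: (bm_grad g01 vOm cOm inOm pi_gt0 pi_der pi_ln sp OmB om1B VT run k0).
- rewrite conv ?lee_fin // => k k0.
  exact: (bm_error vOm cOm inOm pi_gt0 pi_der pi_ln sp sw OmB om1B run k0).
Qed.
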